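(* Every $3$-connected planar graph is identified by $\mathsf{C}^{(2,2)}$; that is, for every $3$-connected planar graph $G$ and every graph $H$ not isomorphic to $G$, some sentence of $\mathsf{C}^{(2,2)}$ holds in exactly one of $G$ and $H$.
   Context: First-order logic with counting $\mathsf{C}$ over graphs has atomic formulas $x=y$ and $E(x,y)$ (adjacency), Boolean connectives, and quantifiers $\forall,\exists,\exists^{\geq n}$ ($n\in\mathbb{N}$, ''at least $n$ distinct vertices''). A variable $x$ is requantified in $\varphi$ if it is both free and bound in $\varphi$, or $\varphi$ has a subformula $Qx\,\psi$ where $\psi$ has a subformula $Q'x\,\chi$ ($Q,Q'$ quantifiers). $\mathsf{C}^{(2,2)}$ is the set of $\mathsf{C}$-formulas with variables in $\{x_1,x_2,y_1,y_2\}$ in which neither $y_1$ nor $y_2$ is requantified. *)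

(* Defs.v *)
From HB Require Import structures.
From mathcomp Require Import all_boot all_order all_algebra.
From mathcomp Require Import all_classical all_reals all_analysis.

Set Implicit Arguments.
Unset Strict Implicit.
Unset Printing Implicit Defensive.

Import Order.TTheory GRing.Theory Num.Theory.
Import numFieldNormedType.Exports.

Record sgraph := SGraph {
  vertex :> finType;
  adj : rel vertex;
  adj_sym : symmetric adj;
  adj_irrefl : irreflexive adj }.

Definition isomorphic (G H : sgraph) : Prop :=
  exists2 h : G -> H, bijective h & {mono h : u v / adj u v}.

Definition edges (G : sgraph) : {set {set G}} :=
  [set [set uv.1; uv.2] | uv in [pred uv : G * G | adj uv.1 uv.2]].

Definition adj_minus (G : sgraph) (X : {set G}) : rel G :=
  [rel u v | [&& u \notin X, v \notin X & adj u v]].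

Definition k_connected (k : nat) (G : sgraph) : Prop :=
  k < #|G| /\
  forall X : {set G}, #|X| < k ->
    forall u v : G, u \notin X -> v \notin X -> connect (adj_minus X) u v.

Section Planarity.
Local Open Scope classical_set_scope.
Local Open Scope ring_scope.
Variable R : realType.

Definition is_arc (A : set (R * R)) (a b : R * R) : Prop :=
  exists g : R -> R * R,
    [/\ {within `[0, 1], continuous g},
        {in `[0, 1] &, injective g},
        g 0 = a, g 1 = b & A = g @` `[0, 1]].

Record plane_drawing (G : sgraph)
    (p : G -> R * R) (arc : {set G} -> set (R * R)) : Prop := PlaneDrawing {
  drawing_inj : injective p;
  drawing_arc : forall u v : G, adj u v ->
    is_arc (arc [set u; v]%SET) (p u) (p v);
  drawing_vertex : forall (e : {set G}) (w : G),
    e \in edges G -> arc e (p w) -> w \in e;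
  drawing_edge : forall e e' : {set G},
    e \in edges G -> e' \in edges G -> e != e' ->
    forall x, arc e x -> arc e' x -> exists2 w : G, w \in e :&: e' & x = p w }.

Definition planar (G : sgraph) : Prop :=
  exists (p : G -> R * R) (arc : {set G} -> set (R * R)), plane_drawing p arc.

End Planarity.

Inductive quantifier := All | Ex | ExGeq of nat.

Inductive formula (V : Type) :=
  | FEq of V & V
  | FAdj of V & V
  | FNot of formula V
  | FAnd of formula V & formula V
  | FOr of formula V & formula V
  | FImp of formula V & formula V
  | FQuant of quantifier & V & formula V.

Fixpoint is_free (V : eqType) (v : V) (f : formula V) : bool :=
  match f with
  | FEq u w | FAdj u w => (v == u) || (v == w)
  | FNot g => is_free v g
  | FAnd g h | FOr g h | FImp g h => is_free v g || is_free v h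
  | FQuant _ u g => (v != u) && is_free v g
  end.

Fixpoint subformula (V : Type) (g f : formula V) : Prop :=
  g = f \/
  match f with
  | FEq _ _ | FAdj _ _ => False
  | FNot h | FQuant _ _ h => subformula g h
  | FAnd h k | FOr h k | FImp h k => subformula g h \/ subformula g k
  end.

Definition is_bound (V : Type) (v : V) (f : formula V) : Prop :=
  exists q g, subformula (FQuant q v g) f.

Definition requantified (V : eqType) (v : V) (f : formula V) : Prop :=
  (is_free v f /\ is_bound v f) \/
  exists q g q' h,
    subformula (FQuant q v g) f /\ subformula (FQuant q' v h) g.

Definition sentence (V : eqType) (f : formula V) : Prop :=
  forall v : V, ~~ is_free v f.

(* Assignments are partial so that a sentence can be evaluated under the empty
   assignment, which gives the intended truth value also on the graph without
   vertices; atoms with an unassigned variable never matter for sentences. *)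
Fixpoint sat (V : eqType) (G : sgraph) (a : V -> option G) (f : formula V) :
    bool :=
  match f with
  | FEq u v => if (a u, a v) is (Some x, Some y) then x == y else false
  | FAdj u v => if (a u, a v) is (Some x, Some y) then adj x y else false
  | FNot g => ~~ sat a g
  | FAnd g h => sat a g && sat a h
  | FOr g h => sat a g || sat a h
  | FImp g h => sat a g ==> sat a h
  | FQuant q v g =>
      let P := [pred z : G | sat [eta a with v |-> Some z] g] in
      match q with
      | All => [forall z, P z]
      | Ex => [exists z, P z]
      | ExGeq n => n <= #|P|
      end
  end.

Definition holds (V : eqType) (G : sgraph) (f : formula V) : bool :=
  sat (fun _ : V => @None G) f.

(* [inl i] are the freely reusable variables x_i, [inr j] are the variables y_j
   that must not be requantified. *)
Definition var (k1 k2 : nat) : eqType := ('I_k1 + 'I_k2)%type.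

Definition in_C (k1 k2 : nat) (f : formula (var k1 k2)) : Prop :=
  forall j : 'I_k2, ~ requantified (inr j : var k1 k2) f.

(* Main.v *)
Require Import Defs.
From HB Require Import structures.
From mathcomp Require Import all_boot all_order all_algebra.
From mathcomp Require Import all_classical all_reals all_analysis.
From mathcomp Require Import ring lra zify.
From Stdlib Require Import Btauto.

(** Pin two vertices [v] and [w] on the outer face.  With the pins named by
    [y1] and [y2], the formulas that only requantify [x1] and [x2] define the
    types of the coarsest equitable partition that isolates [v] and [w].  The
    harmonic function with value 0 at [v] and 1 at [w] is constant on its cells,
    and the vertices of one height that are met by parallel strands from [v] to
    [w] are linearly ordered by the drawing.  Equitability is compatible with
    this order, so a cell has at most two vertices and the partition is the orbit
    partition of a reflection: the vertices moved by it form two sheets glued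
    along the fixed ones.  A graph [H] with the same sentences therefore arises
    from [G] by exchanging some of the edges within and between the sheets, and
    equality of the numbers of closed walks forces the exchange to be a
    relabelling.

    Of the drawing only parities of crossings with horizontal rays are used.
    They are computed on polygons inscribed in the arcs; a fine enough polygon
    of one curve misses every curve disjoint from it, and since only finitely
    many parity patterns exist, one of them occurs for arbitrarily fine
    polygons. *)

(** Equal types over the pins give only a bijection that keeps the numbers of neighbours in each
    cell, and [H] is not known to be planar; all geometry is therefore spent on [G], and the passage
    to [H] is algebra. With cells of at most two vertices the walk matrices of both graphs commute
    with the involution and split into an even part, fixed by neighbour counts, and an odd part on
    one sheet. The odd matrices agree up to signs and that of [G] is non-negative, so equal traces
    of all powers leave only sign patterns produced by swapping pairs. Traces are visible to the
    logic: with both pins placed at [t], the type of [t] determines its closed walks, and one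
    counting quantifier on [y1] counts the vertices of that type. Harmonic heights are used for the
    maximum principle: it makes the vertices below and those above a level connected, hence hubs
    joined by strands through that level. Parities alone do not order the strands: among three of
    them the number enclosed by the other two is only known to be odd. That it is not three needs
    one piece of metric information, a point of a theta graph that is extreme in some direction. *)

Set Implicit Arguments.
Unset Strict Implicit.
Unset Printing Implicit Defensive.

Import Order.TTheory GRing.Theory Num.Theory.
Import numFieldNormedType.Exports.

(** * Connected vertex sets *)

Section Connected.
Variables (V : finType) (e : rel V).
Hypothesis e_sym : symmetric e.

Definition induced (A : {set V}) : rel V := [rel x y | [&& x \in A, y \in A & e x y]].

Definition vconnected (A : {set V}) :=
  forall x y, x \in A -> y \in A -> connect (induced A) x y.

Definition adjacent_to (x : V) (A : {set V}) := [exists y in A, e x y].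

Lemma induced_sym A : symmetric (induced A).
Proof. by move=> x y; rewrite /induced /= e_sym andbCA. Qed.

Lemma induced_walk (A : {set V}) x y : x \in A -> connect (induced A) x y ->
  exists p, [/\ path e x p, last x p = y & {subset x :: p <= A}].
Proof.
move=> xA /connectP[p pp ->]; exists p; elim: p x xA pp => [|z p IH] x xA /=.
  by split=> // t; rewrite inE => /eqP->.
case/andP=> /and3P[_ zA exz] pp; have [pz _ sub] := IH z zA pp.
by split=> //; [rewrite exz | move=> t; rewrite inE => /predU1P[->|/sub]].
Qed.

Lemma walk_induced (A : {set V}) x p :
  path e x p -> {subset x :: p <= A} -> connect (induced A) x (last x p).
Proof.
elim: p x => [|z p IH] x /=; first by rewrite connect0.
case/andP=> exz pp sub; apply: (@connect_trans _ _ z).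
  by apply: connect1; rewrite /induced /= exz !sub ?inE ?eqxx ?orbT.
by apply: IH => // t tz; apply: sub; rewrite inE tz orbT.
Qed.

Lemma connected_walk A x y : vconnected A -> x \in A -> y \in A ->
  exists p, [/\ path e x p, last x p = y & {subset x :: p <= A}].
Proof. by move=> cA xA yA; apply: induced_walk => //; apply: cA. Qed.

Definition vcomponent (A : {set V}) x := [set y in A | connect (induced A) x y].

Lemma component_connected A x : vconnected (vcomponent A x).
Proof.
move=> y z yC; rewrite inE => /andP[zA xz].
have yz : connect (induced A) y z.
  rewrite inE in yC; case/andP: yC => _ xy.
  by apply: connect_trans xz; rewrite (sym_connect_sym (induced_sym A)).
case/connectP: yz => p pp ->; elim: p y yC pp => [|t p IH] y yC /=.
  by rewrite connect0.
case/andP=> yt pp; have tC : t \in vcomponent A x.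
  move: yC; rewrite !inE => /andP[_ xy]; case/and3P: (yt) => _ -> _ /=.
  exact: connect_trans xy (connect1 yt).
apply: connect_trans (IH t tC pp); apply: connect1.
by case/and3P: yt => _ _ eyt; rewrite /induced /= yC tC.
Qed.

Lemma mem_component (A : {set V}) x : x \in A -> x \in vcomponent A x.
Proof. by move=> xA; rewrite inE xA connect0. Qed.

Lemma component_sub (A : {set V}) x : {subset vcomponent A x <= A}.
Proof. by move=> y; rewrite inE => /andP[]. Qed.

Lemma component_closed (A : {set V}) x y z :
  y \in vcomponent A x -> z \in A -> e y z -> z \in vcomponent A x.
Proof.
rewrite !inE => /andP[yA xy] zA eyz; rewrite zA; apply: connect_trans xy _.
by apply: connect1; rewrite /induced /= yA zA.
Qed.

End Connected.

(** * Mod 2 crossing certificates *)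

Lemma addb_xorb a b : a (+) b = xorb a b. Proof. by case: a b => [] []. Qed.

(** Parity identities are treated as linear equations over the two-element field: a goal follows
    from known equations if the xor of all sides involved vanishes identically, which [btauto]
    decides. *)
Lemma xor_elim1 (a b c d : bool) :
  a = b -> xorb (xorb c d) (xorb a b) = false -> c = d.
Proof. by case: a b c d => [] [] [] []. Qed.

Lemma xor_elim2 (a b a' b' c d : bool) : a = b -> a' = b' ->
  xorb (xorb c d) (xorb (xorb a b) (xorb a' b')) = false -> c = d.
Proof. by case: a b a' b' c d => [] [] [] [] [] []. Qed.

Lemma xor_elim3 (a b a' b' a'' b'' c d : bool) : a = b -> a' = b' -> a'' = b'' ->
  xorb (xorb c d) (xorb (xorb a b) (xorb (xorb a' b') (xorb a'' b''))) = false ->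
  c = d.
Proof. by move=> -> -> ->; case: b b' b'' c d => [] [] [] [] []. Qed.

Ltac xor_solve := rewrite !addb_xorb -?[~~ _]/(negb _); btauto.

Section Certificate.
Variables (V : finType) (e : rel V) (r : V -> V -> V -> bool) (s : V -> V -> bool).
Hypothesis e_sym : symmetric e.
(** For disjoint segments, the right rays from [x] and [y] to [ab] and the left rays from [a] and
    [b] to [xy] hit their targets an even number of times in total. The terms in [s] turn left rays
    into right rays. *)
Hypothesis crossing : forall a b x y, e a b -> e x y ->
  a != x -> a != y -> b != x -> b != y ->
  r x a b (+) r y a b (+) r a x y (+) r b x y =
  s a x (+) s a y (+) s b x (+) s b y.
Hypothesis s_asym : forall a b, a != b -> s a b = ~~ s b a.

Fixpoint wind (x a : V) (p : seq V) : bool :=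
  if p is b :: q then r x a b (+) wind x b q else false.

Lemma wind_cat x a p q : wind x a (p ++ q) = wind x a p (+) wind x (last a p) q.
Proof. by elim: p a => //= b p IH a; rewrite IH addbA. Qed.

Definition apart (A B : seq V) := forall x, x \in A -> x \notin B.

Lemma crossing_edge_walk a b x q : e a b -> path e x q ->
  apart [:: a; b] (x :: q) ->
  r x a b (+) r (last x q) a b (+) wind a x q (+) wind b x q =
  s a x (+) s a (last x q) (+) s b x (+) s b (last x q).
Proof.
move=> eab; elim: q x => [|y q IH] x /=.
  by move=> _ _; case: (r x a b); case: (s a x); case: (s b x).
case/andP=> exy pq ap.
have sub u : u \in [:: a; b] -> u \notin y :: q.
  by move/ap; rewrite inE negb_or => /andP[].
have ne u : u \in [:: a; b] -> (u != x) /\ (u != y).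
  by move/ap; rewrite !inE !negb_or => /and3P[].
have [ax ay] := ne a (mem_head _ _).
have [bx by_] : (b != x) /\ (b != y) by apply: ne; rewrite !inE eqxx orbT.
apply: (xor_elim2 (IH y pq sub) (crossing eab exy ax ay bx by_)); xor_solve.
Qed.

Lemma crossing_walks a p x q : path e a p -> path e x q ->
  apart (a :: p) (x :: q) ->
  wind x a p (+) wind (last x q) a p (+) wind a x q (+) wind (last a p) x q =
  s a x (+) s a (last x q) (+) s (last a p) x (+) s (last a p) (last x q).
Proof.
elim: p a => [|b p IH] a /=.
  by move=> _ _ _; case: (wind _ _ _); case: (s _ _); case: (s _ _).
case/andP=> eab pp pq ap.
have ap1 : apart (b :: p) (x :: q).
  by move=> u ub; apply: ap; rewrite inE ub orbT.
have ap2 : apart [:: a; b] (x :: q).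
  by move=> u; rewrite !inE => /orP[]/eqP->; apply: ap; rewrite !inE eqxx ?orbT.
apply: (xor_elim2 (IH b pp pq ap1) (crossing_edge_walk eab pq ap2)); xor_solve.
Qed.

(** For walks with common ends this is the winding number modulo 2 around [x] of the closed curve
    that they form. *)
Definition curve_index x a p q := wind x a p (+) wind x a q.

(** Moving from [x] to [y] changes the parity of each walk by an amount that depends only on the
    ends of that walk, and the ends are common. *)
Lemma index_step x y a p q : path e a p -> path e a q -> last a p = last a q ->
  e x y -> x \notin a :: p -> y \notin a :: p -> x \notin a :: q ->
  y \notin a :: q -> curve_index x a p q = curve_index y a p q.
Proof.
move=> pp pq lpq exy xp yp xq yq.
have H t : path e a t -> x \notin a :: t -> y \notin a :: t ->
  wind x a t (+) wind y a t (+) r a x y (+) r (last a t) x y =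
  s a x (+) s a y (+) s (last a t) x (+) s (last a t) y.
  move=> pt xt yt; have := @crossing_walks a t x [:: y] pt.
  rewrite /= andbT !addbF; apply=> // u ut; rewrite !inE negb_or.
  by apply/andP; split; [apply: contraNneq xt | apply: contraNneq yt] => <-.
apply: (xor_elim2 (H p pp xp yp) (H q pq xq yq)); rewrite lpq /curve_index; xor_solve.
Qed.

Lemma index_connect (A : {set V}) x y a p q :
  path e a p -> path e a q -> last a p = last a q ->
  {in A, forall z, (z \notin a :: p) && (z \notin a :: q)} ->
  connect (induced e A) x y -> curve_index x a p q = curve_index y a p q.
Proof.
move=> pp pq lpq off /connectP[t pt ->].
elim: t x pt => //= z t IH x /andP[/and3P[xA zA exz] pt].
rewrite -(IH z pt); case/andP: (off x xA) => ? ?; case/andP: (off z zA) => ? ?.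
exact: index_step.
Qed.

Section Theta.
Variables (a b : V).
Hypothesis ab : a != b.

Definition strand (x : V) (p q : seq V) :=
  [/\ path e a p, last a p = x, path e x q & last x q = b].

Lemma strand_path x p q : strand x p q ->
  path e a (p ++ q) /\ last a (p ++ q) = b.
Proof. by case=> pp lp pq lq; rewrite cat_path last_cat pp lp pq lq. Qed.

(** Cross the first half of each strand with the second half of the other and add the two
    identities. What remains is one term per strand plus a constant 1, which comes from the
    antisymmetry of [s]; in [theta] every strand term occurs twice and the three constants leave
    1. *)
Lemma crossing_strands x p q y p' q' :
  strand x p q -> strand y p' q' ->
  apart (a :: p) (y :: q') -> apart (a :: p') (x :: q) ->
  wind y a (p ++ q) (+) wind x a (p' ++ q') =
  ~~ ((wind b a p (+) wind a x q (+) s x a (+) s x b)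
  (+) (wind b a p' (+) wind a y q' (+) s y a (+) s y b)).
Proof.
move=> [pp lp pq lq] [pp' lp' pq' lq'] ap1 ap2.
have xp : x \in a :: p by rewrite -lp mem_last.
have yp : y \in a :: p' by rewrite -lp' mem_last.
have bq : b \in x :: q by rewrite -lq mem_last.
have bq' : b \in y :: q' by rewrite -lq' mem_last.
have ay : a != y by apply: contraNneq (ap1 a (mem_head _ _)) => ->; rewrite mem_head.
have ax : a != x by apply: contraNneq (ap2 a (mem_head _ _)) => ->; rewrite mem_head.
have xb : x != b by apply: contraNneq (ap1 x xp) => ->.
have yb : y != b by apply: contraNneq (ap2 y yp) => ->.
have xy : x != y by apply: contraNneq (ap1 x xp) => ->; rewrite mem_head.
apply: (xor_elim2 (crossing_walks pp pq' ap1) (crossing_walks pp' pq ap2)).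
rewrite !wind_cat lp lp' lq lq' (s_asym ay) (s_asym ab) (s_asym ax) (s_asym xy).
rewrite (s_asym xb) (s_asym yb); xor_solve.
Qed.

(* The mod 2 form of the statement that, of three parallel curves, exactly one
   runs inside the closed curve formed by the other two. *)
Lemma theta x p q y p' q' z p'' q'' :
  strand x p q -> strand y p' q' -> strand z p'' q'' ->
  apart (a :: p) (y :: q') -> apart (a :: p) (z :: q'') ->
  apart (a :: p') (x :: q) -> apart (a :: p') (z :: q'') ->
  apart (a :: p'') (x :: q) -> apart (a :: p'') (y :: q') ->
  curve_index x a (p' ++ q') (p'' ++ q'') (+) curve_index y a (p ++ q) (p'' ++ q'')
    (+) curve_index z a (p ++ q) (p' ++ q').
Proof.
move=> sx sy sz xy xz yx yz zx zy.
apply: (xor_elim3 (crossing_strands sx sy xy yx) (crossing_strands sx sz xz zx)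
  (crossing_strands sy sz yz zy)); rewrite /curve_index; xor_solve.
Qed.

End Theta.

Lemma connected_leg (A : {set V}) a x : vconnected e A -> a \in A ->
  adjacent_to e x A -> exists p, [/\ path e a p, last a p = x &
    {subset a :: p <= x |: A}].
Proof.
move=> cA aA /exists_inP[y yA exy].
have [p [pp lp sub]] := connected_walk cA aA yA.
exists (rcons p x); rewrite rcons_path last_rcons pp lp e_sym exy; split=> //.
move=> t; rewrite -rcons_cons mem_rcons inE => /predU1P[->|/sub tA];
  by rewrite !inE ?eqxx ?tA ?orbT.
Qed.

(** Strands from [A] to [B] through [x], [y], [z] satisfy [theta]. Connectivity of [C] moves all
    three base points to one vertex [c], where the three indices are the pairwise sums of three
    parities and so add up to 0. *)
Lemma no_K33 (A B C : {set V}) x y z :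
  vconnected e A -> vconnected e B -> vconnected e C ->
  [disjoint A & B] -> [disjoint A & C] -> [disjoint B & C] ->
  uniq [:: x; y; z] ->
  (forall t, t \in [:: x; y; z] -> t \notin A :|: B :|: C) ->
  (forall t, t \in [:: x; y; z] ->
     [/\ adjacent_to e t A, adjacent_to e t B & adjacent_to e t C]) -> False.
Proof.
move=> cA cB cC dAB dAC dBC uxyz off adjs.
have xs : x \in [:: x; y; z] by rewrite !inE eqxx.
have ys : y \in [:: x; y; z] by rewrite !inE eqxx orbT.
have zs : z \in [:: x; y; z] by rewrite !inE eqxx !orbT.
have [/exists_inP[a aA _] /exists_inP[b bB _] _] := adjs x xs.
have [c cC'] : exists c, c \in C by have [_ _ /exists_inP[c]] := adjs x xs; exists c.
have ab : a != b.
  by apply: contraTneq aA => ->; rewrite (disjointFl dAB bB).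
have H t : t \in [:: x; y; z] -> exists p q, strand a b t p q /\
    ({subset a :: p <= t |: A} /\ {subset t :: q <= t |: B}).
  move=> ts; have [tA tB _] := adjs t ts.
  have [p [pp lp sp]] := connected_leg cA aA tA.
  have [u uB etu] := exists_inP tB.
  have [q [pq lq sq]] := connected_walk cB uB bB.
  exists p, (u :: q); split; first by split=> //=; rewrite etu.
  by split=> // w; rewrite !in_cons => /predU1P[->|wq];
    rewrite !inE ?eqxx // (sq w) ?orbT // in_cons.
have ap t u p q : t \in [:: x; y; z] -> u \in [:: x; y; z] -> t != u ->
    {subset a :: p <= t |: A} -> {subset u :: q <= u |: B} ->
    apart (a :: p) (u :: q).
  move=> ts us tu sp sq w /sp; rewrite !inE => wt; apply/negP => /sq; rewrite !inE.
  have := off t ts; have := off u us; rewrite !inE !negb_or.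
  move=> /andP[/andP[uA uB] _] /andP[/andP[tA tB] _].
  case/predU1P: wt => [->|wA]; first by rewrite (negbTE tu) (negbTE tB).
  by rewrite (disjointFr dAB wA) orbF => /eqP wu; rewrite -wu wA in uA.
have [p1 [q1 [s1 [a1 b1]]]] := H x xs.
have [p2 [q2 [s2 [a2 b2]]]] := H y ys.
have [p3 [q3 [s3 [a3 b3]]]] := H z zs.
move: uxyz; rewrite /= !inE negb_or andbT => /andP[/andP[xy xz] yz].
have yx : y != x by rewrite eq_sym.
have zx : z != x by rewrite eq_sym.
have zy : z != y by rewrite eq_sym.
have := theta ab s1 s2 s3 (ap _ _ _ _ xs ys xy a1 b2) (ap _ _ _ _ xs zs xz a1 b3)
  (ap _ _ _ _ ys xs yx a2 b1) (ap _ _ _ _ ys zs yz a2 b3)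
  (ap _ _ _ _ zs xs zx a3 b1) (ap _ _ _ _ zs ys zy a3 b2).
have idx t u u' p q p' q' : t \in [:: x; y; z] -> u \in [:: x; y; z] ->
    u' \in [:: x; y; z] -> t != u -> t != u' ->
    strand a b u p q -> strand a b u' p' q' ->
    {subset a :: p <= u |: A} -> {subset u :: q <= u |: B} ->
    {subset a :: p' <= u' |: A} -> {subset u' :: q' <= u' |: B} ->
    curve_index t a (p ++ q) (p' ++ q') = curve_index c a (p ++ q) (p' ++ q').
  move=> ts us us' tu tu' st st' sp sq sp' sq'.
  have [pp lp] := strand_path st; have [pp' lp'] := strand_path st'.
  have [_ _ tC] := adjs t ts; have [d dC etd] := exists_inP tC.
  have offw v w m n : t != v -> v \in [:: x; y; z] -> w \in t |: C ->
      {subset a :: m <= v |: A} -> {subset v :: n <= v |: B} ->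
      w \notin a :: m ++ n.
    move=> tv vs wC sm sn; have nt := off t ts; have nv := off v vs.
    rewrite !inE !negb_or in nt nv.
    case/andP: nv => /andP[vA vB] vC; case/andP: nt => /andP[tA tB] tC'.
    have wv : w != v.
      move: wC; rewrite !inE => /predU1P[->//|wC].
      by apply: contraNneq vC => <-.
    have wA : w \notin A.
      move: wC; rewrite !inE => /predU1P[->//|wC].
      by rewrite (disjointFl dAC wC).
    have wB : w \notin B.
      move: wC; rewrite !inE => /predU1P[->//|wC].
      by rewrite (disjointFl dBC wC).
    rewrite -cat_cons mem_cat negb_or; apply/andP; split; apply/negP => h.
      by have := sm w h; rewrite !inE (negbTE wv) (negbTE wA).
    have /sn : w \in v :: n by rewrite in_cons h orbT.
    by rewrite !inE (negbTE wv) (negbTE wB).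
  apply: (@index_connect (t |: C)) => //; first by rewrite lp lp'.
    by move=> w wC; apply/andP; split; [apply: (offw u) | apply: (offw u')].
  apply: (@connect_trans _ _ d).
    by apply: connect1; rewrite /induced /= !inE eqxx dC etd orbT.
  apply: connect_sub (cC d c dC cC') => m n /and3P[mC nC emn].
  by apply: connect1; rewrite /induced /= !inE mC nC emn !orbT.
rewrite (idx x y z) // (idx y x z) // (idx z x y) // /curve_index.
by do 3![case: (wind c a _)].
Qed.

End Certificate.

(** * Branching paths inside a connected set *)

Section Tripod.
Variables (V : finType) (e : rel V).
Hypothesis e_sym : symmetric e.

Lemma path_rev x p : path e x p ->
  path e (last x p) (rev (belast x p)) /\ last (last x p) (rev (belast x p)) = x.
Proof.
move=> pp; split.
  by rewrite rev_path (eq_path (e' := e)) // => a b; rewrite /= e_sym.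
by case: p pp => //= z p _; rewrite rev_cons last_rcons.
Qed.

Lemma path_split x p y : path e x p -> y \in x :: p ->
  exists s t, [/\ path e y s, last y s = x, path e y t, last y t = last x p &
    x :: p = rev s ++ y :: t].
Proof.
move=> pp yp; case/splitPl: yp pp => p1 p2 lp1.
rewrite cat_path => /andP[/path_rev]; rewrite lp1 => -[pp1 ll] pp2.
exists (rev (belast x p1)), p2; rewrite revK last_cat lp1.
by split=> //; rewrite -cat_cons lastI lp1 cat_rcons.
Qed.

Lemma first_hit (L : seq V) x q : last x q \in L ->
  exists q1 q2, [/\ q = q1 ++ q2, last x q1 \in L &
    {in belast x q1, forall z, z \notin L}].
Proof.
elim: q x => [|y q IH] x /=; first by move=> xL; exists [::], [::].
move=> lq; case: (boolP (x \in L)) => xL; first by exists [::], (y :: q).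
have [q1 [q2 [-> l1 b1]]] := IH y lq.
exists (y :: q1), q2; split=> // z; rewrite /= inE => /predU1P[->//|]; exact: b1.
Qed.

(** Take a path from [a1] to [a2] and a path from [a3] cut at its first vertex [b] on the former.
    Disjoint legs are what turns three strands into a simple theta in [hub_theta]. *)
Lemma tripod (A : {set V}) a1 a2 a3 : vconnected e A ->
  a1 \in A -> a2 \in A -> a3 \in A ->
  exists b l1 l2 l3, [/\ uniq (b :: l1 ++ l2 ++ l3),
    {subset b :: l1 ++ l2 ++ l3 <= A},
    [/\ path e b l1, path e b l2 & path e b l3] &
    [/\ last b l1 = a1, last b l2 = a2 & last b l3 = a3]].
Proof.
move=> cA A1 A2 A3.
have U x y : x \in A -> y \in A -> exists p, [/\ path e x p, last x p = y,
    uniq (x :: p) & {subset x :: p <= A}].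
  move=> xA yA; have [p [pp lp sp]] := connected_walk cA xA yA.
  case/shortenP: pp lp => p' pp' up' sub lp; exists p'; split=> // z.
  by rewrite inE => /predU1P[->//|/sub zp]; apply: sp; rewrite inE zp orbT.
have [p [pp lp up sp]] := U _ _ A1 A2; have [q [pq lq uq sq]] := U _ _ A3 A1.
have lqp : last a3 q \in a1 :: p by rewrite lq mem_head.
have [q1 [q2 [eq lq1 bq1]]] := first_hit lqp.
have [s [t [ps ls pt lt est]]] := path_split pp lq1.
have pq1 : path e a3 q1 by move: pq; rewrite eq cat_path => /andP[].
have uq1 : uniq (belast a3 q1).
  move: uq; rewrite eq -cat_cons cat_uniq => /and3P[].
  by rewrite lastI rcons_uniq => /andP[].
have [ps3 ls3] := path_rev pq1; move: (last a3 q1) lq1 ps ls pt lt est ps3 ls3.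
move=> b lq1 ps ls pt lt est ps3 ls3.
have P : perm_eq (b :: s ++ t ++ rev (belast a3 q1)) ((a1 :: p) ++ belast a3 q1).
  rewrite est catA -cat_cons perm_sym.
  apply: perm_cat; last by rewrite perm_sym perm_rev.
  by rewrite perm_catC /= perm_cons perm_catC perm_cat2r perm_rev.
exists b, s, t, (rev (belast a3 q1)); split=> //; last by rewrite ls lt lp ls3.
- rewrite (perm_uniq P) cat_uniq up uq1 andbT; apply/hasPn => z; exact: bq1.
- move=> z; rewrite (perm_mem P) mem_cat => /orP[/sp//|zq].
  by apply: sq; rewrite eq -cat_cons mem_cat lastI mem_rcons inE zq orbT.
Qed.

Lemma path_connect x p y z : path e x p -> y \in x :: p -> z \in x :: p ->
  connect (induced e [set t in x :: p]) y z.
Proof.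
move=> pp; have H t : t \in x :: p -> connect (induced e [set t in x :: p]) x t.
  move=> tp; case/splitPl: tp pp => p1 p2 lp1; rewrite cat_path => /andP[pp1 _].
  rewrite -lp1; apply: walk_induced => // u; rewrite !inE mem_cat.
  by case/predU1P=> [->|->]; rewrite ?eqxx ?orbT.
move=> yp zp; apply: connect_trans (H z zp).
by rewrite (sym_connect_sym (induced_sym e_sym _)) H.
Qed.

End Tripod.

(** * The order of parallel strands *)

Section Apex.
Variables (G : sgraph) (v w : G).

Definition apex_adj : rel (option G) := fun a b =>
  match a, b with
  | Some x, Some y => adj x y
  | None, Some x | Some x, None => (x == v) || (x == w)
  | None, None => false
  end.

Lemma apex_adj_sym : symmetric apex_adj.
Proof. by move=> [a|] [b|] //=; exact: adj_sym. Qed.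

(** For such a triple [theta] leaves open whether one or all three indices are 1; the last clause of
    the certificate rules out the second case, which no parity count does. *)
Definition simple_theta (b c : G) (p1 p2 p3 : seq G) :=
  [/\ uniq (b :: c :: p1 ++ p2 ++ p3), [&& p1 != [::], p2 != [::] & p3 != [::]] &
      [/\ path (@adj G) b (rcons p1 c), path (@adj G) b (rcons p2 c) &
          path (@adj G) b (rcons p3 c)]].

(* Combinatorial residue of a drawing of [G] with [v] and [w] on the outer face
   and an apex [None] drawn outside and joined to both: [r x a b] is the parity
   of the crossings of the edge [ab] with the ray from [x] to the right and
   [s a b] says that [a] lies below [b]. *)
Definition planar_certificate (r : option G -> option G -> option G -> bool)
    (s : option G -> option G -> bool) :=
  [/\ forall a b x y, apex_adj a b -> apex_adj x y ->
        a != x -> a != y -> b != x -> b != y ->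
        r x a b (+) r y a b (+) r a x y (+) r b x y =
        s a x (+) s a y (+) s b x (+) s b y,
      forall a b, a != b -> s a b = ~~ s b a,
      forall a b : G, adj a b -> r None (Some a) (Some b) = false &
      forall b c p1 p2 p3, simple_theta b c p1 p2 p3 ->
        let idx x p q := curve_index r (Some x) (Some b) (map Some (rcons p c))
                           (map Some (rcons q c)) in
        [\/ exists2 x, x \in p1 & idx x p2 p3 = false,
            exists2 x, x \in p2 & idx x p1 p3 = false |
            exists2 x, x \in p3 & idx x p1 p2 = false]].

End Apex.

Lemma perm_theta (T : eqType) (b c x y z : T) (l1 l2 l3 m1 m2 m3 : seq T) :
  perm_eq (b :: c :: (l1 ++ x :: rev m1) ++ (l2 ++ y :: rev m2) ++ (l3 ++ z :: rev m3))
    ((b :: l1 ++ l2 ++ l3) ++ (c :: m1 ++ m2 ++ m3) ++ [:: x; y; z]).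
Proof.
apply/permP => pr; rewrite /= !count_cat /= !count_cat /= !count_rev.
move: (nat_of_bool (pr b)) (nat_of_bool (pr c)) (nat_of_bool (pr x)) => nb nc nx.
move: (nat_of_bool (pr y)) (nat_of_bool (pr z)) => ny nz.
move: (count pr l1) (count pr l2) (count pr l3) => k1 k2 k3.
by move: (count pr m1) (count pr m2) (count pr m3) => j1 j2 j3; lia.
Qed.

Section HubOrder.
Variables (G : sgraph) (v w : G).
Variables (r : option G -> option G -> option G -> bool).
Variables (s : option G -> option G -> bool).
Hypothesis cert : planar_certificate v w r s.

Notation V := (option G).
Notation e := (apex_adj v w).
Notation idx := (curve_index r).

Let e_sym := @apex_adj_sym G v w.
Let crossing := let: And4 c _ _ _ := cert in c.
Let s_asym := let: And4 _ c _ _ := cert in c.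

Lemma wind_apex (a : V) p : a != None -> None \notin p -> path e a p ->
  wind r None a p = false.
Proof.
case: cert => _ _ out _; elim: p a => //= b p IH [a|] // _.
rewrite inE negb_or => /andP[nb np] /andP[eab pp].
case: b nb eab pp => // b _ eab pp; rewrite out // IH //.
Qed.

Section Hubs.
Variables A B : {set G}.
Hypothesis connA : vconnected (@adj G) A.
Hypothesis connB : vconnected (@adj G) B.
Hypothesis AB : [disjoint A & B].
Hypothesis vA : v \in A.
Hypothesis wB : w \in B.

Definition crosses (d : G) :=
  [/\ d \notin A, d \notin B, adjacent_to (@adj G) d A & adjacent_to (@adj G) d B].

Definition strand_of d (p q : seq G) :=
  [/\ path (@adj G) v p, last v p = d, path (@adj G) d q, last d q = w &
      {subset v :: p <= d |: A} /\ {subset d :: q <= d |: B}].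

Lemma strand_exists d : crosses d -> exists p q, strand_of d p q.
Proof.
case=> dA dB adA adB.
have [p [pp lp sp]] := connected_leg (@adj_sym G) connA vA adA.
have [u uB edu] := exists_inP adB.
have [q [pq lq sq]] := connected_walk connB uB wB.
exists p, (u :: q); split=> //=; first by rewrite edu.
split=> // z; rewrite in_cons => /predU1P[->|/sq zB]; by rewrite !inE ?eqxx ?zB ?orbT.
Qed.

Definition sw (p : seq G) : seq V := map Some p.

Lemma path_sw a p : path (@adj G) a p -> path e (Some a) (sw p).
Proof. by elim: p a => //= b p IH a /andP[-> /IH]. Qed.

Lemma last_sw a p : last (Some a) (sw p) = Some (last a p).
Proof. by rewrite last_map. Qed.

Lemma mem_sw x p : (Some x \in sw p) = (x \in p).
Proof. by rewrite mem_map // => ? ? []. Qed.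

Lemma sw_cat p q : sw (p ++ q) = sw p ++ sw q.
Proof. exact: map_cat. Qed.

Lemma None_sw p : None \notin sw p.
Proof. by apply/mapP => -[]. Qed.

Lemma strand_sw d p q : strand_of d p q ->
  strand e (Some v) (Some w) (Some d) (sw p) (sw q).
Proof.
by case=> pp lp pq lq _; split; rewrite ?last_sw ?lp ?lq //; apply: path_sw.
Qed.

Lemma vw_neq : v != w.
Proof. by apply: contraTneq vA => ->; rewrite (disjointFl AB wB). Qed.

Definition outer : seq V := [:: None; Some w].

Lemma outer_path : path e (Some v) outer.
Proof. by rewrite /= !eqxx !orbT. Qed.

Lemma induced_sw (C : {set G}) x y : connect (induced (@adj G) C) x y ->
  connect (induced e [set t | if t is Some z then z \in C else true]) (Some x) (Some y).
Proof.
case/connectP=> p pp ->; elim: p x pp => //= z p IH x /andP[/and3P[xC zC exz] pp].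
apply: connect_trans (IH z pp); apply: connect1.
by rewrite /induced /= !inE xC zC.
Qed.

(* Two curves through the hub [A] bound no region seen from a strand, because
   the other hub and the apex lie outside of it. *)
Lemma index_hubA (x d : G) p p' : crosses x -> x != d -> d \notin B ->
  path (@adj G) v p -> path (@adj G) v p' -> last v p = last v p' ->
  {subset v :: p <= d |: A} -> {subset v :: p' <= d |: A} ->
  idx (Some x) (Some v) (sw p) (sw p') = false.
Proof.
move=> [xA xB adA adB] xd dB pp pp' lpp sp sp'.
have off z t : {subset v :: t <= d |: A} -> z != d -> z \notin A ->
    Some z \notin Some v :: sw t.
  move=> st zd zA; rewrite -[_ :: _]/(sw (v :: t)) mem_sw; apply/negP => /st.
  by rewrite !inE (negbTE zd) (negbTE zA).
have offB z t : {subset v :: t <= d |: A} -> z \in B -> Some z \notin Some v :: sw t.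
  move=> st zB; apply: off => //; last by rewrite (disjointFl AB zB).
  by apply: contraNneq dB => <-.
have offN t : None \notin Some v :: sw t by rewrite -[_ :: _]/(sw (v :: t)) None_sw.
have : idx None (Some v) (sw p) (sw p') = false.
  by rewrite /curve_index !wind_apex ?None_sw //; apply: path_sw.
move=> <-; pose C := [set t | if t is Some z then (z == x) || (z \in B) else true].
apply: (@index_connect _ e r s crossing C) => //; rewrite ?last_sw ?lpp //.
- exact: path_sw.
- exact: path_sw.
- move=> [z|]; rewrite inE ?offN // => /predU1P[->|zB]; [by rewrite !off | by rewrite !offB].
have [u uB exu] := exists_inP adB.
apply: (@connect_trans _ _ (Some u)).
  by apply: connect1; rewrite /induced /= !inE eqxx uB exu orbT.
apply: (@connect_trans _ _ (Some w)).
  apply: connect_sub (induced_sw (connB uB wB)) => a b /and3P[aC bC eab].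
  apply: connect1; rewrite /induced /=; move: aC bC; rewrite !inE eab.
  by case: a b {eab} => [a|] [b|] //= aB bB; rewrite ?aB ?bB ?orbT.
by apply: connect1; rewrite /induced /= !inE wB eqxx !orbT.
Qed.

Lemma index_hubB (x d : G) q q' : crosses x -> x != d -> d \notin A ->
  path (@adj G) d q -> path (@adj G) d q' -> last d q = last d q' ->
  {subset d :: q <= d |: B} -> {subset d :: q' <= d |: B} ->
  idx (Some x) (Some d) (sw q) (sw q') = false.
Proof.
move=> [xA xB adA adB] xd dA pp pp' lpp sp sp'.
have off z t : {subset d :: t <= d |: B} -> z != d -> z \notin B ->
    Some z \notin Some d :: sw t.
  move=> st zd zB; rewrite -[_ :: _]/(sw (d :: t)) mem_sw; apply/negP => /st.
  by rewrite !inE (negbTE zd) (negbTE zB).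
have offA z t : {subset d :: t <= d |: B} -> z \in A -> Some z \notin Some d :: sw t.
  move=> st zA; apply: off => //; last by rewrite (disjointFr AB zA).
  by apply: contraNneq dA => <-.
have offN t : None \notin Some d :: sw t by rewrite -[_ :: _]/(sw (d :: t)) None_sw.
have : idx None (Some d) (sw q) (sw q') = false.
  by rewrite /curve_index !wind_apex ?None_sw //; apply: path_sw.
move=> <-; pose C := [set t | if t is Some z then (z == x) || (z \in A) else true].
apply: (@index_connect _ e r s crossing C) => //; rewrite ?last_sw ?lpp //.
- exact: path_sw.
- exact: path_sw.
- move=> [z|]; rewrite inE ?offN // => /predU1P[->|zB]; [by rewrite !off | by rewrite !offA].
have [u uA exu] := exists_inP adA.
apply: (@connect_trans _ _ (Some u)).
  by apply: connect1; rewrite /induced /= !inE eqxx uA exu orbT.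
apply: (@connect_trans _ _ (Some v)).
  apply: connect_sub (induced_sw (connA uA vA)) => a b /and3P[aC bC eab].
  apply: connect1; rewrite /induced /=; move: aC bC; rewrite !inE eab.
  by case: a b {eab} => [a|] [b|] //= aB bB; rewrite ?aB ?bB ?orbT.
by apply: connect1; rewrite /induced /= !inE vA eqxx !orbT.
Qed.

(** Closed up by the path through the apex, the strand bounds a region; being enclosed by it stands
    for lying on one fixed side of the strand. *)
Definition left_of (x d : G) (p q : seq G) : bool :=
  idx (Some x) (Some v) (sw (p ++ q)) outer.

(** Two strands through [d] differ by one closed curve in each hub, and neither of these encloses
    [x]. *)
Lemma left_of_indep (x d : G) p q p' q' : crosses x -> crosses d -> x != d ->
  strand_of d p q -> strand_of d p' q' -> left_of x d p q = left_of x d p' q'.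
Proof.
move=> cx [dA dB _ _] xd [pp lp pq lq [sp sq]] [pp' lp' pq' lq' [sp' sq']].
have hA := @index_hubA x d p p' cx xd dB pp pp' _ sp sp'.
have hB := @index_hubB x d q q' cx xd dA pq pq' _ sq sq'.
rewrite lp lp' lq lq' in hA hB.
apply: (xor_elim2 (hA erefl) (hB erefl)).
rewrite /left_of /curve_index !sw_cat !wind_cat !last_sw lp lp'; xor_solve.
Qed.

Lemma strand_apart (d : G) p q (x : G) p' q' : crosses d -> crosses x -> d != x ->
  strand_of d p q -> strand_of x p' q' ->
  apart (Some v :: sw p) (Some x :: sw q').
Proof.
move=> [dA dB _ _] [xA xB _ _] dx [_ _ _ _ [sp _]] [_ _ _ _ [_ sq]].
move=> t; rewrite -[_ :: sw p]/(sw (v :: p)) -[_ :: sw q']/(sw (x :: q')).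
case/mapP => z zp ->; rewrite mem_sw; apply/negP => /sq; have := sp z zp.
rewrite !inE => /predU1P[->|zA]; first by rewrite (negbTE dx) (negbTE dB).
by rewrite (disjointFr AB zA) orbF => /eqP zx; rewrite -zx zA in xA.
Qed.

(** The path through the apex serves as the third strand in [theta]. The ray of the apex meets no
    edge of the graph, so its own index is 0 and the two others differ. *)
Lemma left_of_asym (x d : G) p q p' q' : crosses x -> crosses d -> x != d ->
  strand_of d p q -> strand_of x p' q' -> left_of x d p q = ~~ left_of d x p' q'.
Proof.
move=> cx cd xd sd sx.
have so : strand e (Some v) (Some w) None [:: None] [:: Some w].
  by split; rewrite //= ?eqxx ?orbT.
have [pp lp pq lq [sp sq]] := sd; have [pp' lp' pq' lq' [sp' sq']] := sx.
have dx : d != x by rewrite eq_sym.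
have [dA dB _ _] := cd; have [xA xB _ _] := cx.
have oA y t : y \notin B -> {subset v :: t <= y |: A} -> w != y -> 
    apart (Some v :: sw t) (None :: [:: Some w]).
  move=> yB st wy z; rewrite -[_ :: sw t]/(sw (v :: t)) => /mapP[m mt ->].
  rewrite !inE /=; apply: contraTneq (st m mt) => -[->].
  by rewrite !inE (negbTE wy) (disjointFl AB wB).
have oB y t : y \notin A -> {subset y :: t <= y |: B} -> 
    apart (Some v :: [:: None]) (Some y :: sw t).
  move=> yA st z; rewrite -[_ :: sw t]/(sw (y :: t)) !inE => /orP[]/eqP->.
    rewrite mem_sw; apply/negP => /st; rewrite !inE (disjointFr AB vA) orbF.
    by move/eqP=> vy; rewrite -vy vA in yA.
  exact: None_sw.
have wx : w != x by apply: contraNneq xB => <-.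
have wd : w != d by apply: contraNneq dB => <-.
have vwo : Some v != Some w :> V by apply: contraNneq vw_neq => -[->].
have := theta crossing s_asym vwo (strand_sw sx) (strand_sw sd) so
  (strand_apart cx cd xd sx sd) (oA x p' xB sp' wx) (strand_apart cd cx dx sd sx)
  (oA d p dB sp wd) (oB x q' xA sq') (oB d q dA sq).
have -> : idx None (Some v) (sw p' ++ sw q') (sw p ++ sw q) = false.
  have P y t u : path (@adj G) v t -> last v t = y -> path (@adj G) y u ->
      wind r None (Some v) (sw t ++ sw u) = false.
    move=> pt lt pu; rewrite -sw_cat wind_apex ?None_sw //; apply: path_sw.
    by rewrite cat_path pt lt.
  by rewrite /curve_index (P x) // (P d).
rewrite addbF /left_of -/outer !sw_cat.
by do 2![case: (idx _ _ _ _)].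
Qed.

Lemma left_of_connect (C : {set G}) (x y d : G) p q : crosses d -> strand_of d p q ->
  connect (induced (@adj G) C) x y -> [disjoint C & d |: (A :|: B)] ->
  left_of x d p q = left_of y d p q.
Proof.
move=> [dA dB _ _] sd cxy dC; have [pp lp] := strand_path (strand_sw sd).
rewrite /left_of sw_cat.
pose D := [set t | if t is Some z then z \in C else false].
apply: (@index_connect _ e r s crossing D) => //.
- exact: outer_path.
- move=> t tD; have [z zC ->] : exists2 z, z \in C & t = Some z.
    by move: tD; rewrite inE; case: t => // z; exists z.
  have zn : z \notin d |: (A :|: B) by rewrite (disjointFr dC zC).
  rewrite !inE !negb_or in zn; case/and3P: zn => zd zA zB.
  have [_ _ _ _ [sp sq]] := sd; apply/andP; split.
    rewrite -sw_cat -[Some v :: _]/(sw (v :: p ++ q)) mem_sw -cat_cons mem_cat.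
    apply/negP => /orP[/sp|zq]; first by rewrite !inE (negbTE zd) (negbTE zA).
    have /sq : z \in d :: q by rewrite inE zq orbT.
    by rewrite !inE (negbTE zd) (negbTE zB).
  rewrite !inE /= !negb_or; apply/andP; split.
    by apply: contraNneq zA => -[->].
  by apply: contraNneq zB => -[->].
case/connectP: cxy => t pt ->; elim: t x pt => //= z t IH x /andP[/and3P[xC zC exz] pt].
by apply: connect_trans (IH z pt); apply: connect1; rewrite /induced /= !inE xC zC.
Qed.

Lemma theta_leg (x y b c : G) (p m k : seq G) :
  uniq (b :: c :: p ++ m ++ k) -> path (@adj G) b (rcons p c) ->
  path (@adj G) b (rcons m c) -> path (@adj G) b (rcons k c) ->
  x \in p -> y \in p ->
  idx (Some x) (Some b) (sw (rcons m c)) (sw (rcons k c)) =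
  idx (Some y) (Some b) (sw (rcons m c)) (sw (rcons k c)).
Proof.
move=> U pp pm pk xp yp.
have off z : z \in p -> (z \notin b :: rcons m c) && (z \notin b :: rcons k c).
  move=> zp; rewrite !inE !mem_rcons !inE !negb_or.
  move: U; rewrite /= !inE !mem_cat !negb_or !cat_uniq.
  move=> /and3P[/and4P[bc bp bm bk] /and3P[cp cm ck] /and3P[up]].
  move=> /hasPn um _; have zb : z != b by apply: contraNneq bp => <-.
  have zc : z != c by apply: contraNneq cp => <-.
  rewrite zb zc /=; apply/andP; split; apply/negP => h.
    by have := um z; rewrite mem_cat h zp => /(_ isT).
  by have := um z; rewrite mem_cat h zp orbT => /(_ isT).
case: p pp xp yp off {U} => // d p; rewrite rcons_cons /= => /andP[_].
rewrite rcons_path => /andP[pp _] xp yp off.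
have cxy := path_connect (@adj_sym G) pp xp yp.
apply: (@index_connect _ e r s crossing [set t in sw (d :: p)]).
- exact: path_sw.
- exact: path_sw.
- by rewrite !last_sw !last_rcons.
- move=> t; rewrite inE => /mapP[z zp ->].
  by rewrite -![Some b :: _]/(sw (b :: _)) !mem_sw off.
case/connectP: cxy => t pt ->; elim: t x {xp} pt => //= z t IH x.
case/andP=> /and3P[]; rewrite !inE => xp zp exz pt.
apply: connect_trans (IH z pt); apply: connect1.
have M u : (u == d) || (u \in p) -> (Some u == Some d) || (Some u \in sw p).
  by case/predU1P=> [->|up]; rewrite ?eqxx // mem_sw up orbT.
by rewrite /induced /= !inE !M.
Qed.

(** Tripods towards the three neighbours in each hub give a simple theta with branch vertices [b]
    and [c]. The paths [xi] from [v] to [b] and [eta] from [c] to [w] extend its legs to strands;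
    being common to all three, they cancel from every index. *)
Lemma hub_theta (x y z : G) : crosses x -> crosses y -> crosses z ->
  uniq [:: x; y; z] ->
  exists p1 q1 p2 q2 p3 q3,
    [/\ strand_of x p1 q1, strand_of y p2 q2, strand_of z p3 q3 &
     [\/ idx (Some x) (Some v) (sw (p2 ++ q2)) (sw (p3 ++ q3)) = false,
         idx (Some y) (Some v) (sw (p1 ++ q1)) (sw (p3 ++ q3)) = false |
         idx (Some z) (Some v) (sw (p1 ++ q1)) (sw (p2 ++ q2)) = false]].
Proof.
move=> [xA xB /exists_inP[a1 A1 e1] /exists_inP[b1 B1 f1]].
move=> [yA yB /exists_inP[a2 A2 e2] /exists_inP[b2 B2 f2]].
move=> [zA zB /exists_inP[a3 A3 e3] /exists_inP[b3 B3 f3]] uxyz.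
have [b [l1 [l2 [l3 [ub subb [pb1 pb2 pb3] [lb1 lb2 lb3]]]]]] :=
  tripod (@adj_sym G) connA A1 A2 A3.
have [c [m1 [m2 [m3 [uc subc [pc1 pc2 pc3] [lc1 lc2 lc3]]]]]] :=
  tripod (@adj_sym G) connB B1 B2 B3.
have [xi [pxi lxi sxi]] := connected_walk connA vA (subb b (mem_head _ _)).
have [eta [peta leta seta]] := connected_walk connB (subc c (mem_head _ _)) wB.
pose P (t : G) (l m : seq G) : seq G := l ++ t :: rev m.
have leg t l m a' b' : path (@adj G) b l -> last b l = a' -> adj t a' ->
    path (@adj G) c m -> last c m = b' -> adj t b' ->
    path (@adj G) b (rcons (P t l m) c) /\ path (@adj G) t (rcons (rev m) c).
  move=> pl ll ta pm lm tb.
  have H : path (@adj G) t (rcons (rev m) c).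
    have -> : rcons (rev m) c = last c m :: rev (belast c m).
      by rewrite -rev_cons lastI rev_rcons.
    by rewrite /= lm tb -lm; case: (path_rev (@adj_sym G) pm).
  by rewrite /P rcons_cat /= cat_path pl ll /= adj_sym ta.
have [th1 r1] := leg x l1 m1 a1 b1 pb1 lb1 e1 pc1 lc1 f1.
have [th2 r2] := leg y l2 m2 a2 b2 pb2 lb2 e2 pc2 lc2 f2.
have [th3 r3] := leg z l3 m3 a3 b3 pb3 lb3 e3 pc3 lc3 f3.
have U : uniq (b :: c :: P x l1 m1 ++ P y l2 m2 ++ P z l3 m3).
  have Q : perm_eq (b :: c :: P x l1 m1 ++ P y l2 m2 ++ P z l3 m3)
      ((b :: l1 ++ l2 ++ l3) ++ (c :: m1 ++ m2 ++ m3) ++ [:: x; y; z]).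
    exact: perm_theta.
  rewrite (perm_uniq Q) cat_uniq ub [X in _ && X]andbC cat_uniq uc uxyz !andbT !andTb.
  apply/andP; split; last first.
    apply/hasPn => t; rewrite mem_cat => /orP[/subc tB|].
      by apply/negP => /subb tA; rewrite (disjointFr AB tA) in tB.
    move=> txyz; apply/negP => /subb tA; move: txyz; rewrite !inE.
    by case/or3P=> /eqP te; rewrite -te tA in xA yA zA.
  apply/hasPn => t txyz; apply/negP => /subc tB; move: txyz; rewrite !inE.
  by case/or3P=> /eqP te; rewrite -te tB in xB yB zB.
pose pp (t : G) (l : seq G) : seq G := xi ++ rcons l t.
pose qq (m : seq G) : seq G := rcons (rev m) c ++ eta.
have st t l m a' : path (@adj G) b l -> last b l = a' -> adj t a' ->
    path (@adj G) t (rcons (rev m) c) -> {subset l <= A} -> {subset m <= B} ->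
    strand_of t (pp t l) (qq m).
  move=> pl ll ta pr sl sm; split.
  - by rewrite cat_path pxi lxi rcons_path pl ll adj_sym.
  - by rewrite last_cat last_rcons.
  - by rewrite cat_path pr last_rcons.
  - by rewrite last_cat last_rcons.
  split=> u.
    rewrite -cat_cons mem_cat mem_rcons !inE => /orP[h|/predU1P[->|/sl->]];
      rewrite ?eqxx ?orbT // sxi ?orbT // inE //.
  rewrite in_cons mem_cat mem_rcons inE mem_rev => /predU1P[->|].
    by rewrite !inE eqxx.
  case/orP=> [/predU1P[->|/sm uB]|ue]; rewrite !inE ?uB ?orbT //.
    by rewrite subc ?mem_head ?orbT.
  by rewrite seta ?orbT // inE ue orbT.
have subl (l : seq G) : {subset l <= l1 ++ l2 ++ l3} -> {subset l <= A}.
  by move=> sl u /sl ul; apply: subb; rewrite inE ul orbT.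
have subm (l : seq G) : {subset l <= m1 ++ m2 ++ m3} -> {subset l <= B}.
  by move=> sl u /sl ul; apply: subc; rewrite inE ul orbT.
have S1 : strand_of x (pp x l1) (qq m1).
  by apply: (st _ _ _ a1) => //; [apply: subl | apply: subm] => u uu;
    rewrite !mem_cat uu ?orbT.
have S2 : strand_of y (pp y l2) (qq m2).
  by apply: (st _ _ _ a2) => //; [apply: subl | apply: subm] => u uu;
    rewrite !mem_cat uu ?orbT.
have S3 : strand_of z (pp z l3) (qq m3).
  by apply: (st _ _ _ a3) => //; [apply: subl | apply: subm] => u uu;
    rewrite !mem_cat uu ?orbT.
exists (pp x l1), (qq m1), (pp y l2), (qq m2), (pp z l3), (qq m3); split=> //.
have tr (u t : G) (l m : seq G) (t' : G) (l' m' : seq G) :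
    idx (Some u) (Some v) (sw (pp t l ++ qq m)) (sw (pp t' l' ++ qq m')) =
    idx (Some u) (Some b) (sw (rcons (P t l m) c)) (sw (rcons (P t' l' m') c)).
  have E t0 l0 m0 : pp t0 l0 ++ qq m0 = xi ++ rcons (P t0 l0 m0) c ++ eta.
    by rewrite /pp /qq /P -!catA rcons_cat cat_rcons -catA.
  have X (i j k n : bool) : (i (+) (j (+) k)) (+) (i (+) (n (+) k)) = j (+) n.
    by case: i j k n => [] [] [] [].
  by rewrite !E !sw_cat /curve_index !wind_cat !last_sw lxi !last_rcons; exact: X.
rewrite !tr; case: cert => _ _ _ tht.
have inP t l m : t \in P t l m by rewrite mem_cat mem_head orbT.
have PC (s1 s2 s3 : seq G) : perm_eq (s1 ++ s2 ++ s3) (s2 ++ s1 ++ s3).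
  by rewrite perm_catCA.
have TH : simple_theta b c (P x l1 m1) (P y l2 m2) (P z l3 m3).
  by split=> //; rewrite /P; case: (l1) (l2) (l3) => [|? ?] [|? ?] [|? ?].
case: (tht _ _ _ _ _ TH) => -[u up hu].
- constructor 1; rewrite -hu; exact: (theta_leg U).
- constructor 2; rewrite -hu; apply: (@theta_leg _ _ b c (P y l2 m2)) => //.
  by rewrite -(perm_uniq (s1 := b :: c :: P x l1 m1 ++ P y l2 m2 ++ P z l3 m3)) //
    !perm_cons.
- constructor 3; rewrite -hu; apply: (@theta_leg _ _ b c (P z l3 m3)) => //.
  rewrite -(perm_uniq (s1 := b :: c :: P x l1 m1 ++ P y l2 m2 ++ P z l3 m3)) //.
  by rewrite !perm_cons catA perm_catC.
Qed.

(** If the conclusion failed, antisymmetry would make all three indices equal to 1, the pattern that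
    [hub_theta] excludes. *)
Lemma left_of_trans (x y z : G) p2 q2 p3 q3 :
  crosses x -> crosses y -> crosses z -> uniq [:: x; y; z] ->
  strand_of y p2 q2 -> strand_of z p3 q3 ->
  left_of x y p2 q2 -> left_of y z p3 q3 -> left_of x z p3 q3.
Proof.
move=> cx cy cz U sy sz xy yz.
have [p1' [q1' [p2' [q2' [p3' [q3' [sx' sy' sz' cyc]]]]]]] := hub_theta cx cy cz U.
move: U; rewrite /= !inE negb_or andbT => /andP[/andP[nxy nxz] nyz].
have nyx : y != x by rewrite eq_sym.
have nzy : z != y by rewrite eq_sym.
have nzx : z != x by rewrite eq_sym.
rewrite (left_of_indep cx cy nxy sy sy') in xy.
rewrite (left_of_indep cy cz nyz sz sz') in yz.
rewrite (left_of_indep cx cz nxz sz sz').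
have yx := left_of_asym cy cx nyx sx' sy'.
have zx := left_of_asym cz cx nzx sx' sz'.
have zy := left_of_asym cz cy nzy sy' sz'.
rewrite xy in yx; rewrite yz in zy.
apply/negPn/negP => nz; rewrite (negbTE nz) in zx.
have D (u t : G) p q (t' : G) p' q' : idx (Some u) (Some v) (sw (p ++ q)) (sw (p' ++ q')) =
  left_of u t p q (+) left_of u t' p' q'.
  rewrite /left_of /curve_index; xor_solve.
move: cyc; rewrite (D x y _ _ z) (D y x _ _ z) (D z x _ _ y).
by rewrite xy yx (negbTE nz) yz zx zy; case.
Qed.

End Hubs.
End HubOrder.

Section Before.
Variables (G : sgraph) (v w : G).
Variables (r : option G -> option G -> option G -> bool).
Variables (s : option G -> option G -> bool).
Hypothesis cert : planar_certificate v w r s.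
Variables A B : {set G}.
Hypothesis connA : vconnected (@adj G) A.
Hypothesis connB : vconnected (@adj G) B.
Hypothesis AB : [disjoint A & B].
Hypothesis vA : v \in A.
Hypothesis wB : w \in B.

Definition before (x d : G) : Prop :=
  exists p q, strand_of v w A B d p q /\ left_of v w r x d p q.

Lemma beforeE (x d : G) p q : crosses A B x -> crosses A B d -> x != d ->
  strand_of v w A B d p q -> before x d <-> left_of v w r x d p q.
Proof.
move=> cx cd xd sd; split=> [[p' [q' [sd' l]]]|l]; last by exists p, q.
by rewrite (left_of_indep cert connA connB AB vA wB cx cd xd sd sd').
Qed.

Lemma before_asym (x d : G) : crosses A B x -> crosses A B d -> x != d ->
  before x d <-> ~ before d x.
Proof.
move=> cx cd xd; have dx : d != x by rewrite eq_sym.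
have [p [q sd]] := strand_exists connA connB vA wB cd.
have [p' [q' sx]] := strand_exists connA connB vA wB cx.
rewrite (beforeE cx cd xd sd) (beforeE cd cx dx sx).
rewrite (left_of_asym cert AB vA wB cx cd xd sd sx).
by split=> [/negP|/negP].
Qed.

Lemma before_trans (x y z : G) :
  crosses A B x -> crosses A B y -> crosses A B z -> uniq [:: x; y; z] ->
  before x y -> before y z -> before x z.
Proof.
move=> cx cy cz U; have := U.
rewrite /= !inE negb_or andbT => /andP[/andP[xy xz] yz].
have [p2 [q2 sy]] := strand_exists connA connB vA wB cy.
have [p3 [q3 sz]] := strand_exists connA connB vA wB cz.
rewrite (beforeE cx cy xy sy) (beforeE cy cz yz sz) (beforeE cx cz xz sz).
exact: (left_of_trans cert connA connB AB vA wB cx cy cz U).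
Qed.

Lemma before_connect (C : {set G}) (x y d : G) : crosses A B d ->
  connect (induced (@adj G) C) x y -> [disjoint C & d |: (A :|: B)] ->
  before x d -> before y d.
Proof.
move=> cd cxy dC [p [q [sd l]]]; exists p, q; split=> //.
by rewrite -(left_of_connect cert vA wB cd sd cxy dC).
Qed.

End Before.

(** * The maximum principle for heights *)

Section Heights.
Local Open Scope ring_scope.
Variables (G : sgraph).
Hypothesis conn3 : k_connected 3 G.

Definition flat (f : G -> rat) u := [forall t, adj u t ==> (f t == f u)].

(** This is all that the order argument takes from a harmonic function. Flat vertices are excluded
    only in [not_flat], by planarity. *)
Definition height (f : G -> rat) (v w : G) :=
  f v < f w /\ forall u, u != v -> u != w ->
    flat f u \/ (exists2 t, adj u t & f u < f t) /\ (exists2 t, adj u t & f t < f u).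

Lemma heightN f v w : height f v w -> height (fun u => - f u) w v.
Proof.
move=> [fvw h]; split; first by rewrite ltrN2.
move=> u uw uv; case: (h u uv uw) => [fl|[[t ut lt] [t' ut' lt']]]; [left|right].
  by apply/forallP => t; have /forallP/(_ t) := fl; rewrite eqr_opp.
by split; [exists t' | exists t] => //; rewrite ltrN2.
Qed.

Lemma minus_closed (X : {set G}) (P : pred G) (u t : G) : u \notin X -> t \notin X ->
  (#|X| < 3)%N -> P u ->
  (forall a b, P a -> adj a b -> b \notin X -> P b) -> P t.
Proof.
move=> uX tX X3 Pu cl; have [_ /(_ X X3 u t uX tX)] := conn3.
case/connectP=> p pp ->; elim: p u {uX} Pu pp => //= a p IH u Pu.
by case/andP=> /and3P[_ aX ua] pp; apply: (IH a) => //; apply: cl ua aX.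
Qed.

Lemma adj_closed (P : pred G) (u t : G) : P u -> (forall a b, P a -> adj a b -> P b) -> P t.
Proof.
move=> Pu cl; have H := @minus_closed finset.set0 P u t.
rewrite !inE cards0 in H; apply: H => // a b Pa ab _; exact: cl ab.
Qed.

Section OneHeight.
Variables (f : G -> rat) (v w : G).
Hypothesis hf : height f v w.

Definition above y := [set u | y < f u].

(** On a component that misses [w], a highest vertex can only be flat, so its height spreads over
    the whole graph and reaches [v], which is not above [y]. *)
Lemma above_reach y u : f v <= y -> u \in above y ->
  w \in vcomponent (@adj G) (above y) u.
Proof.
move=> vy uy; apply/negPn/negP => wC.
set C := vcomponent _ _ _ in wC.
have uC : u \in C by apply: mem_component.
have [m mC mmax] := @Order.TotalTheory.arg_maxP _ _ G u (mem C) f uC.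
have {}mC : m \in C by [].
have my : y < f m by have := component_sub mC; rewrite inE.
have fl t : t \in C -> f t = f m -> flat f t.
  move=> tC ft; have tv : t != v by apply: contraTneq my => tv; rewrite -ft tv -leNgt.
  have tw : t != w by apply: contraNneq wC => <-.
  case: (proj2 hf t tv tw) => // -[[z tz ltz] _].
  have zC : z \in C.
    by apply: component_closed tC _ tz; rewrite inE (lt_trans my) // -ft.
  by have h : f z <= f m := mmax z zC; rewrite leNgt -ft ltz in h.
have : (v \in C) && (f v == f m).
  apply: (@adj_closed (fun t => (t \in C) && (f t == f m)) m); first by rewrite mC /=.
  move=> a b /andP[aC /eqP fa] ab.
  have /forallP/(_ b)/implyP/(_ ab)/eqP fb := fl a aC fa.
  rewrite fb fa eqxx andbT; apply: component_closed aC _ ab.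
  by rewrite inE fb fa.
by case/andP=> _ /eqP vm; rewrite leNgt vm my in vy.
Qed.

Lemma above_connected y : f v <= y -> vconnected (@adj G) (above y).
Proof.
move=> vy a b ay by_; have cs := sym_connect_sym (induced_sym (@adj_sym G) (above y)).
have := above_reach vy ay; have := above_reach vy by_.
rewrite ![_ \in vcomponent _ _ _]inE => /andP[_ bw] /andP[_ aw].
by apply: connect_trans aw _; rewrite cs.
Qed.

(** Another vertex of maximal height would be flat, and its height would spread to [v] in the graph
    without [w], which is still connected. *)
Lemma height_lt_top u : u != w -> f u < f w.
Proof.
have le t : f t <= f w.
  rewrite leNgt; apply/negP => lt.
  have : t \in above (f w) by rewrite inE.
  move/(above_reach (ltW (proj1 hf)))/component_sub; by rewrite inE ltxx.
move=> uw; rewrite lt_neqAle le andbT; apply/eqP => fuw.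
have : (v != w) && (f v == f w).
  apply: (@minus_closed [set w] (fun t => (t != w) && (f t == f w)) u);
    rewrite ?inE ?cards1 //.
  - by apply: contraTneq (proj1 hf) => ->; rewrite ltxx.
  - by rewrite uw fuw eqxx.
  move=> a b /andP[aw /eqP fa] ab; rewrite inE => bw; rewrite bw /=.
  have av : a != v by apply: contraTneq (proj1 hf) => av; rewrite -av fa ltxx.
  case: (proj2 hf a av aw) => [/forallP/(_ b)/implyP/(_ ab)/eqP->|]; first by rewrite fa.
  by case=> -[t at_ lt] _; have := le t; rewrite leNgt -fa lt.
by case/andP=> _ /eqP vw; have := proj1 hf; rewrite vw ltxx.
Qed.

End OneHeight.

Lemma height_gt_bottom f v w u : height f v w -> u != v -> f v < f u.
Proof. by move/heightN/height_lt_top => h /h; rewrite ltrN2. Qed.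

Definition below (f : G -> rat) y := [set u | f u < y].

Lemma below_connected f v w y : height f v w -> y <= f w ->
  vconnected (@adj G) (below f y).
Proof.
move=> /heightN hf yw; have := @above_connected _ _ _ hf (- y).
rewrite lerN2 => /(_ yw); congr (vconnected _ _).
by apply/setP => u; rewrite !inE ltrN2.
Qed.

End Heights.

(** * The linear order within one height *)

Section Levels.
Local Open Scope ring_scope.
Variables (G : sgraph) (v w : G).
Variables (r : option G -> option G -> option G -> bool).
Variables (s : option G -> option G -> bool).
Hypothesis cert : planar_certificate v w r s.
Hypothesis conn3 : k_connected 3 G.
Variable f : G -> rat.
Hypothesis hf : height f v w.

(** The hubs are the two sides of the height of [d]. Vertices of one height share them, so on a
    level this is the order of parallel strands. *)
Definition lt_level (x d : G) : Prop :=
  before v w r (below f (f d)) (above f (f d)) x d.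

Let inner (u : G) := (u != v) && (u != w).

Section At.
Variable y : rat.
Hypothesis vy : f v < y.
Hypothesis yw : y < f w.
Notation A := (below f y).
Notation B := (above f y).

Lemma hub_below : vconnected (@adj G) A.
Proof. exact: below_connected hf (ltW yw). Qed.

Lemma hub_above : vconnected (@adj G) B.
Proof. exact: above_connected hf _ (ltW vy). Qed.

Lemma hubs_disjoint : [disjoint A & B].
Proof.
rewrite disjoint_subset; apply/fintype.subsetP => u; rewrite !inE => uy.
by rewrite -leNgt ltW.
Qed.

Lemma hub_bottom : v \in A. Proof. by rewrite inE. Qed.
Lemma hub_top : w \in B. Proof. by rewrite inE. Qed.

End At.

Lemma inner_lo d : inner d -> f v < f d.
Proof. by case/andP=> dv _; exact: height_gt_bottom hf dv. Qed.

Lemma inner_hi d : inner d -> f d < f w.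
Proof. by case/andP=> _ dw; exact: height_lt_top hf _ dw. Qed.

Lemma crosses_level d : inner d -> ~~ flat f d ->
  crosses (below f (f d)) (above f (f d)) d.
Proof.
case/andP=> dv dw nf; case: (proj2 hf d dv dw) => [fl|]; first by rewrite fl in nf.
move=> [[t dt lt] [t' dt' lt']]; split; rewrite ?inE ?ltxx //; apply/exists_inP.
- by exists t' => //; rewrite inE.
- by exists t => //; rewrite inE.
Qed.

Section LevelOrder.
Variables x y : G.
Hypotheses (ix : inner x) (iy : inner y) (nx : ~~ flat f x) (ny : ~~ flat f y).
Hypothesis fxy : f x = f y.

Lemma lt_level_asym0 : x != y -> lt_level x y <-> ~ lt_level y x.
Proof.
have cx := crosses_level ix nx; have cy := crosses_level iy ny.
rewrite fxy in cx; rewrite /lt_level fxy; apply: (before_asym cert) => //.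
- exact: (hub_below (inner_hi iy)).
- exact: (hub_above (inner_lo iy)).
- exact: hubs_disjoint.
- exact: (hub_bottom (inner_lo iy)).
- exact: (hub_top (inner_hi iy)).
Qed.

Lemma lt_level_trans0 z : inner z -> ~~ flat f z -> f y = f z ->
  uniq [:: x; y; z] -> lt_level x y -> lt_level y z -> lt_level x z.
Proof.
move=> iz nz fyz; have cx := crosses_level ix nx; have cy := crosses_level iy ny.
have cz := crosses_level iz nz.
rewrite fxy fyz in cx; rewrite fyz in cy; rewrite /lt_level fyz.
apply: (before_trans cert) => //.
- exact: (hub_below (inner_hi iz)).
- exact: (hub_above (inner_lo iz)).
- exact: hubs_disjoint.
- exact: (hub_bottom (inner_lo iz)).
- exact: (hub_top (inner_hi iz)).
Qed.

End LevelOrder.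

Lemma lt_level_connect0 (C : {set G}) (x y d : G) : inner d -> ~~ flat f d ->
  connect (induced (@adj G) C) x y -> {in C, forall z, f z = f d /\ z != d} ->
  lt_level x d -> lt_level y d.
Proof.
move=> id nd cxy sub; apply: (before_connect cert _ _ _ cxy).
- exact: (hub_bottom (inner_lo id)).
- exact: (hub_top (inner_hi id)).
- exact: crosses_level.
rewrite disjoint_subset; apply/fintype.subsetP => z /sub[fz zd].
by rewrite !inE negb_or zd fz !ltxx.
Qed.

Lemma lt_level_step0 (x y d : G) : inner d -> ~~ flat f d -> adj x y ->
  f x = f d -> f y = f d -> x != d -> y != d -> lt_level x d -> lt_level y d.
Proof.
move=> id nd xy fx fy xd yd; apply: (@lt_level_connect0 [set x; y]) => //.
  by apply: connect1; rewrite /induced /= !inE !eqxx orbT xy.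
by move=> z; rewrite !inE => /orP[]/eqP->.
Qed.

(** Of three linearly ordered vertices the middle one has the other two on different sides. *)
Lemma no_level_triangle (x y z : G) : uniq [:: x; y; z] ->
  inner x -> inner y -> inner z -> ~~ flat f x -> ~~ flat f y -> ~~ flat f z ->
  f x = f y -> f x = f z ->
  (lt_level y x <-> lt_level z x) -> (lt_level x y <-> lt_level z y) ->
  (lt_level x z <-> lt_level y z) -> False.
Proof.
rewrite /= !inE negb_or andbT => /andP[/andP[xy xz] yz] ix iy iz nx ny nz fxy fxz.
have fyz : f y = f z by rewrite -fxy.
have a1 := lt_level_asym0 ix iy nx ny fxy xy.
have a2 := lt_level_asym0 ix iz nx nz fxz xz.
have a3 := lt_level_asym0 iy iz ny nz fyz yz.
have d1 := EM (lt_level y x); have d2 := EM (lt_level z y); have d3 := EM (lt_level z x).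
by move=> h1 h2 h3; tauto.
Qed.

(** Let [Z] be a connected set of flat vertices of one height and [N] its non-flat neighbours. By
    3-connectivity [N] has three members, all of that height. Any two are joined through [Z] without
    leaving the level, hence lie on the same side of the third, against [no_level_triangle]. *)
Lemma not_flat u : inner u -> ~~ flat f u.
Proof.
move=> iu; apply/negP => fu.
pose F := [set t | flat f t && (f t == f u)].
have uF : u \in F by rewrite inE fu eqxx.
pose Z := vcomponent (@adj G) F u.
have uZ : u \in Z by exact: mem_component.
have Zlev z : z \in Z -> f z = f u /\ flat f z.
  by move/component_sub; rewrite inE => /andP[-> /eqP].
pose N := [set t | [&& f t == f u, ~~ flat f t & adjacent_to (@adj G) t Z]].
have vu : f v != f u by rewrite lt_eqF // inner_lo.
have wu : f w != f u by rewrite gt_eqF // inner_hi.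
have N3 : (2 < #|N|)%N.
  rewrite ltnNge; apply/negP => N2.
  have : v \in Z.
    apply: (minus_closed conn3 (X := N) (u := u)) => //.
    - by rewrite inE fu andbF.
    - by rewrite inE (negbTE vu).
    move=> a b aZ ab bN; have [fa /forallP/(_ b)/implyP/(_ ab)/eqP fb] := Zlev a aZ.
    case: (boolP (flat f b)) => flb.
      by apply: component_closed aZ _ ab; rewrite inE flb fb fa eqxx.
    move: bN; rewrite inE fb fa eqxx flb /= => /negP[].
    by apply/exists_inP; exists a => //; rewrite adj_sym.
  by case/Zlev => fv; rewrite fv eqxx in vu.
have [x [y [z [xN yN zN U]]]] : exists x y z, [/\ x \in N, y \in N, z \in N &
    uniq [:: x; y; z]].
  have : (3 <= size (enum N))%N by rewrite -cardE.
  have mem t : t \in enum N -> t \in N by rewrite mem_enum.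
  case: (enum N) (enum_uniq N) mem => [|x [|y [|z l]]] // ul mem _.
  exists x, y, z; rewrite !mem ?inE ?eqxx ?orbT //; split=> //.
  move: ul; rewrite /= !inE !negb_or => /and3P[/and3P[-> -> _] /andP[-> _] _] //.
have NP t : t \in N -> [/\ inner t, ~~ flat f t, f t = f u & adjacent_to (@adj G) t Z].
  rewrite inE => /and3P[/eqP ft nt at_]; split=> //.
  apply/andP; split; apply/eqP => te; rewrite te in ft.
    by rewrite ft eqxx in vu.
  by rewrite ft eqxx in wu.
have [ix nx fx ax] := NP x xN; have [iy ny fy ay] := NP y yN.
have [iz nz fz az] := NP z zN.
have mv a b d : a \in N -> b \in N -> d \in N -> a != d -> b != d ->
    lt_level a d -> lt_level b d.
  move=> aN bN dN ad bd; have [ia na fa aa] := NP a aN; have [ib nb fb ab] := NP b bN.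
  have [id nd fd _] := NP d dN.
  have [a' a'Z aa'] := exists_inP aa; have [b' b'Z bb'] := exists_inP ab.
  have ZC : subrel (induced (@adj G) Z) (induced (@adj G) (a |: (b |: Z))).
    by move=> m n /and3P[mZ nZ mn]; rewrite /induced /= !in_setU1 mZ nZ mn !orbT.
  apply: (@lt_level_connect0 (a |: (b |: Z))) => //.
    apply: (@connect_trans _ _ a').
      by apply: connect1; rewrite /induced /= !in_setU1 eqxx a'Z aa' !orbT.
    apply: (@connect_trans _ _ b').
      have := component_connected (@adj_sym G) a'Z b'Z.
      by apply: connect_sub => m n mn; apply: connect1; exact: ZC.
    by apply: connect1; rewrite /induced /= !in_setU1 eqxx b'Z adj_sym bb' !orbT.
  move=> t; rewrite !in_setU1 fd => /or3P[/eqP->|/eqP->|] //.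
  by case/Zlev=> -> flt; split=> //; apply: contraNneq nd => <-.
have := U; rewrite /= !inE negb_or andbT => /andP[/andP[xy xz] yz].
have [yx zx zy] : [/\ y != x, z != x & z != y] by split; rewrite eq_sym.
by apply: (no_level_triangle U) => //; rewrite ?fx ?fy ?fz //; split; apply: mv.
Qed.

Lemma lt_level_asym x y : inner x -> inner y -> f x = f y -> x != y ->
  lt_level x y <-> ~ lt_level y x.
Proof. by move=> ix iy fxy; apply: lt_level_asym0 => //; exact: not_flat. Qed.

Lemma lt_level_trans x y z : inner x -> inner y -> inner z -> f x = f y -> f y = f z ->
  uniq [:: x; y; z] -> lt_level x y -> lt_level y z -> lt_level x z.
Proof. by move=> ix iy iz fxy fyz; apply: lt_level_trans0 => //; exact: not_flat. Qed.

Lemma lt_level_step (x y d : G) : inner d -> adj x y ->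
  f x = f d -> f y = f d -> x != d -> y != d -> lt_level x d <-> lt_level y d.
Proof.
move=> id xy fx fy xd yd; split; apply: lt_level_step0 => //; try exact: not_flat.
by rewrite adj_sym.
Qed.

(** A path from [v] up to [c], the edge to [d] and a path up to [w] form one curve that is a strand
    through [c] for the hubs of the lower height and a strand through [d] for those of the upper
    one. The adjacent vertices [c'] and [d'] avoid it, so they have the same index. *)
Lemma lt_level_edges_up (c c' d d' : G) :
  inner c -> inner c' -> inner d -> inner d' ->
  f c' = f c -> f d' = f d -> f c < f d -> adj c d -> adj c' d' -> c != c' -> d != d' ->
  lt_level c' c <-> lt_level d' d.
Proof.
move=> ic ic' id id' fc fd cd ecd ecd' ncc ndd.
have cc := crosses_level ic (not_flat ic).
have cc' := crosses_level ic' (not_flat ic').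
have cd_ := crosses_level id (not_flat id).
have cd_' := crosses_level id' (not_flat id').
rewrite fc in cc'; rewrite fd in cd_'.
have hc := (hub_below (inner_hi ic), hub_above (inner_lo ic),
  hubs_disjoint (f c), hub_bottom (inner_lo ic), hub_top (inner_hi ic)).
have hd := (hub_below (inner_hi id), hub_above (inner_lo id),
  hubs_disjoint (f d), hub_bottom (inner_lo id), hub_top (inner_hi id)).
have [p [_ [pp lp _ _ [sp _]]]] := strand_exists hc.1.1.1.1 hc.1.1.1.2 hc.1.2 hc.2 cc.
have [_ [q [_ _ pq lq [_ sq]]]] := strand_exists hd.1.1.1.1 hd.1.1.1.2 hd.1.2 hd.2 cd_.
have Sc : strand_of v w (below f (f c)) (above f (f c)) c p (d :: q).
  split=> //=; first by rewrite ecd.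
  split=> // t; rewrite in_cons => /predU1P[->|/sq]; first by rewrite !inE eqxx.
  by rewrite !inE => /predU1P[->|h]; rewrite ?cd ?(lt_trans cd h) orbT.
have Sd : strand_of v w (below f (f d)) (above f (f d)) d (rcons p d) q.
  split=> //; rewrite ?last_rcons ?rcons_path ?pp ?lp //.
  split=> // t; rewrite -rcons_cons mem_rcons in_cons => /predU1P[->|/sp].
    by rewrite !inE eqxx.
  by rewrite !inE => /predU1P[->|h]; rewrite ?cd ?(lt_trans h cd) orbT.
have nc'c : c' != c by rewrite eq_sym.
have nd'd : d' != d by rewrite eq_sym.
rewrite /lt_level (beforeE cert hc.1.1.1.1 hc.1.1.1.2 hc.1.1.2 hc.1.2 hc.2 cc' cc nc'c Sc).
rewrite (beforeE cert hd.1.1.1.1 hd.1.1.1.2 hd.1.1.2 hd.1.2 hd.2 cd_' cd_ nd'd Sd).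
rewrite /left_of cat_rcons.
suff -> : curve_index r (Some c') (Some v) (sw (p ++ d :: q)) (outer w) =
          curve_index r (Some d') (Some v) (sw (p ++ d :: q)) (outer w) by [].
have [crs _ _ _] := cert.
have off t : inner t -> (f t = f c /\ t != c) \/ (f t = f d /\ t != d) ->
    (Some t \notin Some v :: sw (p ++ d :: q)) && (Some t \notin Some v :: outer w).
  move=> it ht; rewrite -[Some v :: sw _]/(sw (v :: p ++ d :: q)) mem_sw; apply/andP; split.
    rewrite -cat_cons mem_cat; apply/negP => /orP[/sp|/sq]; rewrite !inE.
      case/predU1P=> [tc|]; case: ht => -[ft nt].
      - by rewrite tc eqxx in nt.
      - by rewrite tc in ft; rewrite ft ltxx in cd.
      - by rewrite ft ltxx.
      - by rewrite ft ltNge (ltW cd).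
    case/predU1P=> [td|]; case: ht => -[ft nt].
    - by rewrite td in ft; rewrite ft ltxx in cd.
    - by rewrite td eqxx in nt.
    - by rewrite ft ltNge (ltW cd).
    - by rewrite ft ltxx.
  case/andP: it => tv tw; rewrite !inE /= negb_or.
  by apply/andP; split; [apply: contraNneq tv => -[->] | apply: contraNneq tw => -[->]].
have /andP[c1 c2] := off c' ic' (or_introl (conj fc nc'c)).
have /andP[d1 d2] := off d' id' (or_intror (conj fd nd'd)).
apply: (index_step crs) => //.
- apply: path_sw; rewrite cat_path pp /= lp ecd; exact: pq.
- exact: outer_path.
- by rewrite last_sw last_cat /= lq.
Qed.

(** Disjoint edges between two heights keep their order along a common strand. At equal heights one
    slides along each edge as seen from an end of the other, using antisymmetry twice. *)
Lemma lt_level_edges (c c' d d' : G) :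
  inner c -> inner c' -> inner d -> inner d' ->
  f c' = f c -> f d' = f d -> adj c d -> adj c' d' ->
  c != c' -> d != d' -> c != d' -> c' != d ->
  lt_level c' c <-> lt_level d' d.
Proof.
move=> ic ic' id id' fc fd ecd ecd' ncc ndd ncd ncd'.
case: (ltgtP (f c) (f d)) => [lt|gt|eq]; first exact: lt_level_edges_up.
  by symmetry; apply: lt_level_edges_up; rewrite // adj_sym.
have nc'c : c' != c by rewrite eq_sym.
have nd'd : d' != d by rewrite eq_sym.
have nd'c : d' != c by rewrite eq_sym.
have ndc' : d != c' by rewrite eq_sym.
rewrite (@lt_level_step c' d' c) //; last by rewrite fd.
rewrite (@lt_level_asym d' c) ?fd // (@lt_level_asym d' d) //.
by rewrite (@lt_level_step c d d') // ?fd.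
Qed.

End Levels.

(** * Equitable partitions *)

Section Equitable.
Variables (G : sgraph) (same : rel G).
Hypothesis same_refl : reflexive same.
Hypothesis same_sym : symmetric same.
Hypothesis same_trans : transitive same.

Definition cell (u : G) := [set t | same u t].
Definition nb (u c : G) := #|[set t | adj u t & same c t]|.
Definition equitable := forall u u' c, same u u' -> nb u c = nb u' c.

Hypothesis eqt : equitable.

Lemma same_cell u t : same u t -> cell u = cell t.
Proof.
move=> ut; apply/setP => x; rewrite !inE; apply/idP/idP; apply: same_trans => //.
by rewrite same_sym.
Qed.

Lemma nb_gt0 u t c : adj u t -> same c t -> 0 < nb u c.
Proof. by move=> ut ct; apply/card_gt0P; exists t; rewrite inE ut ct. Qed.

Lemma nb_ex u c : 0 < nb u c -> exists2 t, adj u t & same c t.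
Proof. by case/card_gt0P=> t; rewrite inE => /andP[]; exists t. Qed.

Lemma nb_other u c t : 1 < nb u c -> exists t', [/\ adj u t', same c t' & t' != t].
Proof.
case/card_gt1P=> x [y []]; rewrite !inE => /andP[ux cx] /andP[uy cy] xy.
by have [xt|xt] := eqVneq x t; [exists y; rewrite -xt eq_sym | exists x].
Qed.

Lemma nb_uniq u c t t' : nb u c = 1 -> adj u t -> same c t -> adj u t' -> same c t' ->
  t = t'.
Proof.
move=> n1 ut ct ut' ct'; have /cards1P[z e] : nb u c == 1 by rewrite n1.
have : t \in [set z] by rewrite -e inE ut ct.
have : t' \in [set z] by rewrite -e inE ut' ct'.
by rewrite !inE => /eqP-> /eqP->.
Qed.

(** Both sides count the edges between the two cells. *)
Lemma cell_nb u t : #|cell u| * nb u t = #|cell t| * nb t u.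
Proof.
have H a b : #|cell a| * nb a b = \sum_(x in cell a) \sum_(z in cell b) adj x z.
  rewrite -sum_nat_const; apply: eq_bigr => x; rewrite inE => ax.
  rewrite (eqt b ax) /nb -sum1_card [RHS]big_mkcond [LHS]big_mkcond /=.
  by apply: eq_bigr => z _; rewrite !inE andbC; case: (same b z); case: (adj x z).
rewrite !H exchange_big /=; apply: eq_bigr => x _; apply: eq_bigr => z _.
by rewrite adj_sym.
Qed.

End Equitable.

(** * Colour refinement from two vertices of the outer face *)

Section Reflection.
Variables (G : sgraph) (v w : G).
Variables (r : option G -> option G -> option G -> bool).
Variables (s : option G -> option G -> bool).
Hypothesis cert : planar_certificate v w r s.
Hypothesis conn3 : k_connected 3 G.
Variable f : G -> rat.
Hypothesis hf : height f v w.
Variable same : rel G.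
Hypothesis same_refl : reflexive same.
Hypothesis same_sym : symmetric same.
Hypothesis same_trans : transitive same.
Hypothesis eqt : equitable same.
Hypothesis f_same : forall u t, same u t -> f u = f t.
Hypothesis same_v : forall t, same v t -> t = v.
Hypothesis same_w : forall t, same w t -> t = w.

Let inner (u : G) := (u != v) && (u != w).
Notation lt := (lt_level v w r f).
Notation cell := (cell same).
Notation nb := (nb same).

Lemma inner_same u t : same u t -> inner u -> inner t.
Proof.
move=> ut /andP[uv uw]; apply/andP; split.
  by apply: contraNneq uv => tv; apply/eqP/same_v; rewrite -tv same_sym.
by apply: contraNneq uw => tw; apply/eqP/same_w; rewrite -tw same_sym.
Qed.

Lemma cell_inner u : 1 < #|cell u| -> inner u.
Proof.
case/card_gt1P=> x [y []]; rewrite !inE => ux uy xy; apply/andP; split.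
  by apply: contraNneq xy => uv; rewrite uv in ux uy; rewrite (same_v ux) (same_v uy).
by apply: contraNneq xy => uw; rewrite uw in ux uy; rewrite (same_w ux) (same_w uy).
Qed.

Lemma lt_asym x y : inner x -> same x y -> x != y -> lt x y <-> ~ lt y x.
Proof.
move=> ix xy; apply: (lt_level_asym cert conn3 hf) => //; last exact: f_same.
exact: inner_same xy ix.
Qed.

Lemma lt_total x y : inner x -> same x y -> x != y -> lt x y \/ lt y x.
Proof. by move=> ix xy ne; case: (EM (lt y x)); [right | left; apply/lt_asym]. Qed.

Lemma lt_irr x y : inner x -> same x y -> x != y -> lt x y -> lt y x -> False.
Proof. by move=> ix xy ne /(lt_asym ix xy ne). Qed.

Lemma least (P : {set G}) u : inner u -> {in P, forall z, same u z} ->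
  (exists z, z \in P) -> exists2 m, m \in P & forall x, x \in P -> x != m -> lt m x.
Proof.
move=> iu; move: {2}#|P| (leqnn #|P|) => k; elim: k P => [|k IH] P Pk sP [z zP].
  by rewrite leqn0 cards_eq0 in Pk; rewrite (eqP Pk) inE in zP.
have iz := inner_same (sP z zP) iu.
case: (EM (exists x, x \in P :\ z)) => [ex|nex]; last first.
  exists z => // x xP xz; case: nex; exists x; by rewrite !inE xz.
have [||m] := IH (P :\ z) _ _ ex.
- by move: Pk; rewrite (cardsD1 z) zP.
- by move=> x; rewrite !inE => /andP[_ /sP].
rewrite !inE => /andP[mz mP] mmin; have zm : z != m by rewrite eq_sym.
have szm : same z m by apply: same_trans (sP m mP); rewrite same_sym sP.
case: (lt_total iz szm zm) => [lzm|lmz].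
  exists z => // x xP xz; have [->//|xm] := eqVneq x m.
  have sx : same m x by apply: same_trans (sP x xP); rewrite same_sym sP.
  apply: (lt_level_trans cert conn3 hf (y := m)) => //.
  - exact: inner_same szm iz.
  - exact: inner_same (sP x xP) iu.
  - exact: f_same.
  - exact: f_same.
  - by rewrite /= !inE negb_or zm eq_sym xz eq_sym xm.
  - by apply: mmin; rewrite ?inE ?xz.
exists m => // x xP xm; have [->//|xz] := eqVneq x z.
by apply: mmin; rewrite ?inE ?xz.
Qed.

Lemma cell_least u : inner u ->
  exists2 c, same u c & forall x, same u x -> x != c -> lt c x.
Proof.
move=> iu; have [||c] := @least (cell u) u iu; first by move=> z; rewrite inE.
  by exists u; rewrite inE.
by rewrite inE => uc cmin; exists c => // x ux; apply: cmin; rewrite inE.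
Qed.

Lemma edges_rule (c c' d d' : G) : inner c -> inner d -> ~~ same c d ->
  same c c' -> same d d' -> adj c d -> adj c' d' -> c != c' -> d != d' ->
  lt c' c <-> lt d' d.
Proof.
move=> ic id ncd cc dd ecd ecd' ncc ndd.
apply: (lt_level_edges cert conn3 hf) => //.
- exact: inner_same cc ic.
- exact: inner_same dd id.
- by rewrite (f_same cc).
- by rewrite (f_same dd).
- by apply: contraNneq ncd => ->; rewrite same_sym.
- by apply: contraNneq ncd => <-.
Qed.

(** Let [c] be least in its cell and [x] before [x'] two of its neighbours in the other cell. A
    second neighbour [c''] of [x] comes after [c], while the disjoint edges from [c] to [x'] and
    from [c''] to [x] put it before [c]. *)
Lemma one_sided u t : inner u -> inner t -> ~~ same u t -> 1 < nb u t -> nb t u <= 1.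
Proof.
move=> iu it nut n1; rewrite leqNgt; apply/negP => n2.
have [c uc cmin] := cell_least iu; have ic := inner_same uc iu.
have n1c : 1 < nb c t by rewrite -(eqt t uc).
have [d [cd td _]] := nb_other c n1c.
have [d' [cd' td' dd']] := nb_other d n1c.
have dtd : same d d' by apply: same_trans td'; rewrite same_sym.
have id := inner_same td it.
have H x x' : adj c x -> adj c x' -> same t x -> same t x' -> x != x' -> lt x x' -> False.
  move=> cx cx' tx tx' xx' lxx.
  have n2x : 1 < nb x u by rewrite -(eqt u tx).
  have [c'' [xc uc'' cc]] := nb_other c n2x.
  have scc : same c c'' by apply: same_trans uc''; rewrite same_sym.
  have nc : c != c'' by rewrite eq_sym.
  have ncx : ~~ same c x'.
    apply: contra nut => sx; apply: same_trans (same_trans uc sx) _.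
    by rewrite same_sym.
  have sxx : same x' x by apply: same_trans tx; rewrite same_sym.
  have x'x : x' != x by rewrite eq_sym.
  have x''c : adj c'' x by rewrite adj_sym.
  have E := edges_rule ic (inner_same tx' it) ncx scc sxx cx' x''c nc x'x.
  by apply: (lt_irr ic scc nc (cmin _ uc'' cc)); apply/E.
have dd : d != d' by rewrite eq_sym.
case: (lt_total id dtd dd) => l; first exact: (H d d').
by apply: (H d' d).
Qed.

(** The argument of [one_sided] inside one cell; the two edges may now share a vertex, which is the
    separate case of a triangle. *)
Lemma inner_degree u : inner u -> nb u u <= 1.
Proof.
move=> iu; rewrite leqNgt; apply/negP => n1.
have [c uc cmin] := cell_least iu; have ic := inner_same uc iu.
have n1x x : same u x -> 1 < nb x u by move=> ux; rewrite -(eqt u ux).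
have adj_ne (x x' : G) : adj x x' -> x != x'.
  by apply: contraTneq => ->; rewrite adj_irrefl.
have cl x y : same u x -> same u y -> same x y.
  by move=> ux uy; apply: same_trans uy; rewrite same_sym.
have H x x' : adj c x -> adj c x' -> same u x -> same u x' -> x != x' -> lt x x' -> False.
  move=> cx cx' ux ux' xx' lxx.
  have [c'' [xc uc'' cc]] := nb_other c (n1x x ux).
  have ccn : c != c'' by rewrite eq_sym.
  have x'x : x' != x by rewrite eq_sym.
  have [ix ix'] := (inner_same ux iu, inner_same ux' iu).
  have [c''x'|c''x'] := eqVneq c'' x'; last first.
    have E : lt c'' c <-> lt x x'.
      apply: (lt_level_edges cert conn3 hf) => //.
      - exact: inner_same uc'' iu.
      - exact/f_same/cl.
      - exact/f_same/cl.
      - by rewrite adj_sym.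
      - exact: adj_ne.
    by apply: (lt_irr ic (cl _ _ uc uc'') ccn (cmin _ uc'' cc)); apply/E.
  (* Here [c], [x], [x'] form a triangle. Sliding from [c] to [x'] as seen from [x], and from [c] to
     [x] as seen from [x'], puts each of [x] and [x'] before the other, since [c] precedes both. *)
  have xx'a : adj x x' by rewrite -c''x'.
  have E1 : lt c x <-> lt x' x.
    apply: (lt_level_step cert conn3 hf) => //; try exact/f_same/cl.
    exact: adj_ne.
  have E2 : lt c x' <-> lt x x'.
    apply: (lt_level_step cert conn3 hf) => //; try exact/f_same/cl.
    exact: adj_ne.
  apply: (lt_irr ix (cl _ _ ux ux') xx').
    by apply/E2/cmin => //; rewrite eq_sym adj_ne.
  by apply/E1/cmin => //; rewrite eq_sym adj_ne.
have [d [cd ud _]] := nb_other c (n1x c uc).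
have [d' [cd' ud' dd']] := nb_other d (n1x c uc).
have dd : d != d' by rewrite eq_sym.
case: (lt_total (inner_same ud iu) (cl _ _ ud ud') dd) => l; first exact: (H d d').
by apply: (H d' d).
Qed.

Section Largest.
Variable n : nat.
Hypothesis n2 : 1 < n.
Hypothesis n_max : forall u, #|cell u| <= n.

Let big u := #|cell u| == n.

Lemma big_inner u : big u -> inner u.
Proof. by move/eqP=> bu; apply: cell_inner; rewrite bu. Qed.

Lemma big_same u t : same u t -> big u -> big t.
Proof. by move=> ut; rewrite /big (same_cell same_sym same_trans ut). Qed.

Definition first m := forall x, same m x -> x != m -> lt m x.
Definition second m := exists m1, [/\ same m m1, m1 != m, first m1 &
  forall x, same m x -> x != m -> x != m1 -> lt m x].

(** The two sheets are cut out of the lowest and the second lowest vertices of the largest cells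
    only: matchings exist just between cells of equal size. *)
Definition firsts := [set m | big m && `[< first m >]].
Definition seconds := [set m | big m && `[< second m >]].

Lemma firstsP m : m \in firsts -> big m /\ first m.
Proof. by rewrite inE => /andP[-> /asboolP]. Qed.

Lemma secondsP m : m \in seconds -> big m /\ second m.
Proof. by rewrite inE => /andP[-> /asboolP]. Qed.

Lemma first_ex u : big u -> exists2 m, same u m & m \in firsts.
Proof.
move=> bu; have [m um mmin] := cell_least (big_inner bu).
exists m => //; rewrite inE (big_same um bu); apply/asboolP => x mx.
by apply: mmin; exact: same_trans mx.
Qed.

Lemma second_ex u : big u -> exists2 m, same u m & m \in seconds.
Proof.
move=> bu; have [m1 um1 /firstsP[bm1 fm1]] := first_ex bu.
have [||m] := @least (cell u :\ m1) u (big_inner bu).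
- by move=> z; rewrite !inE => /andP[].
- have : 1 < #|cell u| by rewrite (eqP bu).
  rewrite (cardsD1 m1) inE um1 add1n ltnS => /card_gt0P[z zP]; by exists z.
rewrite !inE => /andP[mm1 um] mmin; exists m => //.
rewrite inE (big_same um bu); apply/asboolP; exists m1; split=> //.
- by apply: same_trans um1; rewrite same_sym.
- by rewrite eq_sym.
by move=> x mx xm xm1; apply: mmin; rewrite // !inE xm1 (same_trans um).
Qed.

Lemma first_uniq m m' : m \in firsts -> m' \in firsts -> same m m' -> m = m'.
Proof.
move=> /firstsP[bm fm] /firstsP[_ fm'] mm; apply/eqP/negPn/negP => ne.
have ne' : m' != m by rewrite eq_sym.
apply: (lt_irr (big_inner bm) mm ne (fm _ mm ne')).
by apply: fm' => //; rewrite same_sym.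
Qed.

Lemma second_first m m1 : m \in seconds -> m1 \in firsts -> same m m1 ->
  m1 != m /\ forall x, same m x -> x != m -> x != m1 -> lt m x.
Proof.
move=> /secondsP[bm [m1' [s1 ne f1 h]]] m1F sm.
suff -> : m1 = m1' by [].
apply: first_uniq => //; last by apply: same_trans s1; rewrite same_sym.
by rewrite inE (big_same s1 bm); apply/asboolP.
Qed.

Lemma second_uniq m m' : m \in seconds -> m' \in seconds -> same m m' -> m = m'.
Proof.
move=> mS mS' mm; have [bm _] := secondsP mS.
have [m1 s1 F1] := first_ex bm.
have s1' : same m' m1 by apply: same_trans s1; rewrite same_sym.
have [ne1 h] := second_first mS F1 s1; have [ne1' h'] := second_first mS' F1 s1'.
apply/eqP/negPn/negP => ne; have ne' : m' != m by rewrite eq_sym.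
apply: (lt_irr (big_inner bm) mm ne); first by apply: h; rewrite // eq_sym.
by apply: h' => //; rewrite 1?same_sym // eq_sym.
Qed.

(** Equal sizes give equal degrees in both directions by [cell_nb], and [one_sided] forbids degree
    two on both sides. *)
Lemma big_matching u t : big u -> big t -> ~~ same u t -> adj u t ->
  nb u t = 1 /\ nb t u = 1.
Proof.
move=> bu bt nut ut.
have := cell_nb eqt u t; rewrite (eqP bu) (eqP bt) => /eqP.
rewrite eqn_pmul2l; last exact: ltnW n2.
move/eqP=> e; have p := nb_gt0 ut (same_refl t).
have := one_sided (big_inner bu) (big_inner bt) nut; rewrite -e in p *.
by case: (nb u t) p => [|[|k]] // _ /(_ isT).
Qed.

(** The matching between two largest cells preserves the order, so it pairs their first vertices; in
    [second_step] it likewise pairs the next ones. *)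
Lemma first_step u t : u \in firsts -> big t -> ~~ same u t -> adj u t -> t \in firsts.
Proof.
move=> uF bt nut ut; have [bu fu] := firstsP uF.
have [nut1 ntu1] := big_matching bu bt nut ut.
have [t1 tt1 t1F] := first_ex bt; have [_ ft1] := firstsP t1F.
have [->//|ne] := eqVneq t t1.
have [u1 t1u1 uu1] : exists2 u1, adj t1 u1 & same u u1.
  by apply: (@nb_ex _ same); rewrite -(eqt u tt1) ntu1.
have ne' : t1 != t by rewrite eq_sym.
have uu : u != u1.
  apply: contraNneq ne => uu; apply/eqP; apply: (nb_uniq nut1 ut (same_refl t)) => //.
  by rewrite uu adj_sym.
have uu' : u1 != u by rewrite eq_sym.
have E := edges_rule (big_inner bu) (big_inner bt) nut uu1 tt1 ut.
rewrite adj_sym in t1u1; have {}E := E t1u1 uu ne.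
case: (lt_irr (big_inner bu) uu1 uu (fu _ uu1 uu')); apply/E.
by apply: ft1; rewrite // same_sym.
Qed.

Lemma second_step u t : u \in seconds -> big t -> ~~ same u t -> adj u t ->
  t \in seconds.
Proof.
move=> uS bt nut ut; have [bu _] := secondsP uS.
have [nut1 ntu1] := big_matching bu bt nut ut.
have [u1 su1 u1F] := first_ex bu; have [u1u hu] := second_first uS u1F su1.
have [t1 u1t1 tt1] : exists2 t1, adj u1 t1 & same t t1.
  by apply: (@nb_ex _ same); rewrite -(eqt t su1) nut1.
have bu1 := big_same su1 bu.
have bt1 := big_same tt1 bt.
have nu1t1 : ~~ same u1 t1.
  apply: contra nut => h; apply: same_trans (same_trans su1 h) _.
  by rewrite same_sym.
have t1F := first_step u1F bt1 nu1t1 u1t1.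
have t1t : t1 != t.
  apply: contraNneq u1u => e; apply/eqP; apply: (nb_uniq ntu1) => //.
  by rewrite adj_sym -e.
  by rewrite adj_sym.
rewrite inE bt; apply/asboolP; exists t1; split=> //.
  by have [] := firstsP t1F.
move=> x tx xt xt1.
have [ux xux uux] : exists2 ux, adj x ux & same u ux.
  by apply: (@nb_ex _ same); rewrite -(eqt u tx) ntu1.
have nuxu : u != ux.
  apply: contraNneq xt => e; apply/eqP; symmetry.
  by apply: (nb_uniq nut1 ut (same_refl t)) => //; rewrite e adj_sym.
have nt1u : nb u1 t = 1 by rewrite -(eqt t su1).
have nuxu1 : ux != u1.
  apply: contraNneq xt1 => e; apply/eqP; symmetry.
  by apply: (nb_uniq nt1u u1t1 tt1) => //; rewrite -e adj_sym.
have luux : lt u ux by apply: hu; rewrite // eq_sym.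
have tx' : t != x by rewrite eq_sym.
have E := edges_rule (big_inner bu) (big_inner bt) nut uux tx ut.
rewrite adj_sym in xux; have {}E := E xux nuxu tx'.
case: (lt_total (big_inner bt) tx tx') => // l.
by case: (lt_irr (big_inner bu) uux nuxu luux); apply/E.
Qed.

(** Edges inside a cell form a matching. If [m1] were matched to some [t] other than [m2], and [m2]
    to [t2], then [m2] before [t] would put [t2] before [m1], which is first. *)
Lemma twin_inner m1 m2 t : m1 \in firsts -> m2 \in seconds -> same m1 m2 ->
  adj m1 t -> same m1 t -> t = m2.
Proof.
move=> F1 S2 s12 m1t s1t; have [b1 f1] := firstsP F1; have i1 := big_inner b1.
have s21 : same m2 m1 by rewrite same_sym.
have [ne h2] := second_first S2 F1 s21; apply/eqP/negPn/negP => tm2.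
have d1 : nb m1 m1 = 1.
  by apply/eqP; rewrite eqn_leq inner_degree // (nb_gt0 m1t s1t).
have [t2 m2t2 s1t2] : exists2 t2, adj m2 t2 & same m1 t2.
  by apply: (@nb_ex _ same); rewrite -(eqt m1 s12) d1.
have adj_ne (x x' : G) : adj x x' -> x != x'.
  by apply: contraTneq => ->; rewrite adj_irrefl.
have tm1 : t != m1 by rewrite eq_sym adj_ne.
have t2m1 : t2 != m1.
  apply: contraNneq tm2 => e; apply/eqP; apply: (nb_uniq d1 m1t s1t) => //.
  by rewrite adj_sym -e.
have t2m2 : t2 != m2 by rewrite eq_sym adj_ne.
have cl x y : same m1 x -> same m1 y -> same x y.
  by move=> ux uy; apply: same_trans uy; rewrite same_sym.
have E : lt t2 m1 <-> lt m2 t.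
  apply: (lt_level_edges cert conn3 hf) => //.
  - exact: inner_same s1t2 i1.
  - exact: inner_same s1t i1.
  - exact: inner_same s12 i1.
  - exact/f_same/cl.
  - exact/f_same/cl.
  - by rewrite adj_sym.
  - by rewrite eq_sym.
  - apply/eqP => e; rewrite e in m2t2.
    have dt : nb t m1 = 1 by rewrite -(eqt m1 s1t).
    by move: ne; rewrite (nb_uniq dt _ (same_refl m1) _ s12) ?eqxx // adj_sym.
have l2 : lt m2 t by apply: h2 => //; exact: cl.
apply: (lt_irr i1 s1t2 _ (f1 _ s1t2 t2m1)); first by rewrite eq_sym.
exact/E.
Qed.

(** By double counting [e] has at least two neighbours in the cell of [u], and [u] has only one in
    that of [e]. If the least vertex [e0] of the cell of [e] were not [e], all neighbours of [e0] in
    the cell of [u] would precede [u]; but a first vertex has no predecessor and a second one has a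
    single one. *)
Lemma small_center u e : u \in firsts \/ u \in seconds -> adj u e -> #|cell e| < n ->
  1 < #|cell e| -> forall x, same e x -> x != e -> lt e x.
Proof.
move=> uFS ue small e2; have ie := cell_inner e2.
have bu : big u by case: uFS => [/firstsP[]|/secondsP[]].
have iu := big_inner bu.
have nue : ~~ same u e.
  apply/negP => h; move: small; rewrite -(same_cell same_sym same_trans h).
  by rewrite (eqP bu) ltnn.
have p := nb_gt0 ue (same_refl e).
have cnt := cell_nb eqt u e; rewrite (eqP bu) in cnt.
have lte : nb u e < nb e u.
  rewrite ltnNge; apply/negP => le.
  have : #|cell e| * nb e u < n * nb u e.
    apply: leq_ltn_trans (_ : _ <= #|cell e| * nb u e) _; first exact: leq_mul.
    by rewrite ltn_pmul2r.
  by rewrite -cnt ltnn.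
have neu : 1 < nb e u by exact: leq_ltn_trans p lte.
have nue1 : nb u e = 1.
  apply/eqP; rewrite eqn_leq p andbT; apply: (one_sided ie iu) => //.
  by rewrite same_sym.
have [e0 ee0 emin] := cell_least ie.
have [->|ne] := eqVneq e e0; first by move=> x ex; apply: emin; exact: same_trans ex.
have le0 : lt e0 e by apply: emin.
have key c : adj c e0 -> same u c -> u != c -> lt c u.
  move=> ce0 uc nuc.
  by apply/(edges_rule iu ie nue uc ee0 ue ce0 nuc ne).
case: uFS => [uF|uS]; exfalso.
  have [_ fu] := firstsP uF.
  have [c e0c uc] : exists2 c, adj e0 c & same u c.
    by apply: (@nb_ex _ same); rewrite -(eqt u ee0) ltnW.
  have nuc : u != c.
    apply: contraNneq ne => uc'; apply/eqP; apply: (nb_uniq nue1 ue (same_refl e)) => //.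
    by rewrite uc' adj_sym.
  rewrite adj_sym in e0c; apply: (lt_irr iu uc nuc _ (key c e0c uc nuc)).
  by apply: fu; rewrite // eq_sym.
have [u1 su1 u1F] := first_ex bu; have [u1u hu] := second_first uS u1F su1.
have neu0 : 1 < nb e0 u by rewrite -(eqt u ee0).
have [c [e0c uc cu1]] := nb_other u1 neu0.
have nuc : u != c.
  apply: contraNneq ne => uc'; apply/eqP; apply: (nb_uniq nue1 ue (same_refl e)) => //.
  by rewrite uc' adj_sym.
rewrite adj_sym in e0c; apply: (lt_irr iu uc nuc _ (key c e0c uc nuc)).
by apply: hu; rewrite // eq_sym.
Qed.

(** By [small_center] both vertices can only be adjacent to the least vertex of the small cell. *)
Lemma small_common u u' e : u \in firsts \/ u \in seconds ->
  u' \in firsts \/ u' \in seconds -> same u u' -> adj u e -> #|cell e| < n -> adj u' e.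
Proof.
move=> uFS uFS' uu ue small.
have [e' u'e' ee'] : exists2 e', adj u' e' & same e e'.
  by apply: (@nb_ex _ same); rewrite -(eqt e uu) (nb_gt0 ue (same_refl e)).
suff <- : e' = e by [].
case: (ltnP 1 #|cell e|) => [e2|e1]; last first.
  apply/eqP/negPn/negP => ne; have : 1 < #|cell e|.
    by apply/card_gt1P; exists e', e; rewrite !inE.
  by rewrite ltnNge e1.
have small' : #|cell e'| < n by rewrite -(same_cell same_sym same_trans ee').
have e2' : 1 < #|cell e'| by rewrite -(same_cell same_sym same_trans ee').
apply/eqP/negPn/negP => ne; have ne' : e != e' by rewrite eq_sym.
apply: (lt_irr (cell_inner e2) ee' ne').
  exact: (small_center uFS ue small e2).
by apply: (small_center uFS' u'e' small' e2') => //; rewrite same_sym.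
Qed.

(** [Q1] is a component of [firsts] and [Q2] consists of its twins in [seconds]. Once every other
    vertex is known to be adjacent to [Q1], hence to lie in a smaller cell, a largest cell is
    contained in the two sheets. Each sheet holds at most one of its vertices, so [n] is 2. *)
Lemma reflection_big u0 : big u0 -> exists (Q1 Q2 : {set G}),
  [/\ u0 \in Q1 :|: Q2 \/ n = 2, vconnected (@adj G) Q1,
      forall u, u \notin Q1 -> u \notin Q2 -> #|cell u| = 1,
      {in Q1, forall u, u \in firsts} /\ {in Q2, forall u, u \in seconds} &
      n = 2 /\ forall u m, u \in Q1 -> adj u m -> m \in Q2 -> same u m].
Proof.
move=> bu0; have [x0 _ x0F] := first_ex bu0; have [bx0 _] := firstsP x0F.
pose Q1 := vcomponent (@adj G) firsts x0.
pose Q2 := [set m in seconds | [exists m1 in Q1, same m1 m]].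
have Q1F u : u \in Q1 -> u \in firsts by apply: component_sub.
have Q2S u : u \in Q2 -> u \in seconds by rewrite inE => /andP[].
have Q2tw m : m \in Q2 -> exists2 m1, m1 \in Q1 & same m1 m.
  by rewrite inE => /andP[_ /exists_inP].
have Q2I m m1 : m \in seconds -> m1 \in Q1 -> same m1 m -> m \in Q2.
  by move=> mS m1Q mm; rewrite inE mS; apply/exists_inP; exists m1.
have FS m : m \in firsts -> m \in seconds -> False.
  move=> mF mS; have [ne _] := second_first mS mF (same_refl m).
  by rewrite eqxx in ne.
have Q1c : vconnected (@adj G) Q1 by exact: component_connected (@adj_sym G) _ _.
have bigQ1 u : u \in Q1 -> big u by move/Q1F/firstsP => -[].
have bigQ2 u : u \in Q2 -> big u by move/Q2S/secondsP => -[].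
have nsQ1 u t : u \in Q1 -> t \in Q1 -> adj u t -> ~~ same u t.
  move=> uQ tQ ut; apply/negP => st.
  by have e := first_uniq (Q1F u uQ) (Q1F t tQ) st; rewrite e adj_irrefl in ut.
have Q2c : vconnected (@adj G) Q2.
  have cs := sym_connect_sym (induced_sym (@adj_sym G) Q2).
  move=> a b aQ bQ; have [a1 a1Q sa] := Q2tw a aQ; have [b1 b1Q sb] := Q2tw b bQ.
  case/connectP: (Q1c a1 b1 a1Q b1Q) => p pp eb.
  elim: p a1 a a1Q aQ sa pp eb => [|c1 p IH] a1 a a1Q aQ sa /=.
    move=> _ e; rewrite e in sb; suff -> : a = b by rewrite connect0.
    apply: second_uniq (Q2S a aQ) (Q2S b bQ) _.
    by apply: same_trans sb; rewrite same_sym.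
  case/andP=> /and3P[_ c1Q ac1] pp eb.
  have na := nsQ1 _ _ a1Q c1Q ac1.
  have [c ac sc] : exists2 c, adj a c & same c1 c.
    by apply: (@nb_ex _ same); rewrite -(eqt c1 sa) (nb_gt0 ac1 (same_refl c1)).
  have nac : ~~ same a c.
    apply: contra na => h; apply: same_trans (same_trans sa h) _.
    by rewrite same_sym.
  have cS := second_step (Q2S a aQ) (big_same sc (bigQ1 _ c1Q)) nac ac.
  have cQ := Q2I _ _ cS c1Q sc.
  apply: connect_trans (IH c1 c c1Q cQ sc pp eb).
  by apply: connect1; rewrite /induced /= aQ cQ ac.
(* the neighbours of the two sheets outside of them lie in smaller cells *)
have nbQ1 u e : u \in Q1 -> adj u e -> e \notin Q1 -> e \notin Q2 -> #|cell e| < n.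
  move=> uQ ue eQ1 eQ2; rewrite ltn_neqAle n_max andbT; apply/negP => be.
  have uF := Q1F u uQ; case: (boolP (same u e)) => sue.
    have [m um mS] := second_ex (bigQ1 u uQ).
    have em := twin_inner uF mS um ue sue.
    by rewrite em (Q2I m u) in eQ2.
  have eF := first_step uF be sue ue.
  by rewrite (component_closed uQ eF ue) in eQ1.
have nbQ2 u e : u \in Q2 -> adj u e -> e \notin Q1 -> e \notin Q2 -> #|cell e| < n.
  move=> uQ ue eQ1 eQ2; rewrite ltn_neqAle n_max andbT; apply/negP => be.
  have uS := Q2S u uQ; have [u1 u1Q su] := Q2tw u uQ.
  case: (boolP (same u e)) => sue.
    have u1F := Q1F u1 u1Q.
    have du : nb u u1 = 1.
      apply/eqP; rewrite eqn_leq (nb_gt0 ue (same_trans su sue)) andbT.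
      by rewrite -(eqt u1 su) inner_degree // big_inner // bigQ1.
    have [t u1t st] : exists2 t, adj u1 t & same u1 t.
      by apply: (@nb_ex _ same); rewrite (eqt u1 su) du.
    have tu := twin_inner u1F uS su u1t st.
    have e1 : u1 = e.
      apply: (nb_uniq du) (same_refl u1) ue (same_trans su sue).
      by rewrite adj_sym -tu.
    by rewrite -e1 u1Q in eQ1.
  have eS := second_step uS be sue ue.
  have [t u1t st] : exists2 t, adj u1 t & same e t.
    by apply: (@nb_ex _ same); rewrite (eqt e su) (nb_gt0 ue (same_refl e)).
  have n1t : ~~ same u1 t.
    apply: contra sue => h; rewrite same_sym; apply: same_trans (same_trans st _) su.
    by rewrite same_sym.
  have tF := first_step (Q1F u1 u1Q) (big_same st be) n1t u1t.
  have tQ := component_closed u1Q tF u1t.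
  by rewrite (Q2I e t) // 1?same_sym in eQ2.
pose N := [set e | [&& e \notin Q1, e \notin Q2 & adjacent_to (@adj G) e Q1]].
have com u u' e : u \in Q1 :|: Q2 -> u' \in Q1 :|: Q2 -> same u u' -> adj u e ->
    #|cell e| < n -> adj u' e.
  have M x : x \in Q1 :|: Q2 -> x \in firsts \/ x \in seconds.
    by rewrite finset.in_setU => /orP[/Q1F|/Q2S]; [left | right].
  by move=> uQ uQ'; apply: small_common; exact: M.
have N12 e : e \notin Q1 -> e \notin Q2 ->
    adjacent_to (@adj G) e Q1 = adjacent_to (@adj G) e Q2.
  move=> e1 e2; apply/idP/idP => /exists_inP[u uQ eu]; rewrite adj_sym in eu.
    have [m um mS] := second_ex (bigQ1 u uQ); have mQ := Q2I m u mS uQ um.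
    apply/exists_inP; exists m => //; rewrite adj_sym.
    by apply: (com u) => //; rewrite ?finset.in_setU ?uQ ?mQ ?orbT // (nbQ1 u).
  have [m mQ mu] := Q2tw u uQ; apply/exists_inP; exists m => //; rewrite adj_sym.
  by apply: (com u); rewrite ?finset.in_setU ?uQ ?mQ ?orbT // 1?same_sym // (nbQ2 u).
(* Otherwise a component [W] of the vertices away from the sheets and from [N] has, by
   3-connectivity, three neighbours in [N]. Each of them is adjacent to [Q1], to [Q2] by [N12], and
   to [W]: a $K_{3,3}$ minor. *)
have full x : [|| x \in Q1, x \in Q2 | x \in N].
  apply/negPn/negP; rewrite !negb_or => /and3P[x1 x2 xN].
  pose R := ~: (Q1 :|: Q2 :|: N).
  have inR z : (z \in R) = [&& z \notin Q1, z \notin Q2 & z \notin N].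
    by rewrite finset.in_setC !finset.in_setU !negb_or -andbA.
  pose W := vcomponent (@adj G) R x.
  have xR : x \in R by rewrite inR x1 x2 xN.
  have xW : x \in W by exact: mem_component.
  have WR z : z \in W -> z \in R by exact: component_sub.
  have Wout a b : a \in W -> adj a b -> b \notin W -> b \in N.
    move=> aW ab bW; have /and3P[a1 a2 aN] : [&& a \notin Q1, a \notin Q2 & a \notin N].
      by rewrite -inR WR.
    have aQ1 : ~~ adjacent_to (@adj G) a Q1 by move: aN; rewrite inE a1 a2.
    have aQ2 : ~~ adjacent_to (@adj G) a Q2 by rewrite -N12.
    apply/negPn/negP => bN; case/negP: bW; apply: (component_closed aW _ ab).
    rewrite inR bN andbT; apply/andP; split.
      by apply: contra aQ1 => bQ; apply/exists_inP; exists b.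
    by apply: contra aQ2 => bQ; apply/exists_inP; exists b.
  pose NW := [set e in N | adjacent_to (@adj G) e W].
  have x0Q : x0 \in Q1 by exact: mem_component.
  have x0N : x0 \notin N by rewrite inE x0Q.
  have NW3 : 2 < #|NW|.
    rewrite ltnNge; apply/negP => le2.
    have : x0 \in W.
      apply: (minus_closed conn3 (X := NW) (u := x)) => //.
      - by rewrite inE (negbTE xN).
      - by rewrite inE (negbTE x0N).
      move=> a b aW ab bNW; apply/negPn/negP => bW.
      case/negP: bNW; rewrite inE (Wout a b) //=; apply/exists_inP; exists a => //.
      by rewrite adj_sym.
    by move/WR; rewrite inR x0Q.
  have [x3 [y3 [z3 [xn yn zn U]]]] : exists x y z, [/\ x \in NW, y \in NW, z \in NW &
      uniq [:: x; y; z]].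
    have : 3 <= size (enum NW) by rewrite -cardE.
    have mem t : t \in enum NW -> t \in NW by rewrite mem_enum.
    case: (enum NW) (enum_uniq NW) mem => [|x' [|y' [|z' l]]] // ul mem _.
    exists x', y', z'; rewrite !mem ?inE ?eqxx ?orbT //; split=> //.
    move: ul; rewrite /= !inE !negb_or => /and3P[/and3P[-> -> _] /andP[-> _] _] //.
  have [crs asy _ _] := cert.
  pose r' (a b c : G) := r (Some a) (Some b) (Some c).
  pose s' (a b : G) := s (Some a) (Some b).
  have SN (a b : G) : a != b -> Some a != Some b by apply: contraNneq => -[->].
  have crs' a b c d : adj a b -> adj c d -> a != c -> a != d -> b != c -> b != d ->
    r' c a b (+) r' d a b (+) r' a c d (+) r' b c d = s' a c (+) s' a d (+) s' b c (+) s' b d.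
    by move=> ab cd ? ? ? ?; apply: crs => //; exact: SN.
  have asy' a b : a != b -> s' a b = ~~ s' b a by move=> ?; apply: asy; exact: SN.
  have mNW t : t \in [:: x3; y3; z3] -> t \in NW.
    by rewrite !in_cons in_nil orbF => /or3P[]/eqP->.
  apply: (no_K33 (@adj_sym G) crs' asy' Q1c Q2c
    (component_connected (@adj_sym G) (A := R) (x := x)) _ _ _ U).
  - rewrite disjoint_subset; apply/fintype.subsetP => z zQ; rewrite inE.
    by apply/negP => zQ2; exact: FS (Q1F z zQ) (Q2S z zQ2).
  - rewrite disjoint_subset; apply/fintype.subsetP => z zQ; apply/negP => /WR.
    by rewrite inR zQ.
  - rewrite disjoint_subset; apply/fintype.subsetP => z zQ; apply/negP => /WR.
    by rewrite inR zQ andbF.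
  - move=> t /mNW; rewrite inE => /andP[tN _]; rewrite !finset.in_setU !negb_or.
    move: (tN); rewrite inE => /and3P[-> -> _] /=; apply/negP => /WR.
    by rewrite inR tN !andbF.
  - move=> t /mNW; rewrite inE => /andP[tN tW]; move: tN; rewrite inE.
    by case/and3P=> t1 t2 tQ; split=> //; rewrite -N12.
have smallN e : e \notin Q1 -> e \notin Q2 -> #|cell e| < n.
  move=> e1 e2; have := full e; rewrite (negbTE e1) (negbTE e2) /= inE.
  case/and3P=> _ _ /exists_inP[u uQ eu]; apply: (nbQ1 u) => //.
  by rewrite adj_sym.
have x0Q : x0 \in Q1 by exact: mem_component.
have [m x0m mS] := second_ex bx0; have mQ := Q2I m x0 mS x0Q x0m.
have nE : n = 2.
  have c2 : cell x0 \subset [set x0; m].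
    apply/fintype.subsetP => z; rewrite inE => sz; rewrite !inE.
    have bz := big_same sz bx0.
    have : (z \in Q1) || (z \in Q2).
      apply/negPn/negP; rewrite negb_or => /andP[z1 z2].
      by have := smallN z z1 z2; rewrite (eqP bz) ltnn.
    case/orP=> [zQ|zQ].
      by rewrite (first_uniq x0F (Q1F z zQ) sz) eqxx.
    rewrite (second_uniq mS (Q2S z zQ)) ?eqxx ?orbT //.
    by apply: same_trans sz; rewrite same_sym.
  apply/eqP; rewrite eqn_leq n2 andbT -(eqP bx0).
  by apply: leq_trans (subset_leq_card c2) _; rewrite cards2; case: (_ != _).
exists Q1, Q2; split=> //; first by right.
  move=> u u1 u2; have := smallN u u1 u2; rewrite nE ltnS => le.
  by apply/eqP; rewrite eqn_leq le; apply/card_gt0P; exists u; rewrite inE.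
split=> // u t uQ ut tQ; apply/negPn/negP => ns.
have tF := first_step (Q1F u uQ) (bigQ2 t tQ) ns ut.
exact: FS tF (Q2S t tQ).
Qed.

End Largest.

(** [K] is one of the two sheets: no edge leads from it to the other sheet except from a vertex to
    its own mirror image. A discrete partition is covered by the identity with empty [K]. *)
Definition reflective (tau : G -> G) (K : {set G}) :=
  [/\ involutive tau /\ (forall u t, same u t = (t == u) || (t == tau u)),
      forall u, u \in K -> tau u \notin K,
      forall u, tau u != u -> (u \in K) || (tau u \in K),
      forall u t, u \in K -> adj u t -> [|| t \in K, tau t == t | t == tau u] &
      vconnected (@adj G) K].

Theorem reflection : exists tau K, reflective tau K.
Proof.
pose n := \max_u #|cell u|.
have n_max u : #|cell u| <= n by exact: (leq_bigmax u).
have same_card u t : same u t -> #|cell u| = 1 -> t = u.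
  move=> ut /eqP/cards1P[z e].
  have : t \in [set z] by rewrite -e inE.
  have : u \in [set z] by rewrite -e inE.
  by rewrite !inE => /eqP-> /eqP->.
have card_pos u : 0 < #|cell u| by apply/card_gt0P; exists u; rewrite inE.
case: (ltnP 1 n) => [n2|n1]; last first.
  exists id, finset.set0; split=> //; try by move=> u; rewrite ?inE ?eqxx.
  - split=> // u t; rewrite orbb; apply/idP/eqP => [ut|->//].
    apply: same_card ut _; apply/eqP; rewrite eqn_leq card_pos.
    by rewrite (leq_trans (n_max u)).
have [u0 _ bu0] : exists2 u0, true & #|cell u0| == n.
  have [u0 e] := @bigop.eq_bigmax _ (fun u : G => #|cell u|) (ltnW (ltnW (ltnW (proj1 conn3)))).
  by exists u0 => //; rewrite /n e.
have [Q1 [Q2 [_ Q1c small [QF QS] [nE Q12]]]] := reflection_big n2 n_max bu0.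
(* The default [u] fixes the vertices whose cell is a singleton. *)
pose tau u := odflt u [pick t | same u t & t != u].
have tauP u : same u (tau u).
  by rewrite /tau; case: pickP => [t /andP[]//|_] /=.
have cell2 u t : same u t -> t != u -> tau u = t.
  move=> ut tu; rewrite /tau; case: pickP => [z /andP[uz zu]|/(_ t)] /=; last first.
    by rewrite ut tu.
  apply/eqP/negPn/negP => zt; have : #|[set u; t; z]| <= n.
    apply: leq_trans (n_max u); apply: subset_leq_card; apply/fintype.subsetP => x.
    by rewrite !inE => /orP[/orP[]|]/eqP->.
  rewrite nE -finset.setUA cardsU1 cards2 !inE negb_or ![u == _]eq_sym tu zu.
  by rewrite eq_sym zt.
have same_tau u t : same u t = (t == u) || (t == tau u).
  apply/idP/orP => [ut|[/eqP->//|/eqP->//]].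
  have [->|tu] := eqVneq t u; [by left | right].
  by rewrite (cell2 u t) ?eqxx.
have tauK : involutive tau.
  move=> u; have [e|ne] := eqVneq (tau u) u; first by rewrite !e.
  by apply: cell2; rewrite 1?same_sym // eq_sym.
have big1 u : u \in Q1 \/ u \in Q2 -> #|cell u| = n.
  by case=> [/QF/firstsP[/eqP]|/QS/secondsP[/eqP]].
exists tau, Q1; split=> //.
- move=> u uQ; apply/negP => tQ; have [bu _] := firstsP (QF u uQ).
  have e := first_uniq n2 (QF u uQ) (QF _ tQ) (tauP u).
  have : 1 < #|cell u| by rewrite (eqP bu).
  case/card_gt1P=> x [y []]; rewrite !inE !same_tau -e !orbb => /eqP-> /eqP->.
  by rewrite eqxx.
- move=> u tu; have b : u \in Q1 \/ u \in Q2.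
    case: (boolP (u \in Q1)) => u1; [by left | right].
    apply/negPn/negP => u2; move: tu.
    by rewrite (same_card u (tau u)) ?eqxx // small.
  have b' : tau u \in Q1 \/ tau u \in Q2.
    case: (boolP (tau u \in Q1)) => u1; [by left | right].
    apply/negPn/negP => u2; move: tu.
    by rewrite -(same_card (tau u) u) ?eqxx // ?small // same_sym.
  case: b => [->//|uS]; case: b' => [->|tS]; first by rewrite orbT.
  have e := second_uniq n2 (QS _ uS) (QS _ tS) (tauP u).
  by rewrite -e eqxx in tu.
- move=> u t uQ ut; case: (boolP (t \in Q1)) => //= tQ.
  case: (boolP (t \in Q2)) => tQ2.
    have := Q12 u t uQ ut tQ2; rewrite same_tau => /orP[/eqP e|->]; last by rewrite orbT.
    by rewrite e adj_irrefl in ut.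
  by rewrite (same_card t (tau t)) ?eqxx // small.
Qed.

End Reflection.

(** * Counting closed walks *)

Section Walks.
Variables (V : finType) (a : rel V).
Hypothesis a_sym : symmetric a.

(* Walks of length [k] in the graph with two loops added at every vertex. *)
Fixpoint walks k (x z : V) : nat :=
  if k is k'.+1 then 2 * walks k' x z + \sum_(t | a x t) walks k' t z else x == z.

Lemma sum_eq_op (P : pred V) z : \sum_(t | P t) (t == z) = P z :> nat.
Proof.
rewrite big_mkcond (bigD1 z) //= eqxx big1 ?addn0; first by case: (P z).
by move=> t /negbTE->; case: ifP.
Qed.

Lemma walks_rec k x z : walks k.+1 x z = 2 * walks k x z + \sum_(t | a t z) walks k x t.
Proof.
elim: k x z => [|k IH] x z.
  rewrite /= sum_eq_op; congr (_ + _).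
  by under eq_bigr do rewrite eq_sym; rewrite sum_eq_op.
have D j y t : walks j.+1 y t = 2 * walks j y t + \sum_(m | a y m) walks j m t by [].
have e := IH x z; rewrite D in e; move/addnI: e => e.
rewrite D [in RHS](eq_bigr _ (fun t _ => D k x t)) (eq_bigr _ (fun t _ => IH t z)).
have e2 : \sum_(t | a x t) 2 * walks k t z = \sum_(t | a t z) 2 * walks k x t.
  by rewrite -!big_distrr e.
congr (_ + _); rewrite [LHS]big_split [RHS]big_split /= e2; congr (_ + _).
exact: exchange_big.
Qed.

Lemma walks_sym k x z : walks k x z = walks k z x.
Proof.
elim: k x z => [|k IH] x z; first by rewrite /= eq_sym.
rewrite walks_rec [RHS]/= IH; congr (_ + _).
by apply: eq_big => t; rewrite 1?a_sym // => _; rewrite IH.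
Qed.

End Walks.

(** * Two relations with the same counts: odd parts and signs *)

Section Twist.
Variables (V : finType) (same : rel V) (tau : V -> V) (K : {set V}).
Hypothesis same_refl : reflexive same.
Hypothesis same_sym : symmetric same.
Hypothesis same_trans : transitive same.
Hypothesis tauK : involutive tau.
Hypothesis same_tau : forall u t, same u t = (t == u) || (t == tau u).
Hypothesis K_tau : forall u, u \in K -> tau u \notin K.
Hypothesis tau_K : forall u, tau u != u -> (u \in K) || (tau u \in K).

Definition nbr (a : rel V) u c := #|[set t | a u t & same c t]|.

Lemma nbrE a u c : nbr a u c = if tau c == c then a u c : nat else a u c + a u (tau c).
Proof.
have E : nbr a u c = \sum_(t | same c t) a u t.
  rewrite /nbr -sum1_card [LHS]big_mkcond [RHS]big_mkcond /=; apply: eq_bigr => t _.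
  by rewrite inE andbC; case: (same c t) => //=; case: (a u t).
rewrite E; under eq_bigl do rewrite same_tau.
case: eqP => [tc|/eqP tc].
  by rewrite (bigD1 c) ?eqxx //= big1 ?addn0 // => t; rewrite tc orbb => /andP[->].
rewrite (bigD1 c) ?eqxx //= (bigD1 (tau c)) ?eqxx ?orbT ?tc //= big1 ?addn0 // => t.
by case/andP=> /andP[/orP[->|->]].
Qed.

(** A sum of values constant on the pairs of [tau] depends only on the number of neighbours in each
    pair. Doubling it symmetrises the terms without choosing representatives. *)
Lemma nbr_sum (a b : rel V) (g : V -> nat) x y :
  (forall c, nbr a x c = nbr b y c) -> (forall u, g (tau u) = g u) ->
  \sum_(t | a x t) g t = \sum_(t | b y t) g t.
Proof.
move=> ab gt.
have E (c : rel V) z : 2 * \sum_(t | c z t) g t =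
    \sum_t g t * (if tau t == t then 2 * nbr c z t else nbr c z t).
  have -> : \sum_(t | c z t) g t = \sum_t g t * c z t.
    by rewrite big_mkcond; apply: eq_bigr => t _; case: (c z t); rewrite ?muln1 ?muln0.
  have -> : 2 * \sum_t g t * c z t = \sum_t g t * c z t + \sum_t g t * c z (tau t).
    rewrite mul2n -addnn; congr (_ + _).
    rewrite [RHS](reindex_inj (inv_inj tauK)) /=; apply: eq_bigr => t _.
    by rewrite gt tauK.
  rewrite -big_split /=; apply: eq_bigr => t _; rewrite nbrE -mulnDr.
  by case: eqP => [->|]; rewrite ?mul2n -?addnn.
by apply/eqP; rewrite -(eqn_pmul2l (isT : 0 < 2)) !E; apply/eqP/eq_bigr => t _; rewrite ab.
Qed.

Section OneGraph.
Variable c : rel V.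
Hypothesis c_sym : symmetric c.
Hypothesis c_eq : forall x x' t, same x x' -> nbr c x t = nbr c x' t.

Notation wk := (walks c).

Definition cell_walks k x t := wk k x t + wk k x (tau t).

Lemma same_tauE u : same u (tau u). Proof. by rewrite same_tau eqxx orbT. Qed.

Lemma cell_walks_tau k x t : cell_walks k (tau x) t = cell_walks k x t.
Proof.
elim: k x t => [|k IH] x t.
  rewrite /cell_walks /= addnC (inj_eq (inv_inj tauK)); congr (_ + nat_of_bool _).
  by rewrite -(inj_eq (inv_inj tauK)) tauK.
rewrite /cell_walks /= addnACA [RHS]addnACA -!mulnDr -!big_split /=.
rewrite -!/(cell_walks k _ t) IH; congr (_ + _).
apply: (@nbr_sum c c (fun y => cell_walks k y t)) => [d|u]; last exact: IH.
by rewrite -(c_eq d (same_tauE x)).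
Qed.

(** The block of two pairs [u], [tau u] and [t], [tau t] has equal row sums and, by symmetry, equal
    column sums, so its diagonal entries agree and so do its off-diagonal ones. Thus counts alone
    make [tau] an automorphism. *)
Lemma walks_tau k u t : wk k (tau u) (tau t) = wk k u t /\ wk k (tau u) t = wk k u (tau t).
Proof.
have := cell_walks_tau k u t; have := cell_walks_tau k t u; rewrite /cell_walks.
rewrite !(walks_sym c_sym k t) !(walks_sym c_sym k (tau t)); lia.
Qed.

Local Open Scope ring_scope.

(** The part of the walk matrix that is odd under [tau], while [cell_walks] is the even part.
    Restricted to [K] it is the [k]-th power of the matrix [coef], by [twist0] and [twist_rec]. *)
Definition twist k (u t : V) : int := (wk k u t)%:Z - (wk k u (tau t))%:Z.

Lemma twist_tau k u t : twist k (tau u) t = - twist k u t.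
Proof. by rewrite /twist; have [-> ->] := walks_tau k u t; rewrite opprB. Qed.

Lemma twist_taur k u t : twist k u (tau t) = - twist k u t.
Proof. by rewrite /twist tauK opprB. Qed.

Lemma twist_fix k u t : tau u = u -> twist k u t = 0.
Proof. by move=> fu; have := twist_tau k u t; rewrite fu; lia. Qed.

Lemma twist_sym k u t : twist k u t = twist k t u.
Proof.
rewrite /twist walks_sym //; congr (_ - _%:Z).
by rewrite (walks_sym c_sym k t); have [_ ->] := walks_tau k u t.
Qed.

(** The 2 comes from the loops. It outweighs a possible edge from [u] to [tau u], so that for
    irreflexive relations the diagonal is positive. *)
Definition coef (u y : V) : int := (u == y)%:Z * 2 + (c u y)%:Z - (c u (tau y))%:Z.

Lemma sum_K (g : V -> int) : (forall u, tau u = u -> g u = 0) ->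
  \sum_u g u = \sum_(y in K) (g y + g (tau y)).
Proof.
move=> gf; rewrite big_split /= (bigID (mem K)) /=; congr (_ + _).
rewrite (bigID (fun u => tau u \in K)) /= [X in _ + X]big1 ?addr0; last first.
  move=> u /andP[uK tK]; apply: gf; apply/eqP/negPn/negP => /tau_K.
  by rewrite (negbTE uK) (negbTE tK).
rewrite [RHS](reindex_inj (inv_inj tauK)) /=; apply: eq_big => [u|u _].
  by rewrite andb_idl // => /K_tau; rewrite tauK.
by rewrite tauK.
Qed.

Lemma twist_rec k u t : u \in K -> t \in K ->
  twist k.+1 u t = \sum_(y in K) coef u y * twist k y t.
Proof.
move=> uK tK.
have -> : twist k.+1 u t = twist k u t * 2 + \sum_(x | c u x) twist k x t.
  have S z : (\sum_(x | c u x) wk k x z)%N%:Z = \sum_(x | c u x) (wk k x z)%:Z.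
    exact: (big_morph Posz PoszD).
  by rewrite /twist sumrB -!S /=; lia.
rewrite big_mkcond /= sum_K; last first.
  by move=> x fx; rewrite twist_fix // if_same.
have -> : twist k u t * 2 = \sum_(y in K) (u == y)%:Z * 2 * twist k y t.
  rewrite (bigD1 u) //= eqxx big1 ?addr0; first by rewrite mul1r mulrC.
  by move=> y /andP[_ /negbTE]; rewrite eq_sym => ->; rewrite !mul0r.
rewrite -big_split /=; apply: eq_bigr => y _; rewrite twist_tau /coef.
by case: (c u y); case: (c u (tau y)); rewrite /= !mulrDl ?mul0r ?mul1r ?mulN1r ?addr0 ?oppr0 ?addr0 //; lia.
Qed.

Lemma twist0 u t : u \in K -> t \in K -> twist 0 u t = (u == t)%:Z.
Proof.
move=> uK tK; rewrite /twist /=; have -> : (u == tau t) = false.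
  by apply/negbTE/eqP => e; have := K_tau tK; rewrite -e uK.
by rewrite subr0.
Qed.

Lemma twistD j k u t : u \in K -> t \in K ->
  twist (j + k) u t = \sum_(y in K) twist j u y * twist k y t.
Proof.
move=> + tK; elim: j u => [|j IH] u uK.
  rewrite add0n (bigD1 u) //= twist0 // eqxx mul1r big1 ?addr0 // => y /andP[yK yu].
  by rewrite twist0 // eq_sym (negbTE yu) mul0r.
rewrite addSn twist_rec //; under eq_bigr => y yK do rewrite IH // mulr_sumr.
rewrite exchange_big /=; apply: eq_bigr => z zK; rewrite twist_rec // mulr_suml.
by apply: eq_bigr => y _; rewrite mulrA.
Qed.

Lemma twist1 u t : u \in K -> t \in K -> twist 1 u t = coef u t.
Proof.
move=> uK tK; rewrite twist_rec // (bigD1 t) //= twist0 // eqxx mulr1 big1 ?addr0 //.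
by move=> y /andP[yK /negbTE yt]; rewrite twist0 // yt mulr0.
Qed.

Lemma twist_trace k : \sum_u twist k u u = \sum_u ((wk k u u)%:Z * 2 - (cell_walks k u u)%:Z).
Proof. by apply: eq_bigr => u _; rewrite /twist /cell_walks; lia. Qed.

End OneGraph.

Variables a b : rel V.
Hypothesis a_sym : symmetric a.
Hypothesis b_sym : symmetric b.
Hypothesis a_irr : irreflexive a.
Hypothesis b_irr : irreflexive b.
Hypothesis ab_eq : forall x x' t, same x x' -> nbr a x t = nbr b x' t.
Hypothesis a_K : forall u t, u \in K -> a u t -> [|| t \in K, tau t == t | t == tau u].
Hypothesis K_conn : vconnected a K.
Hypothesis closed_walks : forall k, \sum_u walks a k u u = \sum_u walks b k u u.

Lemma a_eq x x' t : same x x' -> nbr a x t = nbr a x' t.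
Proof. by move=> xx; rewrite (ab_eq t xx) (ab_eq t (same_refl x')). Qed.

Lemma b_eq x x' t : same x x' -> nbr b x t = nbr b x' t.
Proof. by move=> xx; rewrite -(ab_eq t xx) -(ab_eq t (same_refl x)). Qed.

Lemma cell_walks_ab k x t : cell_walks a k x t = cell_walks b k x t.
Proof.
elim: k x t => [|k IH] x t //; rewrite /cell_walks /= addnACA [RHS]addnACA -!mulnDr -!big_split /=.
rewrite -!/(cell_walks _ k _ t) IH; congr (_ + _).
under eq_bigr => y _ do rewrite -/(cell_walks a k y t) IH.
apply: (@nbr_sum a b (fun y => cell_walks b k y t)) => [d|u].
  exact: ab_eq (same_refl x).
exact: cell_walks_tau b_eq _ _ _.
Qed.

Local Open Scope ring_scope.

Lemma a_tau_false u t : u \in K -> t \in K -> u != t -> a u (tau t) = false.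
Proof.
move=> uK tK ut; apply/negP => /(a_K uK); rewrite (negbTE (K_tau tK)) /= tauK.
case/orP=> [/eqP e|/eqP/(inv_inj tauK) e]; last by rewrite e eqxx in ut.
by have := K_tau tK; rewrite -e tK.
Qed.

Lemma K_moved u : u \in K -> (tau u == u) = false.
Proof. by move=> uK; apply/negbTE; apply: contraNneq (K_tau uK) => ->. Qed.

(** The relations have equally many edges from [u] into the pair of [t]. For distinct [u] and [t] in
    [K], such an edge of [a] can only end in [t]; in [b] it may end in [tau t] instead, which
    changes the sign. *)
Lemma coef_abs u t : u \in K -> t \in K ->
  0 <= coef a u t /\ (coef b u t = coef a u t \/ coef b u t = - coef a u t).
Proof.
move=> uK tK; have := ab_eq t (same_refl u); rewrite !nbrE (K_moved tK) /coef.
have [->|ut] := eqVneq u t.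
  rewrite !a_irr !b_irr; case: (a t (tau t)); case: (b t (tau t)) => //= _;
    by split; [|left]; lia.
rewrite (a_tau_false uK tK ut); case: (a u t); case: (b u t); case: (b u (tau t)) => //= _;
  split; lia.
Qed.

Lemma coef_diag u : u \in K -> 0 < coef a u u /\ coef b u u = coef a u u.
Proof.
move=> uK; have := ab_eq u (same_refl u); rewrite !nbrE (K_moved uK) /coef eqxx.
by rewrite !a_irr !b_irr; case: (a u (tau u)); case: (b u (tau u)) => //= _; lia.
Qed.

Lemma twist_bound k u t : u \in K -> t \in K -> `|twist b k u t| <= twist a k u t.
Proof.
move=> + tK; elim: k u => [|k IH] u uK; first by rewrite !twist0 //; case: eqP.
rewrite !(twist_rec _ _ _ uK tK) //; try exact: a_eq; try exact: b_eq.
apply: le_trans (ler_norm_sum _ _ _) _; apply: ler_sum => y yK.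
rewrite normrM; apply: ler_pM; rewrite ?normr_ge0 ?IH //.
by have [ge0 [->|->]] := coef_abs uK yK; rewrite ?normrN ger0_norm.
Qed.

(** The traces agree, because closed walks and the even parts do. Since the diagonal for [b] is
    bounded by that for [a], equality of the sums forces equality term by term. *)
Lemma twist_diag k u : u \in K -> twist b k u u = twist a k u u.
Proof.
have tr : \sum_x (twist a k x x - twist b k x x) = 0.
  rewrite sumrB !twist_trace -sumrB.
  rewrite (eq_bigr (fun x => ((walks a k x x)%:Z - (walks b k x x)%:Z) * 2)); last first.
    by move=> x _; rewrite cell_walks_ab; lia.
  rewrite -mulr_suml sumrB.
  have S (c : rel V) : (\sum_u walks c k u u)%N%:Z = \sum_u (walks c k u u)%:Z.
    exact: (big_morph Posz PoszD).
  by rewrite -!S closed_walks subrr mul0r.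
have ge0 x : 0 <= twist a k x x - twist b k x x.
  have H y : y \in K -> 0 <= twist a k y y - twist b k y y.
    by move=> yK; rewrite subr_ge0 (le_trans (ler_norm _)) // twist_bound.
  have T (c : rel V) : symmetric c -> (forall x x' t, same x x' -> nbr c x t = nbr c x' t) ->
      twist c k (tau x) (tau x) = twist c k x x.
    by move=> cs ce; rewrite twist_tau // twist_taur opprK.
  have [fx|nx] := eqVneq (tau x) x.
    by rewrite !twist_fix ?subrr //; [exact: b_eq | exact: a_eq].
  case/orP: (tau_K nx) => [/H//|/H].
  by rewrite !T //; [exact: b_eq | exact: a_eq].
move=> uK; move/eqP: tr; rewrite psumr_eq0 => [|x _]; last exact: ge0.
by move/allP/(_ u (mem_index_enum u)); rewrite /= subr_eq0 => /eqP.
Qed.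

(** By symmetry of the odd matrix, the diagonal entry of the power [k + k] at [u] is the sum of
    squares of row [u] of the power [k]. These sums agree while the entries are dominated, so
    absolute values agree. *)
Lemma twist_abs k u t : u \in K -> t \in K -> `|twist b k u t| = twist a k u t.
Proof.
move=> uK tK; have := twist_diag (k + k) uK; rewrite !twistD //; try exact: a_eq;
  try exact: b_eq.
have E (c : rel V) : symmetric c -> (forall x x' t, same x x' -> nbr c x t = nbr c x' t) ->
    \sum_(y in K) twist c k u y * twist c k y u = \sum_(y in K) `|twist c k u y| ^+ 2.
  move=> cs ce; apply: eq_bigr => y _; rewrite (twist_sym cs ce k y u) -expr2.
  by rewrite real_normK // num_real.
rewrite !E //; try exact: a_eq; try exact: b_eq.
move/eqP; rewrite -subr_eq0 -sumrB -oppr_eq0 -sumrN psumr_eq0; last first.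
  move=> y yK; rewrite oppr_ge0 subr_le0 lerXn2r ?nnegrE ?normr_ge0 //.
  by rewrite (le_trans (twist_bound k uK yK)) // ler_norm.
move/allP/(_ t (mem_index_enum t)); rewrite tK oppr_eq0 subr_eq0 eqrXn2 ?normr_ge0 //.
move/eqP=> ->; apply: ger0_norm; apply: le_trans (twist_bound k uK tK); exact: normr_ge0.
Qed.

(** Connectivity of [K] makes each entry of row [u] positive for some power. The positive diagonal
    keeps it positive for all later powers, so the largest of the exponents serves all entries. *)
Lemma twist_pos u : u \in K -> exists k, forall t, t \in K -> 0 < twist a k u t.
Proof.
move=> uK.
have pos t : t \in K -> exists k, 0 < twist a k u t.
  move=> tK; case/connectP: (K_conn uK tK) => p; elim/last_ind: p t tK => [|p z IH] t tK.
    by move=> _ ->; exists 0%N; rewrite twist0 // eqxx.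
  rewrite rcons_path last_rcons => /andP[pp /and3P[lK zK az]] e.
  have [k pk] := IH _ lK pp erefl; exists (k + 1)%N.
  rewrite twistD //; last exact: a_eq.
  rewrite (bigD1 (last u p)) //=; apply: ltr_pwDl.
    rewrite mulr_gt0 // twist1 //; last exact: a_eq.
    rewrite /coef e az; have [le|ne] := eqVneq (last u p) z.
      by rewrite le a_irr in az.
    by rewrite (a_tau_false lK zK ne).
  apply: sumr_ge0 => y /andP[yK _]; rewrite -!twist_abs ?mulr_ge0 ?normr_ge0 //.
have mono t k j : t \in K -> 0 < twist a k u t -> 0 < twist a (k + j) u t.
  move=> tK; elim: j => [|j IH] pk; first by rewrite addn0.
  rewrite addnS -addn1 twistD //; last exact: a_eq.
  rewrite (bigD1 t) //=; apply: ltr_pwDl.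
    rewrite mulr_gt0 ?IH // twist1 //; last exact: a_eq.
    by have [] := coef_diag tK.
  apply: sumr_ge0 => y /andP[yK _]; rewrite -!twist_abs ?mulr_ge0 ?normr_ge0 //.
pose kk t := if pselect (exists k, 0 < twist a k u t) is left h then sval (cid h) else 0%N.
exists (\max_t kk t)%N => t tK.
have pk : 0 < twist a (kk t) u t.
  by rewrite /kk; case: pselect => [h|/(_ (pos t tK))//]; case: cid.
have le : (kk t <= \max_t kk t)%N by exact: leq_bigmax.
by rewrite -(subnKC le); apply: mono.
Qed.

(** [sg] is the sign of a row of a power without zero entries. By [twist_abs] for the next power the
    triangle inequality is an equality there, so all summands share one sign [e]; the summand with
    the positive diagonal entry identifies [e] as the sign of [t], and the one at [y] then gives the
    sign of the coefficient. *)
Lemma untwist : exists sg : V -> bool,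
  forall u t, u \in K -> t \in K ->
    coef b u t = (if sg u == sg t then coef a u t else - coef a u t).
Proof.
case: (boolP [exists u, u \in K]) => [/existsP[u0 u0K]|/existsPn K0]; last first.
  by exists xpredT => u t uK; have := K0 u; rewrite uK.
have [k pos] := twist_pos u0K; pose sg t := 0 <= twist b k u0 t.
exists sg => y t yK tK.
have E z : z \in K -> twist b k u0 z = if sg z then twist a k u0 z else - twist a k u0 z.
  move=> zK; rewrite -(twist_abs k u0K zK) /sg; case: lerP => h.
    by rewrite ger0_norm.
  by rewrite ltr0_norm // opprK.
have Eb : twist b (k + 1) u0 t = \sum_(z in K) twist b k u0 z * coef b z t.
  rewrite twistD //; last exact: b_eq.
  by apply: eq_bigr => z zK; rewrite twist1 //; exact: b_eq.
have Ea : twist a (k + 1) u0 t = \sum_(z in K) twist a k u0 z * coef a z t.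
  rewrite twistD //; last exact: a_eq.
  by apply: eq_bigr => z zK; rewrite twist1 //; exact: a_eq.
have bnd z : z \in K -> `|twist b k u0 z * coef b z t| <= twist a k u0 z * coef a z t.
  move=> zK; rewrite normrM twist_abs //.
  by have [ge0 [->|->]] := coef_abs zK tK; rewrite ?normrN ger0_norm.
have [e eE eP] : exists2 e : int, (e == 1) || (e == -1) & forall z, z \in K ->
    twist b k u0 z * coef b z t = e * (twist a k u0 z * coef a z t).
  have := twist_abs (k + 1) u0K tK; rewrite Eb Ea.
  set S := \sum_(z in K) _ => nS.
  pose e : int := if 0 <= S then 1 else -1.
  have e2 : e * e = 1 by rewrite /e; case: ifP.
  exists e; first by rewrite /e; case: ifP.
  have : \sum_(z in K) (twist a k u0 z * coef a z t - e * (twist b k u0 z * coef b z t)) = 0.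
    rewrite sumrB -nS -mulr_sumr -/S /e; case: lerP => h.
      by rewrite ger0_norm // mul1r subrr.
    by rewrite ltr0_norm // mulN1r subrr.
  have le1 z : z \in K -> e * (twist b k u0 z * coef b z t) <= twist a k u0 z * coef a z t.
    move=> zK; apply: le_trans (bnd z zK).
    by rewrite /e; case: ifP; rewrite ?mul1r ?mulN1r ?ler_norm // -normrN ler_norm.
  move/eqP; rewrite psumr_eq0 => [/allP h z zK|z zK]; last by rewrite subr_ge0 le1.
  have := h z (mem_index_enum z); rewrite zK /= subr_eq0 => /eqP->.
  by rewrite mulrA e2 mul1r.
have [dpos dE] := coef_diag tK.
have et := eP t tK; rewrite dE mulrA in et.
have {}et : twist b k u0 t = e * twist a k u0 t.
  by apply: (mulIf (lt0r_neq0 dpos)).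
have ey := eP y yK; rewrite !E // in et ey.
have pt := pos t tK; have py := pos y yK.
case/orP: eE => /eqP ee; rewrite ee in et ey; case: (sg t) et => et;
  case: (sg y) ey => ey /=; nia.
Qed.

Theorem untwist_iso : exists psi : V -> V, injective psi /\ {mono psi : u t / a u t >-> b u t}.
Proof.
have [sg sgE] := untwist.
(* Pairs with negative sign are swapped. Outside of [K] the sign of the mirror image decides, so
   that [psi] commutes with [tau]. *)
pose psi u := if u \in K then if sg u then u else tau u
  else if tau u \in K then if sg (tau u) then u else tau u else u.
have psi_cell u : psi u = u \/ psi u = tau u.
  by rewrite /psi; case: (u \in K); case: (sg u); case: (tau u \in K);
    case: (sg (tau u)); auto.
have psi_fix u : tau u = u -> psi u = u by move=> fu; case: (psi_cell u); rewrite ?fu.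
have psi_tau u : psi (tau u) = tau (psi u).
  have [fu|nu] := eqVneq (tau u) u; first by rewrite fu psi_fix.
  rewrite /psi tauK; case: (boolP (u \in K)) => uK.
    by rewrite (negbTE (K_tau uK)); case: ifP; rewrite ?tauK.
  have tK : tau u \in K by have := tau_K nu; rewrite (negbTE uK).
  by rewrite tK; case: ifP; rewrite ?tauK.
have bt u t : b (tau u) (tau t) = b u t.
  have [+ _] := walks_tau b_sym b_eq 1 u t; rewrite /= !sum_eq_op (inj_eq (inv_inj tauK)).
  by move/addnI; case: (b _ _); case: (b _ _).
have at_ u t : a (tau u) (tau t) = a u t.
  have [+ _] := walks_tau a_sym a_eq 1 u t; rewrite /= !sum_eq_op (inj_eq (inv_inj tauK)).
  by move/addnI; case: (a _ _); case: (a _ _).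
exists psi; split=> [u t e|].
  have psi2 x : psi (psi x) = x.
    case: (psi_cell x) => px; first by rewrite !px.
    by rewrite {1}px psi_tau px tauK.
  by rewrite -(psi2 u) e psi2.
have toK u : tau u != u -> exists2 x, x \in K & u = x \/ u = tau x.
  by move/tau_K/orP=> [uK|uK]; [exists u; [|left] | exists (tau u); [|right; rewrite tauK]].
have fixed s0 u : tau s0 = s0 -> b (psi u) s0 = a u s0.
  move=> fs; have := ab_eq s0 (same_refl u); have := ab_eq s0 (same_tauE u).
  rewrite !nbrE fs eqxx => h1 h2.
  by case: (psi_cell u) => ->; [move: h2 | move: h1]; case: (a _ _); case: (b _ _).
have KK u t : u \in K -> t \in K -> b (psi u) (psi t) = a u t /\ b (psi u) (tau (psi t)) = a u (tau t).
  move=> uK tK; have [->|ut] := eqVneq u t.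
    have : b t (tau t) = a t (tau t).
      have := ab_eq t (same_refl t); rewrite !nbrE (K_moved tK) a_irr b_irr.
      by case: (a _ _); case: (b _ _).
    by case: (psi_cell t) => ->; rewrite ?tauK !b_irr !a_irr // [b (tau t) t]b_sym.
  have := sgE u t uK tK; have := ab_eq t (same_refl u).
  rewrite !nbrE (K_moved tK) /coef (negbTE ut) (a_tau_false uK tK ut) mul0r add0r subr0.
  have b2 : b (tau u) t = b u (tau t) by rewrite -bt tauK.
  rewrite /psi uK tK; case: (sg u); case: (sg t) => /=; rewrite ?tauK ?bt ?b2;
    by case: (a u t); case: (b u t); case: (b u (tau t)).
move=> u t; have [ft|nt] := eqVneq (tau t) t; first by rewrite (psi_fix t ft) fixed.
have [fu|nu] := eqVneq (tau u) u.
  by rewrite b_sym (psi_fix u fu) fixed // a_sym.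
have [x xK ux] := toK u nu; have [y yK ty] := toK t nt; have [k1 k2] := KK x y xK yK.
have b2 p q : b (tau p) q = b p (tau q) by rewrite -bt tauK.
have a2 p q : a (tau p) q = a p (tau q) by rewrite -at_ tauK.
by case: ux => ->; case: ty => ->; rewrite ?psi_tau ?bt ?at_ ?b2 ?a2.
Qed.

End Twist.

(** * Harmonic heights *)

Section Harmonic.
Variables (G : sgraph) (v w : G) (same : rel G).
Hypothesis conn3 : k_connected 3 G.
Hypothesis vw : v != w.
Hypothesis same_refl : reflexive same.
Hypothesis same_sym : symmetric same.
Hypothesis same_trans : transitive same.
Hypothesis eqt : equitable same.
Hypothesis same_v : forall t, same v t -> t = v.
Hypothesis same_w : forall t, same w t -> t = w.

Local Open Scope ring_scope.

Definition laplace (g : G -> rat) (u : G) : rat := \sum_(t | adj u t) (g t - g u).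

Lemma harmonic_le (g : G -> rat) (c : rat) :
  (forall u, u != v -> u != w -> laplace g u = 0) -> g v <= c -> g w <= c ->
  forall u, g u <= c.
Proof.
move=> hg gv gw; have [m _ mmax] := @Order.TotalTheory.arg_maxP _ _ G v predT g isT.
have {}mmax u : g u <= g m by exact: mmax.
suff mc : g m <= c by move=> u; exact: le_trans (mmax u) mc.
rewrite leNgt; apply/negP => lt.
have : g v == g m.
  apply: (@adj_closed _ conn3 (fun t => g t == g m) m) => // a b /eqP ga ab.
  have av : a != v by apply: contraTneq lt => e; rewrite -leNgt -ga e.
  have aw : a != w by apply: contraTneq lt => e; rewrite -leNgt -ga e.
  have ha := hg a av aw.
  have : \sum_(t | adj a t) (g a - g t) = 0.
    apply/eqP; rewrite -oppr_eq0 -sumrN -[X in _ == X]ha; apply/eqP.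
    by apply: eq_bigr => t _; rewrite opprB.
  move/eqP; rewrite psumr_eq0; last by move=> t _; rewrite subr_ge0 ga.
  by move/allP/(_ b (mem_index_enum b)); rewrite ab subr_eq0 ga eq_sym.
by move/eqP=> e; rewrite -e ltNge gv in lt.
Qed.

Lemma harmonic_eq0 (g : G -> rat) :
  (forall u, u != v -> u != w -> laplace g u = 0) -> g v = 0 -> g w = 0 ->
  forall u, g u = 0.
Proof.
move=> hg gv gw u; apply/eqP; rewrite eq_le.
rewrite (harmonic_le hg) ?gv ?gw //=; rewrite -oppr_le0.
apply: (@harmonic_le (fun u => - g u)); rewrite ?gv ?gw ?oppr0 // => t tv tw.
rewrite -[RHS]oppr0 -(hg t tv tw) /laplace -sumrN; apply: eq_bigr => x _.
by rewrite opprD.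
Qed.

(* Cells are represented by a canonical member. *)
Definition rep (u : G) : G := odflt u [pick t | same u t].

Lemma rep_same u : same u (rep u).
Proof. by rewrite /rep; case: pickP => //=. Qed.

Lemma rep_eq u t : same u t -> rep u = rep t.
Proof.
move=> ut; rewrite /rep.
have e : [pred x | same u x] =1 [pred x | same t x].
  by move=> x /=; apply/idP/idP; apply: same_trans => //; rewrite same_sym.
rewrite (eq_pick e); case: pickP => // /(_ t) /=; by rewrite same_refl.
Qed.

(** Grouping the neighbours by cells expresses the Laplacian of a function constant on cells through
    neighbour counts, which equitability makes equal. *)
Lemma laplace_same (g : G -> rat) u u' : (forall x, g (rep x) = g x) -> same u u' ->
  laplace g u = laplace g u'.
Proof.
move=> gr uu; have gs x y : same x y -> g x = g y.
  by move=> xy; rewrite -gr (rep_eq xy) gr.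
have E x : laplace g x = \sum_c (if rep c == c then (nb same x c)%:R * (g c - g x) else 0).
  rewrite /laplace (partition_big rep predT) //=; apply: eq_bigr => c _.
  case: eqP => [rc|rc]; last first.
    rewrite big1 // => t /andP[_ /eqP e]; case: rc.
    by rewrite -{1}e -(rep_eq (rep_same t)).
  rewrite (eq_bigr (fun _ => g c - g x)); last first.
    by move=> t /andP[_ /eqP <-]; rewrite gr.
  rewrite sumr_const mulr_natl; congr (_ *+ _); rewrite /nb; apply: eq_card => t.
  rewrite !inE; congr (_ && _); apply/eqP/idP => [<-|ct].
    by rewrite same_sym rep_same.
  by rewrite -(rep_eq ct).
rewrite !E; apply: eq_bigr => c _; rewrite (eqt c uu) (gs _ _ uu) //.
Qed.

(** This is the discrete Dirichlet problem over the rationals. The maximum principle makes the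
    kernel of a square system trivial, so a solution exists; constancy on cells is built into the
    equations. *)
Theorem height_exists : exists f : G -> rat,
  height f v w /\ forall u t, same u t -> f u = f t.
Proof.
pose n := #|G|; pose ev (i : 'I_n) : G := enum_val i.
pose ix (u : G) : 'I_n := enum_rank u.
have evK u : ev (ix u) = u by exact: enum_rankK.
have ixK i : ix (ev i) = i by exact: enum_valK.
(* Row [c] of the system: the boundary values at [v] and [w], the harmonic
   equation at the other representatives, and [g c = g (rep c)] elsewhere. *)
pose op (g : G -> rat) (u : G) : rat :=
  if rep u != u then g u - g (rep u)
  else if (u == v) || (u == w) then g u else laplace g u.
have opD g h a u : op (fun x => a * g x + h x) u = a * op g u + op h u.
  rewrite /op; case: ifP => _; first by rewrite mulrBr opprD addrACA.
  case: ifP => // _; rewrite /laplace mulr_sumr -big_split /=; apply: eq_bigr => t _.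
  by rewrite mulrBr opprD addrACA.
have inj g : (forall u, op g u = 0) -> forall u, g u = 0.
  move=> og; have gr x : g (rep x) = g x.
    have := og x; rewrite /op; case: eqP => [->//|_] /=.
    by move/eqP; rewrite subr_eq0 => /eqP.
  have rr x : rep (rep x) = rep x by rewrite -(rep_eq (rep_same x)).
  have rv : rep v = v by exact/same_v/rep_same.
  have rw : rep w = w by exact/same_w/rep_same.
  apply: harmonic_eq0.
  - move=> u uv uw; rewrite (laplace_same gr (rep_same u)).
    have := og (rep u); rewrite /op rr eqxx /=; case: ifP => // /orP[]/eqP e.
      by case/eqP: uv; apply: same_v; rewrite -e same_sym rep_same.
    by case/eqP: uw; apply: same_w; rewrite -e same_sym rep_same.
  - by have := og v; rewrite /op rv !eqxx.
  - by have := og w; rewrite /op rw !eqxx orbT.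
pose vec (g : G -> rat) : 'rV[rat]_n := \row_i g (ev i).
pose fn (x : 'rV[rat]_n) (u : G) : rat := x 0 (ix u).
pose L (x : 'rV[rat]_n) : 'rV[rat]_n := vec (op (fn x)).
have opE g h u : g =1 h -> op g u = op h u.
  by move=> e; rewrite /op /laplace !e; do 2![case: ifP => // _]; apply: eq_bigr => t _; rewrite !e.
have Llin : linear L.
  move=> a x y; apply/rowP => i; rewrite !mxE -opD; apply: opE => u.
  by rewrite /fn !mxE.
pose Lm := GRing.isLinear.Build _ _ _ _ L Llin.
pose LL : {linear 'rV[rat]_n -> 'rV[rat]_n} := HB.pack L Lm.
pose M := lin1_mx LL.
have ME x : x *m M = L x by rewrite mul_rV_lin1.
have Mfree : row_free M.
  rewrite -kermx_eq0; apply/rowV0P => x /sub_kermxP; rewrite ME => Lx.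
  apply/rowP => i; rewrite mxE; have := inj (fn x) _ (ev i); rewrite /fn ixK; apply.
  by move=> u; have := congr1 (fun y : 'rV[rat]_n => y 0 (ix u)) Lx; rewrite !mxE evK.
have Munit : M \in unitmx by rewrite -row_free_unit.
pose f := fn (vec (fun u => (u == w)%:R) *m invmx M).
have of_ u : op f u = (u == w)%:R.
  have : L (vec (fun u => (u == w)%:R) *m invmx M) = vec (fun u => (u == w)%:R).
    by rewrite -ME -mulmxA mulVmx // mulmx1.
  by move/(congr1 (fun y : 'rV[rat]_n => y 0 (ix u))); rewrite !mxE evK.
have rv : rep v = v by exact/same_v/rep_same.
have rw : rep w = w by exact/same_w/rep_same.
have rr x : rep (rep x) = rep x by rewrite -(rep_eq (rep_same x)).
have fr x : f (rep x) = f x.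
  have := of_ x; rewrite /op; case: eqP => [->//|ne] /=.
  have -> : (x == w) = false by apply/eqP => e; rewrite e in ne.
  by move/eqP; rewrite subr_eq0 => /eqP.
have fv : f v = 0 by have := of_ v; rewrite /op rv !eqxx /= (negbTE vw).
have fw : f w = 1 by have := of_ w; rewrite /op rw !eqxx orbT.
exists f; split; last by move=> u t ut; rewrite -fr (rep_eq ut) fr.
split; first by rewrite fv fw ltr01.
move=> u uv uw.
have lu : laplace f u = 0.
  rewrite (laplace_same fr (rep_same u)).
  have nv : rep u != v.
    by apply: contraNneq uv => e; apply/eqP/same_v; rewrite -e same_sym rep_same.
  have nw : rep u != w.
    by apply: contraNneq uw => e; apply/eqP/same_w; rewrite -e same_sym rep_same.
  by have := of_ (rep u); rewrite /op rr eqxx /= (negbTE nv) (negbTE nw).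
have side (g : G -> rat) : \sum_(t | adj u t) g t = 0 ->
    [forall t, adj u t ==> (g t == 0)] \/ exists2 t, adj u t & 0 < g t.
  move=> g0; case: (boolP [exists t, adj u t && (0 < g t)]) => [/existsP[t /andP[]]|].
    by right; exists t.
  rewrite negb_exists => /forallP h; left; apply/forallP => t; apply/implyP => ut.
  have : \sum_(t | adj u t) - g t = 0 by rewrite sumrN g0 oppr0.
  move/eqP; rewrite psumr_eq0; last first.
    by move=> x ux; have := h x; rewrite ux /= -leNgt oppr_ge0.
  by move/allP/(_ t (mem_index_enum t)); rewrite ut oppr_eq0.
have fl (g : G -> rat) : (forall t, (g t == 0) = (f t == f u)) ->
    [forall t, adj u t ==> (g t == 0)] -> flat f u.
  by move=> e /forallP h; apply/forallP => t; rewrite -e.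
case: (side (fun t => f t - f u) lu) => [h|[t ut lt]].
  by left; apply: fl h => t; rewrite subr_eq0.
case: (side (fun t => f u - f t)) => [|h|[t' ut' lt']].
- have -> : \sum_(t | adj u t) (f u - f t) = \sum_(t | adj u t) - (f t - f u).
    by apply: eq_bigr => x _; rewrite opprB.
  by rewrite sumrN -/(laplace f u) lu oppr0.
- by left; apply: fl h => x; rewrite subr_eq0 eq_sym.
by right; split; [exists t | exists t'] => //; rewrite -subr_gt0.
Qed.

End Harmonic.

(** * Crossing parities of polygonal curves *)

Section Segments.
Variable R : realType.
Local Open Scope ring_scope.
Notation pt := (R * R)%type.

(* [a] lies below the line through [x] of infinitesimal positive slope. *)
Definition prec (a x : pt) : bool := (a.2 < x.2) || ((a.2 == x.2) && (x.1 < a.1)).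

Definition det (a b x : pt) : R :=
  (b.1 - a.1) * (x.2 - a.2) - (b.2 - a.2) * (x.1 - a.1).

(** Comparing by [prec] tilts the ray infinitesimally upwards, so horizontal segments and rays
    through endpoints need no convention of their own. A positive [det] means that [x] is to the
    left of the upward segment. *)
Definition rray (x a b : pt) : bool :=
  if prec a x && prec x b then 0 < det a b x
  else if prec b x && prec x a then 0 < det b a x else false.

Definition lray (x a b : pt) : bool :=
  if prec a x && prec x b then det a b x < 0
  else if prec b x && prec x a then det b a x < 0 else false.

Definition mix (t : R) (a b : pt) : pt :=
  ((1 - t) * a.1 + t * b.1, (1 - t) * a.2 + t * b.2).

Definition on_seg (a b z : pt) := exists2 t, 0 <= t <= 1 & z = mix t a b.

Definition disj_seg (a b x y : pt) := forall z, on_seg a b z -> on_seg x y z -> False.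

Lemma prec_irr a : prec a a = false.
Proof. by rewrite /prec !ltxx andbF. Qed.

Lemma prec_asym a b : a != b -> prec a b = ~~ prec b a.
Proof.
case: a b => [a1 a2] [b1 b2]; rewrite /prec /= xpair_eqE.
by case: (ltgtP a2 b2) => //= _; rewrite andbT; case: (ltgtP a1 b1).
Qed.

Lemma prec_trans b a c : prec a b -> prec b c -> prec a c.
Proof.
rewrite /prec => /orP[h1|/andP[/eqP e1 h1]] /orP[h2|/andP[/eqP e2 h2]]; apply/orP.
- by left; exact: lt_trans h1 h2.
- by left; rewrite -e2.
- by left; rewrite e1.
- by right; rewrite e1 e2 eqxx /=; exact: lt_trans h2 h1.
Qed.

Lemma conv_l (t p q c : R) : 0 <= t -> t < 1 -> c < p -> c <= q -> c < (1 - t) * p + t * q.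
Proof.
move=> t0 t1 cp cq; have h1 : 0 < (1 - t) * (p - c) by apply: mulr_gt0; lra.
have h2 : 0 <= t * (q - c) by apply: mulr_ge0; lra.
lra.
Qed.

Lemma conv_r (t p q c : R) : 0 < t -> t <= 1 -> c <= p -> c < q -> c < (1 - t) * p + t * q.
Proof.
move=> t0 t1 cp cq; have h1 : 0 <= (1 - t) * (p - c) by apply: mulr_ge0; lra.
have h2 : 0 < t * (q - c) by apply: mulr_gt0; lra.
lra.
Qed.

Lemma conv_lt (t p q c : R) : 0 <= t -> t <= 1 -> c < p -> c < q -> c < (1 - t) * p + t * q.
Proof.
move=> t0 t1 cp cq; have [->|tn] := eqVneq t 0; first by lra.
by apply: conv_r => //; [rewrite lt_neqAle eq_sym tn | exact: ltW].
Qed.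

Lemma prec_mix_l t a x y : 0 <= t <= 1 -> prec a x -> prec a y -> prec a (mix t x y).
Proof.
move=> /andP[t0 t1]; rewrite /prec /mix /=.
move=> /orP[h1|/andP[/eqP e1 h1]] /orP[h2|/andP[/eqP e2 h2]].
- by apply/orP; left; exact: conv_lt.
- have [->|tn] := eqVneq t 1; first by rewrite subrr !mul0r !mul1r !add0r e2 eqxx h2 orbT.
  by apply/orP; left; apply: conv_l => //; [rewrite lt_neqAle tn | rewrite e2].
- have [->|tn] := eqVneq t 0; first by rewrite subr0 !mul0r !mul1r !addr0 e1 eqxx h1 orbT.
  by apply/orP; left; apply: conv_r => //; [rewrite lt_neqAle eq_sym tn | rewrite e1].
- apply/orP; right; apply/andP; split; first by apply/eqP; rewrite -e1 -e2; lra.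
  by have := @conv_lt t (- x.1) (- y.1) (- a.1) t0 t1; rewrite !ltrN2 => /(_ h1 h2); lra.
Qed.

Lemma prec_mix_r t b x y : 0 <= t <= 1 -> prec x b -> prec y b -> prec (mix t x y) b.
Proof.
move=> /andP[t0 t1]; rewrite /prec /mix /=.
move=> /orP[h1|/andP[/eqP e1 h1]] /orP[h2|/andP[/eqP e2 h2]].
- apply/orP; left; have := @conv_lt t (- x.2) (- y.2) (- b.2) t0 t1.
  by rewrite !ltrN2 => /(_ h1 h2); lra.
- have [->|tn] := eqVneq t 1; first by rewrite subrr !mul0r !mul1r !add0r e2 eqxx h2 orbT.
  have t1' : t < 1 by rewrite lt_neqAle tn.
  apply/orP; left; have := @conv_l t (- x.2) (- y.2) (- b.2) t0 t1'.
  by rewrite !ltrN2 lerN2 e2 lexx => /(_ h1 isT); lra.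
- have [->|tn] := eqVneq t 0; first by rewrite subr0 !mul0r !mul1r !addr0 e1 eqxx h1 orbT.
  have t0' : 0 < t by rewrite lt_neqAle eq_sym tn.
  apply/orP; left; have := @conv_r t (- x.2) (- y.2) (- b.2) t0' t1.
  by rewrite !ltrN2 lerN2 e1 lexx => /(_ isT h2); lra.
- apply/orP; right; apply/andP; split; first by apply/eqP; rewrite e1 e2; lra.
  exact: conv_lt.
Qed.

Lemma between a b x : prec a x -> prec x b -> det a b x = 0 -> on_seg a b x.
Proof.
case: a b x => [a1 a2] [b1 b2] [x1 x2]; rewrite /prec /det /on_seg /mix /=.
move=> h1 h2 d; have [e|ne] := eqVneq a2 b2.
  have [ea eb] : a2 = x2 /\ x2 = b2.
    by split; move: h1 h2 => /orP[?|/andP[/eqP ? ?]] /orP[?|/andP[/eqP ? ?]]; lra.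
  subst x2 b2; rewrite !ltxx !eqxx /= in h1 h2.
  have ab : a1 - b1 != 0 by apply/eqP; lra.
  exists ((a1 - x1) / (a1 - b1)).
    by rewrite divr_ge0 ?ler_pdivrMr; lra.
  by congr pair; field.
have lt : a2 < b2.
  by move: h1 h2 => /orP[?|/andP[/eqP ? ?]] /orP[?|/andP[/eqP ? ?]]; first [lra | move/eqP: ne; lra].
have ab : b2 - a2 != 0 by apply/eqP; lra.
exists ((x2 - a2) / (b2 - a2)).
  have [l1 l2] : a2 <= x2 /\ x2 <= b2.
    by split; move: h1 h2 => /orP[?|/andP[/eqP ? ?]] /orP[?|/andP[/eqP ? ?]]; lra.
  by rewrite divr_ge0 ?ler_pdivrMr; lra.
congr pair; last by field.
have e : x1 * (b2 - a2) = a1 * (b2 - a2) + (b1 - a1) * (x2 - a2) by lra.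
by apply: (mulIf ab); rewrite e; field.
Qed.

Lemma det_mix a b t x y : det a b (mix t x y) = (1 - t) * det a b x + t * det a b y.
Proof. by rewrite /det /mix /=; ring. Qed.

(** Directions that increase for [prec] fill a half-open half-plane, on which turning left is
    transitive. The identity [id] expresses this through the three cross products. *)
Lemma half_plane (a b c d p q : pt) : prec a b -> prec c d -> prec p q ->
  0 < (b.1 - a.1) * (d.2 - c.2) - (b.2 - a.2) * (d.1 - c.1) ->
  0 < (d.1 - c.1) * (q.2 - p.2) - (d.2 - c.2) * (q.1 - p.1) ->
  0 < (b.1 - a.1) * (q.2 - p.2) - (b.2 - a.2) * (q.1 - p.1).
Proof.
have U x y : prec x y -> 0 < y.2 - x.2 \/ y.2 - x.2 = 0 /\ y.1 - x.1 < 0.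
  by rewrite /prec => /orP[h|/andP[/eqP e h]]; [left | right]; lra.
move=> /U + /U + /U.
move: (b.1 - a.1) (b.2 - a.2) (d.1 - c.1) (d.2 - c.2) (q.1 - p.1) (q.2 - p.2).
move=> x1 x2 y1 y2 z1 z2 hx hy hz h1 h2.
have z2g : 0 <= z2 by case: hz => [/ltW//|[-> _]].
have x2g : 0 <= x2 by case: hx => [/ltW//|[-> _]].
have y2p : 0 < y2.
  case: hy => // -[e h]; rewrite e mul0r subr0 in h2.
  by have := mulr_le0_ge0 (ltW h) z2g; lra.
have id : y2 * (x1 * z2 - x2 * z1) = x2 * (y1 * z2 - y2 * z1) + z2 * (x1 * y2 - x2 * y1).
  by ring.
rewrite -(pmulr_rgt0 _ y2p) id.
case: hx => [x2p|[x20 x1n]].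
  by have := mulr_gt0 x2p h2; have := mulr_ge0 z2g (ltW h1); lra.
case: hz => [z2p|[z20 z1n]].
  by have := mulr_gt0 z2p h1; have := mulr_ge0 x2g (ltW h2); lra.
rewrite x20 mul0r subr0 in h1; have := mulr_le0_ge0 (ltW x1n) (ltW y2p); lra.
Qed.

Lemma mul_lt0 (p q : R) : p < 0 -> 0 < q -> p * q < 0.
Proof. by move=> hp hq; rewrite nmulr_rlt0. Qed.

Lemma mul_lt0_neq (p q : R) : p * q < 0 -> p - q != 0.
Proof.
move=> h; apply/eqP => e; have pq : p = q by lra.
by have := sqr_ge0 q; rewrite expr2; rewrite pq in h; lra.
Qed.

Lemma mul_lt0_ratio (p q : R) : p * q < 0 -> 0 <= p / (p - q) <= 1.
Proof.
move=> pq; have nz := mul_lt0_neq pq; case: (ltgtP p 0) => hp.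
- have qp : 0 < q by rewrite nmulr_rlt0 in pq.
  have -> : p / (p - q) = (- p) / (q - p) by rewrite -(opprB p q) invrN mulrNN.
  by rewrite divr_ge0 ?ler_pdivrMr; lra.
- have qp : q < 0 by rewrite pmulr_rlt0 in pq.
  by rewrite divr_ge0 ?ler_pdivrMr; lra.
- by rewrite hp mul0r lexx ler01.
Qed.

Lemma cross_point a b x y : det a b x * det a b y < 0 -> det x y a * det x y b < 0 ->
  exists2 z, on_seg a b z & on_seg x y z.
Proof.
move=> h1 h2.
have n1 := mul_lt0_neq h1.
have E : det x y a - det x y b = - (det a b x - det a b y) by rewrite /det; ring.
exists (mix (det a b x / (det a b x - det a b y)) x y); last first.
  by eexists; first exact: mul_lt0_ratio h1.
exists (det x y a / (det x y a - det x y b)); first exact: mul_lt0_ratio.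
rewrite E; move: n1; rewrite /mix /det /= => n1.
by congr pair; field; rewrite ?oppr_eq0.
Qed.

Lemma rrayC x a b : rray x a b = rray x b a.
Proof.
rewrite /rray; case: (boolP (prec a x && prec x b)) => // /andP[h1 h2].
case: (boolP (prec b x)) => //= h3.
by have := prec_trans h2 h3; rewrite prec_irr.
Qed.

Lemma lrayC x a b : lray x a b = lray x b a.
Proof.
rewrite /lray; case: (boolP (prec a x && prec x b)) => // /andP[h1 h2].
case: (boolP (prec b x)) => //= h3.
by have := prec_trans h2 h3; rewrite prec_irr.
Qed.

Lemma on_seg_l a b : on_seg a b a.
Proof.
by exists 0; rewrite ?lexx ?ler01 // /mix subr0 !mul0r !mul1r !addr0 -surjective_pairing.
Qed.

Lemma on_segC a b z : on_seg a b z -> on_seg b a z.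
Proof.
move=> [t /andP[t0 t1] ->]; exists (1 - t); first by apply/andP; split; lra.
by rewrite /mix; congr pair; ring.
Qed.

Lemma on_seg_r a b : on_seg a b b. Proof. exact/on_segC/on_seg_l. Qed.

(** The tilted line through [x] is crossed exactly when [prec] distinguishes [a] and [b], and then
    on exactly one side of [x]. *)
Lemma lray_rray x a b : ~ on_seg a b x ->
  lray x a b = rray x a b (+) prec a x (+) prec b x.
Proof.
move=> off.
have ne y : on_seg a b y -> y != x by move=> h; apply/eqP => e; rewrite e in h.
have ax := ne _ (on_seg_l a b); have bx := ne _ (on_seg_r a b).
rewrite /lray /rray (prec_asym ax) (prec_asym bx).
case: (boolP (prec x a)) => h1; case: (boolP (prec x b)) => h2 //=.
  have : det b a x <> 0 by move=> d; apply/off/on_segC/between; rewrite // prec_asym ?h2.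
  by case: (ltgtP (det b a x) 0).
have : det a b x <> 0 by move=> d; apply/off/between; rewrite // prec_asym ?h1.
by case: (ltgtP (det a b x) 0).
Qed.

Lemma nested a b x y : disj_seg a b x y -> prec a x -> prec x b -> prec a y -> prec y b ->
  (0 < det a b x) = (0 < det a b y).
Proof.
move=> dis ax xb ay yb.
have d1 : det a b x != 0.
  by apply/eqP => d; apply: dis (between ax xb d) (on_seg_l x y).
have d2 : det a b y != 0.
  by apply/eqP => d; apply: dis (between ay yb d) (on_seg_r x y).
have opp : det a b x * det a b y < 0 -> False.
  move=> opp; have n1 := mul_lt0_neq opp; have t01 := mul_lt0_ratio opp.
  apply: dis; last by eexists; first exact: t01.
  apply: between; [exact: prec_mix_l | exact: prec_mix_r | rewrite det_mix; by field].
case: (ltgtP (det a b x) 0) d1 => // s1 _; case: (ltgtP (det a b y) 0) d2 => // s2 _; exfalso.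
  by apply/opp/mul_lt0.
by apply: opp; rewrite mulrC; exact: mul_lt0.
Qed.

Lemma nested_neg a b x y : disj_seg a b x y -> prec a x -> prec x b -> prec a y -> prec y b ->
  (det a b x < 0) = (det a b y < 0).
Proof.
move=> dis ax xb ay yb; have := nested dis ax xb ay yb.
have d1 : det a b x != 0.
  by apply/eqP => d; apply: dis (between ax xb d) (on_seg_l x y).
have d2 : det a b y != 0.
  by apply/eqP => d; apply: dis (between ay yb d) (on_seg_r x y).
by case: (ltgtP (det a b x) 0) d1 => // s1 _; case: (ltgtP (det a b y) 0) d2.
Qed.

(** The ranges of heights interleave. With the wrong signs [half_plane] would place the ends of each
    segment on different sides of the other, and the segments would meet by [cross_point]. *)
Lemma overlapping a b x y : disj_seg a b x y -> prec a x -> prec x b -> prec b y ->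
  (0 < det a b x) = (det x y b < 0).
Proof.
move=> dis ax xb by_; have ab := prec_trans ax xb; have xy := prec_trans xb by_.
have d1 : det a b x != 0.
  by apply/eqP => d; apply: dis (between ax xb d) (on_seg_l x y).
have d2 : det x y b != 0.
  by apply/eqP => d; apply: dis (on_seg_r a b) (between xb by_ d).
case: (ltgtP (det a b x) 0) d1 => // s1 _; case: (ltgtP (det x y b) 0) d2 => // s2 _; exfalso.
  have h1 : 0 < det a b y.
    have := half_plane ab xb by_; rewrite /det in s1 s2 * => h.
    suff : 0 < (b.1 - a.1) * (y.2 - b.2) - (b.2 - a.2) * (y.1 - b.1) by lra.
    by apply: h; lra.
  have h2 : 0 < det x y a.
    have := half_plane ax xb xy; rewrite /det in s1 s2 * => h.
    suff : 0 < (x.1 - a.1) * (y.2 - x.2) - (x.2 - a.2) * (y.1 - x.1) by lra.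
    by apply: h; lra.
  have [||z z1 z2] := @cross_point a b x y; last exact: dis z1 z2.
    exact: mul_lt0.
  by rewrite mulrC; exact: mul_lt0.
have h1 : det a b y < 0.
  have := half_plane by_ xb ab; rewrite /det in s1 s2 * => h.
  suff : 0 < (y.1 - b.1) * (b.2 - a.2) - (y.2 - b.2) * (b.1 - a.1) by lra.
  by apply: h; lra.
have h2 : det x y a < 0.
  have := half_plane xy xb ax; rewrite /det in s1 s2 * => h.
  suff : 0 < (y.1 - x.1) * (x.2 - a.2) - (y.2 - x.2) * (x.1 - a.1) by lra.
  by apply: h; lra.
have [||z z1 z2] := @cross_point a b x y; last exact: dis z1 z2.
  by rewrite mulrC; exact: mul_lt0.
exact: mul_lt0.
Qed.

Lemma disj_segC a b x y : disj_seg a b x y -> disj_seg x y a b.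
Proof. by move=> dis z h1 h2; exact: dis h2 h1. Qed.

(** Each of the four terms records that, at the height of one endpoint, [xy] lies to the left of
    [ab]. The heights common to both segments form an interval with an endpoint of a segment at
    either end, and disjoint segments do not change sides in between; so the records come in
    pairs. *)
Lemma cross_aux a b x y : disj_seg a b x y -> prec a b -> prec x y ->
  rray x a b (+) rray y a b (+) lray a x y (+) lray b x y = false.
Proof.
move=> dis ab xy.
have ne p q : on_seg a b p -> on_seg x y q -> p != q.
  by move=> h1 h2; apply/eqP => e; rewrite e in h1; exact: dis h1 h2.
have [A B X Y] := And4 (on_seg_l a b) (on_seg_r a b) (on_seg_l x y) (on_seg_r x y).
have flip p q : on_seg a b p -> on_seg x y q -> prec q p = ~~ prec p q.
  by move=> h1 h2; rewrite (prec_asym (ne _ _ h1 h2)) negbK.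
have ba : prec b a = false by apply/negP => h; have := prec_trans ab h; rewrite prec_irr.
have yx : prec y x = false by apply/negP => h; have := prec_trans xy h; rewrite prec_irr.
have [fxa fxb] := (flip a x A X, flip b x B X).
have [fya fyb] := (flip a y A Y, flip b y B Y).
case ax : (prec a x) fxa; case bx : (prec b x) fxb; case ay : (prec a y) fya;
  case by_ : (prec b y) fyb => /= fyb fya fxb fxa;
  rewrite /rray /lray ?ax ?bx ?ay ?by_ ?fxa ?fxb ?fya ?fyb ?ba ?yx /= ?addbF ?addFb //.
all: try by have := prec_trans ax xy; rewrite ay.
all: try by have := prec_trans bx xy; rewrite by_.
all: try by have := prec_trans ab bx; rewrite ax.
all: try by have := prec_trans ab by_; rewrite ay.
- by rewrite (overlapping dis ax fxb by_) addbb.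
- by rewrite (nested dis ax fxb ay fyb) addbb.
- by rewrite (nested_neg (disj_segC dis) fxa ay fxb by_) addbb.
rewrite (_ : (0 < det a b y) = (det x y a < 0)) ?addbb //.
have dis' := disj_segC dis.
have d1 : det x y a != 0.
  by apply/eqP => d; apply: dis (on_seg_l a b) (between fxa ay d).
have := overlapping dis' fxa ay fyb; have := @nested_neg; move=> _.
have d2 : det a b y != 0.
  by apply/eqP => d; apply: dis (between ay fyb d) (on_seg_r x y).
by case: (ltgtP (det x y a) 0) d1 => // s1 _; case: (ltgtP (det a b y) 0) d2.
Qed.

Lemma cross_seg a b x y : disj_seg a b x y ->
  rray x a b (+) rray y a b (+) lray a x y (+) lray b x y = false.
Proof.
move=> dis; have degR p q : rray p q q = false.
  rewrite /rray; case: (boolP (prec q p && prec p q)) => // /andP[h1 h2].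
  by have := prec_trans h1 h2; rewrite prec_irr.
have degL p q : lray p q q = false.
  rewrite /lray; case: (boolP (prec q p && prec p q)) => // /andP[h1 h2].
  by have := prec_trans h1 h2; rewrite prec_irr.
have [eab|nab] := eqVneq a b; first by rewrite eab !degR !addFb addbb.
have [exy|nxy] := eqVneq x y; first by rewrite exy !degL !addbF addbb.
have sw1 : disj_seg b a x y by move=> z /on_segC; exact: dis.
have sw2 : disj_seg a b y x by move=> z h /on_segC; exact: dis.
have sw3 : disj_seg b a y x by move=> z h /on_segC; exact: sw1.
case ab : (prec a b); case xy : (prec x y).
- exact: cross_aux.
- have yx : prec y x by rewrite prec_asym 1?eq_sym // xy.
  by have := cross_aux sw2 ab yx; rewrite (lrayC a) (lrayC b) [rray y _ _ (+) _]addbC.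
- have ba : prec b a by rewrite prec_asym 1?eq_sym // ab.
  have := cross_aux sw1 ba xy; rewrite (rrayC x) (rrayC y) => <-.
  by rewrite -!addbA; congr (_ (+) (_ (+) _)); exact: addbC.
have yx : prec y x by rewrite prec_asym 1?eq_sym // xy.
have ba : prec b a by rewrite prec_asym 1?eq_sym // ab.
have := cross_aux sw3 ba yx; rewrite (rrayC x) (rrayC y) (lrayC a) (lrayC b) => <-.
by rewrite [rray y _ _ (+) _]addbC -!addbA; congr (_ (+) (_ (+) _)); exact: addbC.
Qed.

(* Seen from beyond a line, a segment behind it is hit by the ray exactly when
   the ray points behind the line. *)
Lemma rray_behind (l1 l2 : R) x a b :
  l1 * a.1 + l2 * a.2 < l1 * x.1 + l2 * x.2 -> l1 * b.1 + l2 * b.2 < l1 * x.1 + l2 * x.2 ->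
  rray x a b = (l1 < 0) && (prec a x (+) prec b x).
Proof.
move=> la lb.
have ne y : l1 * y.1 + l2 * y.2 < l1 * x.1 + l2 * x.2 -> y != x.
  by move=> h; apply: contraTneq h => ->; rewrite ltxx.
have key p q : l1 * p.1 + l2 * p.2 < l1 * x.1 + l2 * x.2 ->
    l1 * q.1 + l2 * q.2 < l1 * x.1 + l2 * x.2 -> prec p x -> prec x q ->
    (0 < det p q x) = (l1 < 0).
  move=> lp lq px xq.
  have U y z : prec y z -> 0 < z.2 - y.2 \/ z.2 - y.2 = 0 /\ z.1 - y.1 < 0.
    by rewrite /prec => /orP[h|/andP[/eqP e h]]; [left | right]; lra.
  have id : l1 * det p q x = (q.2 - x.2) * (l1 * (p.1 - x.1) + l2 * (p.2 - x.2)) +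
      (x.2 - p.2) * (l1 * (q.1 - x.1) + l2 * (q.2 - x.2)).
    by rewrite /det; ring.
  have hp : l1 * (p.1 - x.1) + l2 * (p.2 - x.2) < 0 by lra.
  have hq : l1 * (q.1 - x.1) + l2 * (q.2 - x.2) < 0 by lra.
  have : l1 * det p q x < 0.
    rewrite id; case: (U _ _ px) => [p2|[p2 p1]]; case: (U _ _ xq) => [q2|[q2 q1]].
    - by have := mul_lt0 hp q2; have := mul_lt0 hq p2; lra.
    - by have := mul_lt0 hq p2; rewrite q2 mul0r; lra.
    - by have := mul_lt0 hp q2; rewrite p2 mul0r; lra.
    - exfalso; have e1 : p.2 - x.2 = 0 by lra.
      rewrite e1 mulr0 addr0 in hp; rewrite q2 mulr0 addr0 in hq.
      have l1n : l1 < 0 by rewrite pmulr_llt0 // in hp; lra.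
      by rewrite nmulr_llt0 in hq => //; lra.
  case: (ltgtP l1 0) => [l1n|l1p|->]; last by rewrite mul0r ltxx.
    by rewrite nmulr_rlt0.
  by rewrite pmulr_rlt0 // => h; apply/negbTE; rewrite -leNgt ltW.
have [ax bx] := (ne _ la, ne _ lb).
rewrite /rray; case pa : (prec a x); case pb : (prec b x) => /=.
- by rewrite (prec_asym bx) in pb; rewrite (negbTE pb) (prec_asym ax) in pa *;
    rewrite (negbTE pa) andbF.
- have xb : prec x b by rewrite prec_asym 1?eq_sym // pb.
  by rewrite xb (key _ _ la lb pa xb) andbT.
- have xa : prec x a by rewrite prec_asym 1?eq_sym // pa.
  by rewrite xa (key _ _ lb la pb xa) andbT.
- by rewrite andbF.
Qed.

End Segments.

(** * Polygons inscribed in curves *)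

Section Chains.
Variable R : realType.
Local Open Scope ring_scope.
Notation pt := (R * R)%type.

Fixpoint crr (x a : pt) (l : seq pt) : bool :=
  if l is b :: m then rray x a b (+) crr x b m else false.

Fixpoint cll (x a : pt) (l : seq pt) : bool :=
  if l is b :: m then lray x a b (+) cll x b m else false.

Fixpoint segs (a : pt) (l : seq pt) : seq (pt * pt) :=
  if l is b :: m then (a, b) :: segs b m else [::].

Definition disj_chain a l x m :=
  forall s t, s \in segs a l -> t \in segs x m -> disj_seg s.1 s.2 t.1 t.2.

Lemma crr_cat x a l m : crr x a (l ++ m) = crr x a l (+) crr x (last a l) m.
Proof. by elim: l a => //= b l IH a; rewrite IH addbA. Qed.

Lemma segs_cat a l m : segs a (l ++ m) = segs a l ++ segs (last a l) m.
Proof. by elim: l a => //= b l IH a; rewrite IH. Qed.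

Lemma cross_seg_chain a b x m :
  (forall t, t \in segs x m -> disj_seg a b t.1 t.2) ->
  rray x a b (+) rray (last x m) a b (+) cll a x m (+) cll b x m = false.
Proof.
elim: m x => [|y m IH] x /= dis; first by rewrite !addbF addbb.
have d1 : disj_seg a b x y by apply: (dis (x, y)); rewrite mem_head.
have d2 t : t \in segs y m -> disj_seg a b t.1 t.2.
  by move=> h; apply: dis; rewrite inE h orbT.
apply: (xor_elim2 (cross_seg d1) (IH y d2)); xor_solve.
Qed.

Lemma cross_chains a l x m : disj_chain a l x m ->
  crr x a l (+) crr (last x m) a l (+) cll a x m (+) cll (last a l) x m = false.
Proof.
elim: l a => [|b l IH] a /= dis; first by case: (cll _ _ _).
have d1 t : t \in segs x m -> disj_seg a b t.1 t.2.
  by move=> h; apply: (dis (a, b)); rewrite ?mem_head.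
have d2 : disj_chain b l x m by move=> s t h; apply: dis; rewrite inE h orbT.
apply: (xor_elim2 (cross_seg_chain d1) (IH b d2)); xor_solve.
Qed.

Lemma cll_crr x a l : (forall s, s \in segs a l -> ~ on_seg s.1 s.2 x) ->
  cll x a l = crr x a l (+) prec a x (+) prec (last a l) x.
Proof.
elim: l a => [|b l IH] a /= off; first by case: (prec _ _).
have o1 : ~ on_seg a b x by apply: (off (a, b)); rewrite mem_head.
have o2 s : s \in segs b l -> ~ on_seg s.1 s.2 x.
  by move=> h; apply: off; rewrite inE h orbT.
apply: (xor_elim2 (lray_rray o1) (IH b o2)); xor_solve.
Qed.

Lemma crr_behind (l1 l2 : R) x a l :
  (forall y, y \in a :: l -> l1 * y.1 + l2 * y.2 < l1 * x.1 + l2 * x.2) ->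
  crr x a l = (l1 < 0) && (prec a x (+) prec (last a l) x).
Proof.
elim: l a => [|b l IH] a /= h; first by rewrite addbb andbF.
have ha := h a (mem_head _ _); have hb : l1 * b.1 + l2 * b.2 < l1 * x.1 + l2 * x.2.
  by apply: h; rewrite !inE eqxx orbT.
rewrite (rray_behind ha hb) IH; first by case: (l1 < 0) => //=; xor_solve.
by move=> y yl; apply: h; rewrite inE yl orbT.
Qed.

(** The starting point is left out, since [crr] and [segs] receive it separately; samples of
    consecutive curves can then be concatenated. *)
Definition sample (N : nat) (g : R -> pt) := [seq g (i.+1%:R / N%:R) | i <- iota 0 N].

Definition chain N (cs : seq (R -> pt)) := flatten [seq sample N g | g <- cs].

Fixpoint linked (a : pt) (cs : seq (R -> pt)) (b : pt) : Prop :=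
  if cs is g :: cs' then g 0 = a /\ linked (g 1) cs' b else a = b.

Lemma last_sample N g : (0 < N)%N -> last (g 0) (sample N g) = g 1.
Proof.
case: N => // N _; rewrite /sample.
have -> : iota 0 N.+1 = iota 0 N ++ [:: N] by rewrite -addn1 iotaD.
by rewrite map_cat last_cat /= divff // pnatr_eq0.
Qed.

Lemma segs_sample N g s : s \in segs (g 0) (sample N g) ->
  exists2 i, (i < N)%N & s = (g (i%:R / N%:R), g (i.+1%:R / N%:R)).
Proof.
rewrite /sample; have -> : g 0 = g (0%:R / N%:R) by rewrite mul0r.
have H m k : (m + k = N)%N -> s \in segs (g (m%:R / N%:R)) [seq g (i.+1%:R / N%:R) | i <- iota m k] ->
    exists2 i, (i < N)%N & s = (g (i%:R / N%:R), g (i.+1%:R / N%:R)).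
  elim: k m => //= k IH m mk; rewrite inE => /predU1P[->|h].
    by exists m => //; rewrite -mk addnS ltnS leq_addr.
  by apply: (IH m.+1) => //; rewrite addSn -addnS.
exact: H.
Qed.

Lemma last_chain N a cs b : (0 < N)%N -> linked a cs b -> last a (chain N cs) = b.
Proof.
move=> N0; elim: cs a => //= g cs IH a [<- /IH] <-.
by rewrite /chain /= last_cat last_sample.
Qed.

Lemma segs_chain N a cs b s : (0 < N)%N -> linked a cs b -> s \in segs a (chain N cs) ->
  exists2 g, g \in cs & exists2 i, (i < N)%N & s = (g (i%:R / N%:R), g (i.+1%:R / N%:R)).
Proof.
move=> N0; elim: cs a => //= g cs IH a [<- lk].
rewrite /chain /= segs_cat mem_cat => /orP[/segs_sample h|].
  by exists g; rewrite ?mem_head.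
rewrite last_sample // => /(IH _ lk)[g' g'c h].
by exists g'; rewrite // inE g'c orbT.
Qed.

Local Open Scope classical_set_scope.

Lemma mix_ball (c a b : pt) (d t : R) : 0 <= t <= 1 -> ball c d a -> ball c d b ->
  ball c d (mix t a b).
Proof.
move=> /andP[t0 t1] [a1 a2] [b1 b2].
have H (x y z : R) : ball x d y -> ball x d z -> ball x d ((1 - t) * y + t * z).
  rewrite /ball /= !ltr_distlC => /andP[h1 h2] /andP[h3 h4]; apply/andP; split.
    by apply: conv_lt.
  have := @conv_lt _ t (- y) (- z) (- (x + d)) t0 t1; rewrite !ltrN2 => /(_ h2 h4); lra.
by split; apply: H.
Qed.

(** Near a pair of parameters the two curves stay in disjoint balls, and so do short chords because
    balls are convex. Compactness of the square of parameters makes the mesh uniform. *)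
Lemma curves_apart (g h : R -> pt) : continuous g -> continuous h ->
  (forall s t, s \in `[0, 1]%R -> t \in `[0, 1]%R -> g s <> h t) ->
  \forall N \near \oo, forall i j, (i < N)%N -> (j < N)%N ->
    disj_seg (g (i%:R / N%:R)) (g (i.+1%:R / N%:R)) (h (j%:R / N%:R)) (h (j.+1%:R / N%:R)).
Proof.
move=> cg ch dis.
pose K : set (R * R) := `[0, 1]%classic `*` `[0, 1]%classic.
have cK : compact K by apply: compact_setX; exact: segment_compact.
pose P (N : nat) (x : R * R) := forall s t : R, `|x.1 - s| <= N%:R^-1 -> `|x.2 - t| <= N%:R^-1 ->
  disj_seg (g x.1) (g s) (h x.2) (h t).
have loc x : K x -> \forall x' \near x & N \near \oo, P N x'.
  case: x => s t [/= sI tI].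
  have d0 : 0 < `|g s - h t| by rewrite normr_gt0 subr_eq0; apply/eqP; apply: dis.
  pose d := `|g s - h t| / 2.
  have dp : 0 < d by rewrite divr_gt0.
  have apart_ z : ball (g s) d z -> ball (h t) d z -> False.
    move=> b1 b2; have := ball_triangle b1 (ball_sym b2).
    by rewrite -ball_normE /= /d -splitr ltxx.
  have [e1 /= e10 B1] : exists2 e, 0 < e & forall u, `|s - u| < e -> ball (g s) d (g u).
    have /nbhs_ballP[e e0 he] := cg s _ (nbhsx_ballx (g s) d dp).
    by exists e => // u us; apply: he; rewrite -ball_normE.
  have [e2 /= e20 B2] : exists2 e, 0 < e & forall u, `|t - u| < e -> ball (h t) d (h u).
    have /nbhs_ballP[e e0 he] := ch t _ (nbhsx_ballx (h t) d dp).
    by exists e => // u us; apply: he; rewrite -ball_normE.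
  pose e := Num.min e1 e2 / 2.
  have e0 : 0 < e by rewrite divr_gt0 // lt_min e10.
  have ee1 : e + e <= e1 by rewrite /e -splitr ge_min lexx.
  have ee2 : e + e <= e2 by rewrite /e -splitr ge_min lexx orbT.
  exists (ball ((s, t) : R * R) e, [set N : nat | N%:R^-1 < e]).
    split; first exact: nbhsx_ballx.
    near=> N; rewrite /= invf_plt ?posrE //; last by rewrite ltr0n; near: N; exact: nbhs_infty_gt.
    near: N; exact: nbhs_infty_gtr.
  move=> [[s' t'] N] [/= [b1 b2] Ne] u u' /= hu hu' z [k1 k1I ->] [k2 k2I e12].
  move: b1 b2; rewrite -!ball_normE /= => b1 b2.
  have c1 : `|s - u| < e1.
    rewrite -(subrK s' s) -addrA; apply: le_lt_trans (ler_normD _ _) _.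
    by apply: lt_le_trans ee1; apply: ltrD => //; exact: le_lt_trans Ne.
  have c2 : `|t - u'| < e2.
    rewrite -(subrK t' t) -addrA; apply: le_lt_trans (ler_normD _ _) _.
    by apply: lt_le_trans ee2; apply: ltrD => //; exact: le_lt_trans Ne.
  apply: (apart_ (mix k1 (g s') (g u))).
    apply: mix_ball => //; apply: B1 => //; apply: lt_le_trans b1 _; lra.
  rewrite e12; apply: mix_ball => //; apply: B2 => //; apply: lt_le_trans b2 _; lra.
have /(_ _ \oo P _ loc) H := (compact_near_coveringP K).1 cK.
near=> N => i j iN jN.
have N0 : (0 < N)%N by apply: leq_trans iN.
have N0' : (N%:R : R) != 0 by rewrite pnatr_eq0 -lt0n.
have inI k : (k < N)%N -> 0 <= (k%:R / N%:R : R) <= 1.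
  move=> kN; apply/andP; split; first exact: divr_ge0.
  by rewrite ler_pdivrMr ?ltr0n // mul1r ler_nat; exact: ltnW.
have stp k : `|k%:R / N%:R - k.+1%:R / N%:R| <= N%:R^-1 :> R.
  by rewrite -mulrBl -addn1 natrD opprD addrA subrr add0r mulN1r normrN ger0_norm // invr_ge0.
have PN : K `<=` P N by near: N; exact: H.
apply: (PN (i%:R / N%:R, j%:R / N%:R)) => //=; split; rewrite /= in_itv /=; exact: inI.
Unshelve. all: by end_near.
Qed.
End Chains.

(** * Continuous curves *)

Section Curves.
Variable R : realType.
Local Open Scope ring_scope.
Local Open Scope classical_set_scope.
Notation pt := (R * R)%type.

Definition lin (l1 l2 : R) (z : pt) : R := l1 * z.1 + l2 * z.2.

Definition covers (cs : seq (R -> pt)) (z : pt) :=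
  exists2 g, g \in cs & exists2 t, 0 <= t <= 1 & z = g t.

Definition all_continuous (cs : seq (R -> pt)) := forall g, g \in cs -> continuous g.

Definition sub_curve (g : R -> pt) (s t : R) : R -> pt := fun u => g ((1 - u) * s + u * t).

Definition line (a b : pt) : R -> pt := fun t => mix t a b.

Definition reverse (cs : seq (R -> pt)) : seq (R -> pt) :=
  rev [seq (fun t => g (1 - t)) | g <- cs].

(** Composition with this retraction makes an arc continuous on the whole line, so no relative
    topology appears afterwards. *)
Definition clamp (t : R) : R := Num.max 0 (Num.min 1 t).

Lemma affine_continuous (s t : R) : continuous (fun u : R => (1 - u) * s + u * t).
Proof.
move=> u; apply: cvgD; apply: cvgM;
  [apply: cvgB; [exact: cvg_cst|exact: cvg_id]|exact: cvg_cst|exact: cvg_id|exact: cvg_cst].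
Qed.

Lemma sub_curve_continuous g s t : continuous g -> continuous (sub_curve g s t).
Proof.
move=> cg u; have := @continuous_comp _ _ _ (fun u : R => (1 - u) * s + u * t) g u.
by apply; [exact: affine_continuous | exact: cg].
Qed.

Lemma sub_curve0 g s t : sub_curve g s t 0 = g s.
Proof. by rewrite /sub_curve subr0 mul1r mul0r addr0. Qed.

Lemma sub_curve1 g s t : sub_curve g s t 1 = g t.
Proof. by rewrite /sub_curve subrr mul1r mul0r add0r. Qed.

Lemma convex01 (s t u : R) : 0 <= s <= 1 -> 0 <= t <= 1 -> 0 <= u <= 1 ->
  0 <= (1 - u) * s + u * t <= 1.
Proof.
move=> /andP[s0 s1] /andP[t0 t1] /andP[u0 u1].
have h1 : 0 <= (1 - u) * s by apply: mulr_ge0; lra.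
have h2 : 0 <= u * t by apply: mulr_ge0; lra.
have h3 : 0 <= (1 - u) * (1 - s) by apply: mulr_ge0; lra.
have h4 : 0 <= u * (1 - t) by apply: mulr_ge0; lra.
apply/andP; split; lra.
Qed.

Lemma line_continuous a b : continuous (line a b).
Proof. 
move=> u Q [[A B] /= [hA hB] sub].
have H1 : \forall t \near u, A ((1 - t) * a.1 + t * b.1) := @affine_continuous a.1 b.1 u _ hA.
have H2 : \forall t \near u, B ((1 - t) * a.2 + t * b.2) := @affine_continuous a.2 b.2 u _ hB.
suff: \forall t \near u, Q (line a b t) by [].
near=> t; apply: (sub (line a b t)); split; rewrite /line /mix /=; near: t; [exact: H1 | exact: H2].
Unshelve. all: by end_near.
Qed.

Lemma line0 a b : line a b 0 = a.
Proof. by case: a => x y; rewrite /line /mix /= subr0 !mul1r !mul0r !addr0. Qed.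

Lemma line1 a b : line a b 1 = b.
Proof. by case: b => x y; rewrite /line /mix /= subrr !mul1r !mul0r !add0r. Qed.

Lemma clamp_id t : 0 <= t <= 1 -> clamp t = t.
Proof.
rewrite /clamp => /andP[t0 t1]; rewrite (min_idPr t1); exact/max_idPr.
Qed.

Lemma clamp01 t : 0 <= clamp t <= 1.
Proof. by rewrite /clamp le_max lexx /= ge_max ler01 ge_min lexx. Qed.

Lemma clamp_near (x y e : R) : `|x - y| < e -> `|clamp x - clamp y| < e.
Proof.
rewrite !ltr_distlC /clamp /Order.max /Order.min => /andP[h1 h2].
case: (ltP 1 x) => ?; case: (ltP 1 y) => ?; rewrite ?ltr01;
  case: (ltP 0 x) => ?; case: (ltP 0 y) => ?; apply/andP; split; lra.
Qed.

Lemma clamp_continuous_within (g : R -> pt) : {within `[0, 1]%classic, continuous g} ->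
  continuous (g \o clamp).
Proof.
move=> /subspace_continuousP cg x.
have c01 y : `[0, 1]%classic (clamp y) by rewrite /= in_itv /= clamp01.
have := cg (clamp x) (c01 x); apply: cvg_trans => Q /=.
rewrite /within /= => /nbhs_ballP[e e0 he]; apply/nbhs_ballP; exists e => // y.
rewrite -ball_normE /= => /clamp_near xy; apply: he (c01 y).
by rewrite -ball_normE.
Qed.

Lemma lin_continuous l1 l2 (g : R -> pt) : continuous g ->
  continuous (fun t => lin l1 l2 (g t)).
Proof.
move=> cg t; apply: cvgD; apply: cvgM;
  [exact: cvg_cst | | exact: cvg_cst |].
- by apply: (@cvg_comp _ _ _ g fst _ _ _ (cg t)); exact: cvg_fst.
- by apply: (@cvg_comp _ _ _ g snd _ _ _ (cg t)); exact: cvg_snd.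
Qed.

Lemma covers_cat cs ds z : covers (cs ++ ds) z -> covers cs z \/ covers ds z.
Proof.
by case=> g; rewrite mem_cat => /orP[] gc h; [left|right]; exists g.
Qed.

Lemma covers_sub cs ds z : {subset cs <= ds} -> covers cs z -> covers ds z.
Proof. by move=> sub [g /sub gd h]; exists g. Qed.

Lemma covers1 g z : covers [:: g] z -> exists2 t, 0 <= t <= 1 & z = g t.
Proof. by case=> h; rewrite inE => /eqP ->. Qed.

Lemma max_on_curves l1 l2 cs : cs != [::] -> all_continuous cs ->
  exists2 z, covers cs z & forall y, covers cs y -> lin l1 l2 y <= lin l1 l2 z.
Proof.
elim: cs => // g cs IH _ cc.
have cg := cc g (mem_head _ _).
have [t tI ht] := EVT_max ler01 (continuous_subspaceT (@lin_continuous l1 l2 g cg)).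
rewrite in_itv /= in tI; have {}ht u : 0 <= u <= 1 -> lin l1 l2 (g u) <= lin l1 l2 (g t).
  by move=> uI; apply: ht; rewrite in_itv.
have gt1 : covers (g :: cs) (g t) by exists g; rewrite ?mem_head //; exists t.
case: (altP (cs =P [::])) => [cs0|ne].
  by exists (g t) => // y; rewrite cs0 => /covers1[s sI ->]; exact: ht.
have [|z zc hz] := IH ne; first by move=> h hc; apply: cc; rewrite inE hc orbT.
have sub : {subset cs <= g :: cs} by move=> h hc; rewrite inE hc orbT.
have [le|le] := leP (lin l1 l2 (g t)) (lin l1 l2 z).
  exists z => [|y]; first exact: covers_sub zc.
  case=> h; rewrite inE => /predU1P[->|hc] [s sI ->].
    by apply: le_trans le; exact: ht.
  by apply: hz; exists h => //; exists s.
exists (g t) => // y; case=> h; rewrite inE => /predU1P[->|hc] [s sI ->]; first exact: ht.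
by apply: le_trans (ltW le); apply: hz; exists h => //; exists s.
Qed.

Lemma value_on_curves l1 l2 (a b : pt) (cs : seq (R -> pt)) c : linked a cs b -> all_continuous cs ->
  lin l1 l2 a < c -> c < lin l1 l2 b -> exists2 z, covers cs z & lin l1 l2 z = c.
Proof.
elim: cs a => [|g cs IH] a /=; first by move=> -> _ h1 h2; have := lt_trans h1 h2; rewrite ltxx.
move=> [ga lk] cc ac cb.
have sub : {subset cs <= g :: cs} by move=> h hc; rewrite inE hc orbT.
have cg := cc g (mem_head _ _).
have [le|lt] := leP c (lin l1 l2 (g 1)).
  have [|t tI ht] := @IVT _ (fun t => lin l1 l2 (g t)) 0 1 c ler01
    (continuous_subspaceT (@lin_continuous l1 l2 g cg)).
    by rewrite ga ge_min (ltW ac) /= le_max le orbT.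
  by rewrite in_itv /= in tI; exists (g t) => //; exists g; rewrite ?mem_head //; exists t.
have [|z zc hz] := IH _ lk _ lt cb; first by move=> h /sub; exact: cc.
by exists z => //; exact: covers_sub zc.
Qed.

Lemma linked_cat (a m b : pt) (cs ds : seq (R -> pt)) : linked a cs m -> linked m ds b -> linked a (cs ++ ds) b.
Proof. by elim: cs a => [|g cs IH] a /= => [->|[-> lk] /(IH _ lk)]. Qed.

Lemma linked_reverse (a b : pt) (cs : seq (R -> pt)) : linked a cs b -> linked b (reverse cs) a.
Proof.
elim: cs a => [|g cs IH] a /= => [->|[ga /IH lk]] //.
rewrite /reverse /= rev_cons -cats1; apply: linked_cat lk _ => /=.
by rewrite subr0 subrr.
Qed.

Lemma covers_reverse cs z : covers (reverse cs) z -> covers cs z.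
Proof.
case=> g; rewrite mem_rev => /mapP[h hc ->] [t tI ->].
exists h => //; exists (1 - t) => //; move: tI => /andP[t0 t1].
by apply/andP; split; lra.
Qed.

Lemma reverse_continuous cs : all_continuous cs -> all_continuous (reverse cs).
Proof.
move=> cc g; rewrite mem_rev => /mapP[h hc ->] t.
have := @continuous_comp _ _ _ (fun t : R => 1 - t) h t.
apply; last exact: cc.
by apply: cvgB; [exact: cvg_cst | exact: cvg_id].
Qed.

Lemma near_all (T : eqType) (s : seq T) (P : nat -> T -> Prop) :
  (forall x, x \in s -> \forall N \near \oo, P N x) ->
  \forall N \near \oo, forall x, x \in s -> P N x.
Proof.
elim: s => [|a s IH] h; first by apply: nearW => N x.
have h1 := h a (mem_head _ _).
have h2 : \forall N \near \oo, forall x, x \in s -> P N x.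
  by apply: IH => x xs; apply: h; rewrite inE xs orbT.
by move: h1 h2; apply: filterS2 => N a1 a2 x; rewrite inE => /predU1P[->|/a2].
Qed.

Lemma chains_apart (a b x y : pt) (cs ds : seq (R -> pt)) : linked a cs b -> linked x ds y ->
  all_continuous cs -> all_continuous ds ->
  (forall z, covers cs z -> covers ds z -> False) ->
  \forall N \near \oo, (0 < N)%N /\ disj_chain a (chain N cs) x (chain N ds).
Proof.
move=> l1 l2 c1 c2 dis.
have H : \forall N \near \oo, forall g, g \in cs -> forall h, h \in ds ->
    forall i j, (i < N)%N -> (j < N)%N ->
    disj_seg (g (i%:R / N%:R)) (g (i.+1%:R / N%:R)) (h (j%:R / N%:R)) (h (j.+1%:R / N%:R)).
  apply: near_all => g gc; apply: near_all => h hd; apply: curves_apart.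
  - exact: c1.
  - exact: c2.
  - rewrite /= => s t; rewrite !in_itv /= => sI tI e; apply: (dis (g s)); first by exists g => //; exists s.
    by exists h => //; exists t.
have := nbhs_infty_gt 0; move: H; apply: filterS2 => N H N0; split=> // s t hs ht.
have [g gc [i iN ->]] := segs_chain N0 l1 hs.
have [h hd [j jN ->]] := segs_chain N0 l2 ht.
exact: H.
Qed.

Lemma segs_head (a : pt) (l : seq pt) : l != [::] -> exists2 s, s \in segs a l & on_seg s.1 s.2 a.
Proof. by case: l => // b l _; exists (a, b); rewrite ?mem_head //; exact: on_seg_l. Qed.

Lemma segs_last (a : pt) (l : seq pt) : l != [::] -> exists2 s, s \in segs a l & on_seg s.1 s.2 (last a l).
Proof.
elim: l a => // b [|c l] IH a _; first by exists (a, b); rewrite ?mem_head //; exact: on_seg_r.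
by have [s hs os] := IH b isT; exists s => //; rewrite inE hs orbT.
Qed.

Lemma chain_neq0 N (cs : seq (R -> pt)) : (0 < N)%N -> cs != [::] -> chain N cs != [::].
Proof. by case: N cs => // N [|g cs]. Qed.

Lemma chain_covers N (a b y : pt) (cs : seq (R -> pt)) : (0 < N)%N -> cs != [::] -> linked a cs b ->
  y \in a :: chain N cs -> covers cs y.
Proof.
move=> N0; case: cs => // g cs _ [ga _]; rewrite inE => /predU1P[->|].
  by exists g; rewrite ?mem_head //; exists 0; rewrite ?lexx ?ler01.
move=> /flatten_mapP[h hc /mapP[i]]; rewrite mem_iota add0n => /andP[_ iN] ->.
exists h => //; exists (i.+1%:R / N%:R) => //.
by rewrite divr_ge0 // ler_pdivrMr ?ltr0n // mul1r ler_nat.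
Qed.

Lemma paths_cross (a b x y : pt) (cs ds : seq (R -> pt)) : linked a cs b -> linked x ds y ->
  all_continuous cs -> all_continuous ds -> cs != [::] ->
  (forall z, covers cs z -> covers ds z -> False) ->
  \forall N \near \oo,
    crr x a (chain N cs) (+) crr y a (chain N cs) (+) crr a x (chain N ds)
      (+) crr b x (chain N ds) = prec x a (+) prec y a (+) prec x b (+) prec y b.
Proof.
move=> l1 l2 c1 c2 n1 dis; have := chains_apart l1 l2 c1 c2 dis.
apply: filterS => N [N0 dj].
have ne := chain_neq0 N0 n1.
have offa s : s \in segs x (chain N ds) -> ~ on_seg s.1 s.2 a.
  by move=> hs os; have [t ht ot] := segs_head a ne; apply: (dj t s ht hs _ ot os).
have offb s : s \in segs x (chain N ds) -> ~ on_seg s.1 s.2 b.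
  move=> hs os; have [t ht ot] := segs_last a ne; apply: (dj t s ht hs _ ot).
  by rewrite (last_chain N0 l1).
have := cross_chains dj; rewrite (last_chain N0 l1) (last_chain N0 l2).
rewrite (cll_crr offa) (cll_crr offb) (last_chain N0 l2) => E.
by apply: (xor_elim1 E); xor_solve.
Qed.

End Curves.

Lemma pigeonhole (T : finType) (f : nat -> T) :
  exists c, forall M, exists2 N, M <= N & f N = c.
Proof.
apply: contrapT => no.
have B c : exists M, forall N, M <= N -> f N <> c.
  apply: contrapT => h; apply: no; exists c => M; apply: contrapT => h'.
  by apply: h; exists M => N MN e; apply: h'; exists N.
have [m hm] := choice B.
by apply: (hm (f (\max_c m c)) (\max_c m c)) => //; exact: leq_bigmax.
Qed.

(** * Certificates from plane drawings *)

Section Drawing.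
Variables (R : realType) (G : sgraph).
Local Open Scope ring_scope.
Notation pt := (R * R)%type.
Variables (p : G -> pt) (arc : {set G} -> set pt).
Hypothesis D : plane_drawing p arc.

Definition curve_of (u v : G) (g : R -> pt) :=
  [/\ continuous g, forall s t, 0 <= s <= 1 -> 0 <= t <= 1 -> g s = g t -> s = t,
      g 0 = p u, g 1 = p v &
      forall z, arc (u |: [set v])%SET z <-> exists2 t, 0 <= t <= 1 & z = g t].

(** The two directions of an edge receive independently chosen parametrisations. The parities
    [r x a b] and [r x b a] may thus differ, and the certificate never compares them. *)
Lemma edge_curves : exists gam : G -> G -> R -> pt,
  forall u v, adj u v -> curve_of u v (gam u v).
Proof.
have E (uv : G * G) : exists g, adj uv.1 uv.2 -> curve_of uv.1 uv.2 g.
  case: uv => u v /=; case uv : (adj u v); last by exists (fun=> 0).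
  have [g [cg ig g0 g1 aE]] := drawing_arc D uv; exists (g \o @clamp R) => _; rewrite /curve_of aE.
  have cE t : 0 <= t <= 1 -> (g \o @clamp R) t = g t by move=> tI /=; rewrite clamp_id.
  split.
  - exact: clamp_continuous_within.
  - by move=> s t sI tI; rewrite !cE // => /ig; apply; rewrite in_itv.
  - by rewrite cE // lexx ler01.
  - by rewrite cE // lexx ler01.
  - move=> z; split=> [[t /= tI <-]|[t tI ->]].
      by rewrite in_itv /= in tI; exists t => //; rewrite /= clamp_id.
    by exists t; rewrite /= ?in_itv //= clamp_id.
have [gam H] := choice E.
by exists (fun u v => gam (u, v)) => u v uv; exact: (H (u, v)).
Qed.

Variable gam : G -> G -> R -> pt.
Hypothesis gamP : forall u v, adj u v -> curve_of u v (gam u v).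

Lemma edge_in u v : adj u v -> (u |: [set v])%SET \in edges G.
Proof. by move=> uv; apply/finset.imsetP; exists (u, v). Qed.

Lemma arcC u v : arc (u |: [set v])%SET = arc (v |: [set u])%SET.
Proof. by rewrite finset.setUC. Qed.

Lemma arc_end u v : adj u v -> arc (u |: [set v])%SET (p u).
Proof.
by move=> uv; have [_ _ g0 _ /(_ (p u))[_]] := gamP uv; apply; exists 0; rewrite ?lexx ?ler01.
Qed.

Lemma vertex_on_arc u v t : adj u v -> arc (u |: [set v])%SET (p t) -> (t == u) || (t == v).
Proof. by move=> /edge_in e /(drawing_vertex D e); rewrite !inE. Qed.

Lemma arcs_meet u v u' v' z : adj u v -> adj u' v' -> u != u' -> u != v' ->
  arc (u |: [set v])%SET z -> arc (u' |: [set v'])%SET z ->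
  z = p v /\ (v == u') || (v == v').
Proof.
move=> uv uv' n1 n2 h1 h2.
have [|t] := drawing_edge D (edge_in uv) (edge_in uv') _ h1 h2.
  apply/negP => /eqP e; have := finset.setU11 u [set v]%SET; rewrite e !inE.
  by rewrite (negPf n1) (negPf n2).
rewrite !inE => /andP[/orP[]/eqP-> h ->]; last by rewrite h.
by rewrite (negPf n1) (negPf n2) in h.
Qed.

Definition drawn z := exists u v, adj u v /\ arc (u |: [set v])%SET z.

(** The curve may run along arcs at [u], and curves to two vertices may meet: the certificate
    compares only edges without a common vertex, and all edges at the apex share it. *)
Definition accessible (po : pt) (u : G) := exists L : seq (R -> pt),
  [/\ L != [::], all_continuous L, linked po L (p u) &
      forall a b, adj a b -> u != a -> u != b ->
        forall z, covers L z -> ~ arc (a |: [set b])%SET z].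

Definition route (po : pt) (L : seq (R -> pt)) (q : pt) :=
  [/\ L != [::], all_continuous L, linked po L q &
      forall z, covers L z -> drawn z -> z = q].

Lemma access_vertex po L u : route po L (p u) -> accessible po u.
Proof.
case=> n c l h; exists L; split=> // a b ab ua ub z zL az.
have e : z = p u by apply: h => //; exists a, b.
by move: (vertex_on_arc (t := u) ab); rewrite -e (negPf ua) (negPf ub) => /(_ az).
Qed.

(** From a point inside an arc one continues along the arc to its end [a]. The retraced part could
    touch an arc not incident with [a] only at [p b], which it does not reach. *)
Lemma access_edge po L q a b : route po L q -> adj a b -> arc (a |: [set b])%SET q ->
  ~ (exists u, q = p u) -> accessible po a.
Proof.
case=> n c l h ab aq nq; have [cg ig g0 g1 gE] := gamP ab.
have [t0 t0I qE] := (gE q).1 aq.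
exists (L ++ [:: sub_curve (gam a b) t0 0]); split.
- by case: (L) n.
- move=> g; rewrite mem_cat inE => /orP[/c //|/eqP ->]; exact: sub_curve_continuous.
- apply: linked_cat l _ => /=; by rewrite sub_curve0 sub_curve1.
move=> a' b' ab' n1 n2 z /covers_cat[zL|/covers1[u uI zE]] az.
  have e : z = q by apply: h => //; exists a', b'.
  have [zb _] := arcs_meet ab ab' n1 n2 aq (eq_ind z _ az q e).
  by apply: nq; exists b.
rewrite /sub_curve in zE; set s := (_ + _) in zE.
have sI : 0 <= s <= 1 by apply: convex01 => //; rewrite lexx ler01.
have az' : arc (a |: [set b])%SET z by apply/gE; exists s.
have [zb _] := arcs_meet ab ab' n1 n2 az' az.
have s1 : s = 1 by apply: ig => //; rewrite ?lexx ?ler01 // g1 -zE.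
case/andP: t0I uI => t00 t01 /andP[u0 u1].
have ut : 0 <= u * t0 by exact: mulr_ge0.
by apply: nq; exists b; rewrite qE -g1; congr (gam a b _); rewrite /s in s1; lra.
Qed.

Lemma access_extremal po L q : route po L q -> drawn q ->
  (exists2 u, q = p u & accessible po u) \/
  (exists a b, [/\ a != b, accessible po a & accessible po b]).
Proof.
move=> rt [a [b [ab aq]]]; case: (EM (exists u, q = p u)) => [[u e]|nq].
  by left; exists u => //; rewrite e in rt; exact: access_vertex rt.
right; exists a, b; split.
- by apply/eqP => e; move: ab; rewrite e adj_irrefl.
- exact: access_edge rt ab aq nq.
- by apply: access_edge rt _ _ nq; [rewrite adj_sym; exact: ab | rewrite arcC].
Qed.

Definition all_edges := [seq gam uv.1 uv.2 | uv <- enum [pred uv : G * G | adj uv.1 uv.2]].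

Lemma all_edges_continuous : all_continuous all_edges.
Proof.
move=> g /mapP[[u v]]; rewrite mem_enum inE /= => uv ->.
by have [] := gamP uv.
Qed.

Lemma drawn_covers z : drawn z -> covers all_edges z.
Proof.
case=> u [v [uv az]]; have [_ _ _ _ gE] := gamP uv.
have [t tI ->] := (gE z).1 az; exists (gam u v); last by exists t.
by apply/mapP; exists (u, v); rewrite // mem_enum inE.
Qed.

Lemma covers_drawn z : covers all_edges z -> drawn z.
Proof.
case=> g /mapP[[u v]]; rewrite mem_enum inE /= => uv -> zt.
by exists u, v; split=> //; have [_ _ _ _ gE] := gamP uv; apply/gE.
Qed.

Hypothesis degree_gt0 : forall u : G, exists v, adj u v.
Variable (u0 : G).

Lemma drawn_vertex u : drawn (p u).
Proof. by have [v uv] := degree_gt0 u; exists u, v; split=> //; exact: arc_end. Qed.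

Lemma drawn_max l1 l2 : exists2 q, drawn q & forall z, drawn z -> lin l1 l2 z <= lin l1 l2 q.
Proof.
have ne : all_edges != [::].
  apply/negP => /eqP e; have := drawn_covers (drawn_vertex u0); rewrite e.
  by case=> g; rewrite in_nil.
have [q qc h] := max_on_curves l1 l2 ne all_edges_continuous.
by exists q; [exact: covers_drawn | move=> z /drawn_covers; exact: h].
Qed.

Lemma line_route po q : (forall t, 0 <= t <= 1 -> drawn (mix t po q) -> t = 1) ->
  route po [:: line po q] q.
Proof.
move=> h; split=> //.
- by move=> g; rewrite inE => /eqP ->; exact: line_continuous.
- by rewrite /= line0 line1.
- by move=> z /covers1[t tI ->] dz; rewrite (h t tI dz) line1.
Qed.

(** The apex is placed to the right of a rightmost point. If that point is inside an edge, both ends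
    of the edge are accessible; otherwise it is a first vertex, and a leftmost point, reached by a
    detour over the top, provides a second one. *)
Lemma apex_exists : exists po v w,
  [/\ v != w, accessible po v, accessible po w & forall z, drawn z -> z.1 < po.1].
Proof.
have [q1 d1 h1] := drawn_max 1 0; have [q2 d2 h2] := drawn_max (-1) 0.
have [q3 d3 h3] := drawn_max 0 1.
have {}h1 z : drawn z -> z.1 <= q1.1 by move/h1; rewrite /lin; lra.
have {}h2 z : drawn z -> q2.1 <= z.1 by move/h2; rewrite /lin; lra.
have {}h3 z : drawn z -> z.2 <= q3.2 by move/h3; rewrite /lin; lra.
pose po : pt := (q1.1 + 1, q1.2).
have right z : drawn z -> z.1 < po.1 by move/h1 => /=; lra.
have fin a b : a != b -> accessible po a -> accessible po b -> exists po v w,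
  [/\ v != w, accessible po v, accessible po w & forall z, drawn z -> z.1 < po.1].
  by move=> ab aa ac; exists po, a, b.
have rt1 : route po [:: line po q1] q1.
  apply: line_route => t /andP[t0 t1] /h1; rewrite /mix /= => h; lra.
case: (access_extremal rt1 d1) => [[v q1v av]|[a [b [ab aa ac]]]]; last exact: fin ab aa ac.
(* The detour keeps one unit away from the bounding box, so it meets the drawing only at its last
   point. *)
pose A1 : pt := (q1.1 + 1, q3.2 + 1); pose A2 : pt := (q2.1 - 1, q3.2 + 1).
pose A3 : pt := (q2.1 - 1, q2.2).
have rt2 : route po [:: line po A1; line A1 A2; line A2 A3; line A3 q2] q2.
  split=> //.
  - by move=> g; rewrite !inE => /or4P[]/eqP->; exact: line_continuous.
  - by rewrite /= !line0 !line1.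
  - move=> z [g]; rewrite !inE => /or4P[]/eqP-> [t /andP[t0 t1] zE] dz;
      have z1 := h1 z dz; have z2 := h2 z dz; have z3 := h3 z dz;
      rewrite zE /line /mix /= in z1 z2 z3;
      try by have : (0 : R) < 0 by [lra]; rewrite ltxx.
    have te : t = 1 by lra.
    by rewrite zE te line1.
case: (access_extremal rt2 d2) => [[w q2w aw]|[a [b [ab aa ac]]]]; last exact: fin ab aa ac.
have [vw|] := eqVneq v w; last by move=> vw; exact: fin vw av aw.
(* everything lies on one vertical line *)
have q12 : q1.1 = q2.1 by rewrite q1v q2w vw.
have [u vu] := degree_gt0 v.
have rt3 : route po [:: line po (p u)] (p u).
  apply: line_route => t /andP[t0 t1] dz; have := h1 _ dz; rewrite /mix /=.
  have e : (p u).1 = q1.1.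
    by have := h1 _ (drawn_vertex u); have := h2 _ (drawn_vertex u); rewrite -q12; lra.
  rewrite e; lra.
apply: fin av (access_vertex rt3).
by apply/eqP => e; move: vu; rewrite e adj_irrefl.
Qed.

Fixpoint strand_curves (b : G) (l : seq G) : seq (R -> pt) :=
  if l is c :: m then gam b c :: strand_curves c m else [::].

Lemma linked_strand b l : path (@adj G) b l -> linked (p b) (strand_curves b l) (p (last b l)).
Proof.
elim: l b => //= c l IH b /andP[bc /IH lk]; have [_ _ -> -> _] := gamP bc; by [].
Qed.

Lemma strand_continuous b l : path (@adj G) b l -> all_continuous (strand_curves b l).
Proof.
elim: l b => [|c l IH] b /=; first by move=> _ g; rewrite in_nil.
move=> /andP[bc /IH h] g; rewrite inE => /predU1P[->|/h //].
by have [] := gamP bc.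
Qed.

Lemma covers_strand1 d q c z : path (@adj G) d (rcons q c) -> covers (strand_curves d (rcons q c)) z ->
  exists x y, [/\ x \in d :: q, y \in c :: q, adj x y & arc (x |: [set y])%SET z].
Proof.
have split_cover g cs : covers (g :: cs) z ->
    (exists2 t, 0 <= t <= 1 & z = g t) \/ covers cs z.
  by case=> h; rewrite inE => /predU1P[->|hc] e; [left | right; exists h].
elim: q d => [|e q IH] d /= /andP[dc pa] /split_cover[zt|zc].
- by have [_ _ _ _ gE] := gamP dc; exists d, c; rewrite !inE !eqxx; split=> //; apply/gE.
- by case: zc => g; rewrite in_nil.
- have [_ _ _ _ gE] := gamP dc; exists d, e; rewrite !inE !eqxx orbT; split=> //; exact/gE.
have [x [y [hx hy xy az]]] := IH e pa zc; exists x, y; split=> //.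
  by rewrite inE hx orbT.
by move: hy; rewrite !inE => /orP[->|->]; rewrite ?orbT.
Qed.

Lemma covers_strand b q c z : q != [::] -> path (@adj G) b (rcons q c) ->
  covers (strand_curves b (rcons q c)) z ->
  exists x y, [/\ x \in q, y \in b :: c :: q, adj x y & arc (x |: [set y])%SET z].
Proof.
case: q => // d q _ /= /andP[bd pa] [g]; rewrite inE => /predU1P[->|gs] zt.
  have [_ _ _ _ gE] := gamP bd; exists d, b; rewrite !inE !eqxx adj_sym bd; split=> //.
  by rewrite arcC; apply/gE.
have [x [y [hx hy xy az]]] := covers_strand1 pa (ex_intro2 _ _ g gs zt).
exists x, y; split=> //.
by move: hy; rewrite !inE => /orP[->|->]; rewrite ?orbT.
Qed.

Lemma interior_meet b c q q' x y z : uniq (b :: c :: q ++ q') -> q' != [::] ->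
  path (@adj G) b (rcons q' c) -> x \in q -> y \in b :: c :: q -> adj x y ->
  arc (x |: [set y])%SET z -> covers (strand_curves b (rcons q' c)) z ->
  z = p y /\ (y == b) || (y == c).
Proof.
move=> un ne pa xq yq xy az /(covers_strand ne pa)[x' [y' [xq' yq' xy' az']]].
have [bc [bq [cq dis]]] : b != c /\ (b \notin q ++ q' /\ (c \notin q ++ q' /\
    forall t, t \in q -> t \in q' -> False)).
  move: un; rewrite /= inE negb_or cat_uniq => /and3P[/andP[-> ->] -> /and3P[_ /hasPn h _]].
  by do 3!split=> //; move=> t tq /h /=; rewrite tq.
move: bq cq; rewrite !mem_cat !negb_or => /andP[bq bq'] /andP[cq cq'].
have nx t : t \in b :: c :: q' -> x != t.
  rewrite !inE => /or3P[/eqP->|/eqP->|tq]; apply/eqP => e; move: xq; rewrite e.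
  - by rewrite (negPf bq).
  - by rewrite (negPf cq).
  - by move=> h; exact: dis h tq.
have xx' : x' \in b :: c :: q' by rewrite !inE xq' !orbT.
have [zy yy] := arcs_meet xy xy' (nx _ xx') (nx _ yq') az az'; split=> //.
have yb : y \in b :: c :: q' by case/orP: yy => /eqP->.
move: yq yb; rewrite !inE; case: (y == b) => //=; case: (y == c) => //= h1 h2.
by have := dis _ h1 h2.
Qed.

(* From a point of the strand through [q] that is extreme in direction [(l1, l2)]
   one can walk off to infinity, so the other strands have the same index at
   [x] as at a point beyond them. *)
Lemma escape l1 l2 b c q z : (l1 != 0) || (l2 != 0) -> q != [::] -> path (@adj G) b (rcons q c) ->
  covers (strand_curves b (rcons q c)) z -> z <> p b -> z <> p c ->
  exists2 x, x \in q & exists K : nat -> bool, forall q',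
    q' != [::] -> path (@adj G) b (rcons q' c) -> uniq (b :: c :: q ++ q') ->
    (forall y, covers (strand_curves b (rcons q' c)) y -> lin l1 l2 y <= lin l1 l2 z) ->
    \forall N \near \oo%classic, crr (p x) (p b) (chain N (strand_curves b (rcons q' c))) = K N.
Proof.
move=> l0 ne pa /(covers_strand ne pa)[x [y [xq yq xy az]]] zb zc; exists x => //.
have [cg ig g0 g1 gE] := gamP xy; have [t0 t0I zE] := (gE z).1 az.
(* [z'] lies strictly beyond [z] in the extreme direction, so [crr_behind] determines its parity
   from the ends of the strand. *)
pose z' : pt := (z.1 + l1, z.2 + l2).
have nrm : 0 < l1 * l1 + l2 * l2.
  have h1 : 0 <= l1 * l1 by rewrite -expr2 sqr_ge0.
  have h2 : 0 <= l2 * l2 by rewrite -expr2 sqr_ge0.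
  case/orP: l0 => /negPf h.
    have : l1 * l1 != 0 by rewrite mulf_eq0 h.
    by rewrite neq_lt => /orP[] ?; lra.
  have : l2 * l2 != 0 by rewrite mulf_eq0 h.
  by rewrite neq_lt => /orP[] ?; lra.
pose L := [:: sub_curve (gam x y) 0 t0; line z z'].
have Lc : all_continuous L.
  move=> g; rewrite !inE => /orP[]/eqP->; [exact: sub_curve_continuous | exact: line_continuous].
have Ll : linked (p x) L z' by rewrite /= sub_curve0 sub_curve1 line0 line1 -zE.
(* Only [b], [c] and the escape route occur here and not [q'], so all strands behind [z] get the
   same value. *)
exists (fun N => [&& l1 < 0 & prec (p b) z' (+) prec (p c) z'] (+)
  (cll (p b) (p x) (chain N L) (+) cll (p c) (p x) (chain N L))).
move=> q' ne' pa' un bd.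
have lk := linked_strand pa'; rewrite last_rcons in lk.
have meet u : arc (x |: [set y])%SET u -> covers (strand_curves b (rcons q' c)) u ->
    u = p y /\ (y == b) || (y == c) by move=> h1 h2; exact: interior_meet un ne' pa' xq yq xy h1 h2.
have zy : z = p y -> (y == b) || (y == c) -> False.
  by move=> e /orP[]/eqP h; rewrite h in e.
have dis u : covers (strand_curves b (rcons q' c)) u -> covers L u -> False.
  move=> us [g]; rewrite !inE => /orP[]/eqP-> [t tI uE].
    rewrite /sub_curve in uE; set s := (_ + _) in uE.
    have sI : 0 <= s <= 1 by apply: convex01 => //; rewrite lexx ler01.
    have [|uy yy] := meet u _ us; first by apply/gE; exists s.
    have s1 : s = 1 by apply: ig => //; rewrite ?lexx ?ler01 // g1 -uE.
    case/andP: t0I => t00 t01; case/andP: tI => u00 u01.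
    have ut : 0 <= (1 - t) * t0 by apply: mulr_ge0; lra.
    by apply: zy yy; rewrite zE -g1; congr (gam x y _); rewrite /s in s1; lra.
  have := bd u us; rewrite uE /line /lin /mix /= => h.
  case/andP: tI => t00 t01.
  have te : t = 0.
    apply/eqP; rewrite eq_le t00 andbT -(pmulr_rle0 _ nrm).
    have -> : (l1 * l1 + l2 * l2) * t = l1 * ((1 - t) * z.1 + t * (z.1 + l1)) +
      l2 * ((1 - t) * z.2 + t * (z.2 + l2)) - (l1 * z.1 + l2 * z.2) by ring.
    by rewrite subr_le0.
  have uz : u = z by rewrite uE te line0.
  by rewrite uz in us; have [e1 e2] := meet z az us; exact: zy e1 e2.
have := chains_apart lk Ll (strand_continuous pa') Lc dis.
apply: filterS => N [N0 dj].
have sne : strand_curves b (rcons q' c) != [::] by case: (q').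
have := cross_chains dj; rewrite (last_chain N0 lk) (last_chain N0 Ll).
rewrite (@crr_behind _ l1 l2 z'); last first.
  move=> u /(chain_covers N0 sne lk)/bd; rewrite /lin /= => h.
  by apply: le_lt_trans h _; lra.
rewrite (last_chain N0 lk) => E.
by apply: (xor_elim1 E); rewrite ?[[&& _ & _]]/(_ && _); xor_solve.
Qed.

(** A point farthest from the line through [p b] and [p c], on either side, is neither of these two
    points, so [escape] applies to the strand that carries it. The direction is the normal of the
    line, or its opposite. *)
Lemma theta_escape b c p1 p2 p3 : simple_theta b c p1 p2 p3 ->
  let ix N x q := crr (p x) (p b) (chain N (strand_curves b (rcons q c))) in
  [\/ exists2 x, x \in p1 & \forall N \near \oo%classic, ix N x p2 = ix N x p3,
      exists2 x, x \in p2 & \forall N \near \oo%classic, ix N x p1 = ix N x p3 |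
      exists2 x, x \in p3 & \forall N \near \oo%classic, ix N x p1 = ix N x p2].
Proof.
case=> un /and3P[n1 n2 n3] [a1 a2 a3] ix.
have sub q : subseq q (p1 ++ p2 ++ p3) -> uniq (b :: c :: q).
  by move=> s; apply: subseq_uniq un; rewrite /= !eqxx.
have u12 : uniq (b :: c :: p1 ++ p2).
  by apply: sub; rewrite catA; exact: prefix_subseq.
have u13 : uniq (b :: c :: p1 ++ p3).
  by apply: sub; apply: cat_subseq => //; exact: suffix_subseq.
have u23 : uniq (b :: c :: p2 ++ p3) by apply: sub; exact: suffix_subseq.
have sw q q' : uniq (b :: c :: q ++ q') -> uniq (b :: c :: q' ++ q).
  by rewrite /= !inE !mem_cat ![(_ \in q) || _]orbC uniq_catC.
have bc : b != c by case/andP: un; rewrite inE negb_or => /andP[].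
have key l1 l2 z : (l1 != 0) || (l2 != 0) -> z <> p b -> z <> p c ->
    covers (strand_curves b (rcons p1 c) ++ strand_curves b (rcons p2 c) ++ strand_curves b (rcons p3 c)) z ->
    (forall y, covers (strand_curves b (rcons p1 c) ++ strand_curves b (rcons p2 c) ++ strand_curves b (rcons p3 c)) y
      -> lin l1 l2 y <= lin l1 l2 z) ->
  [\/ exists2 x, x \in p1 & \forall N \near \oo%classic, ix N x p2 = ix N x p3,
      exists2 x, x \in p2 & \forall N \near \oo%classic, ix N x p1 = ix N x p3 |
      exists2 x, x \in p3 & \forall N \near \oo%classic, ix N x p1 = ix N x p2].
  move=> l0 zb zc zS bd.
  have b1 y : covers (strand_curves b (rcons p1 c)) y -> lin l1 l2 y <= lin l1 l2 z.
    by move=> h; apply: bd; apply: covers_sub h => g gs; rewrite mem_cat gs.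
  have b2 y : covers (strand_curves b (rcons p2 c)) y -> lin l1 l2 y <= lin l1 l2 z.
    by move=> h; apply: bd; apply: covers_sub h => g gs; rewrite !mem_cat gs orbT.
  have b3 y : covers (strand_curves b (rcons p3 c)) y -> lin l1 l2 y <= lin l1 l2 z.
    by move=> h; apply: bd; apply: covers_sub h => g gs; rewrite !mem_cat gs !orbT.
  case/covers_cat: zS => [z1|/covers_cat[z2|z3]].
  - have [x xp [K HK]] := escape l0 n1 a1 z1 zb zc; constructor 1; exists x => //.
    move: (HK _ n2 a2 u12 b2) (HK _ n3 a3 u13 b3); apply: filterS2 => N e1 e2.
    by rewrite /ix e1 e2.
  - have [x xp [K HK]] := escape l0 n2 a2 z2 zb zc; constructor 2; exists x => //.
    move: (HK _ n1 a1 (sw _ _ u12) b1) (HK _ n3 a3 u23 b3); apply: filterS2 => N e1 e2.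
    by rewrite /ix e1 e2.
  - have [x xp [K HK]] := escape l0 n3 a3 z3 zb zc; constructor 3; exists x => //.
    move: (HK _ n1 a1 (sw _ _ u13) b1) (HK _ n2 a2 (sw _ _ u23) b2); apply: filterS2 => N e1 e2.
    by rewrite /ix e1 e2.
set S := _ ++ _ in key.
have Sc : all_continuous S.
  by move=> g; rewrite !mem_cat => /or3P[]; apply: strand_continuous.
have Sn : S != [::] by rewrite /S; case: (p1).
pose d1 := (p c).1 - (p b).1; pose d2 := (p c).2 - (p b).2.
have dn : (d1 != 0) || (d2 != 0).
  rewrite -negb_and !subr_eq0; apply/negP => /andP[/eqP e1 /eqP e2].
  move/eqP: bc; apply; apply: (drawing_inj D).
  by rewrite [LHS]surjective_pairing [RHS]surjective_pairing e1 e2.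
have lbc : lin (- d2) d1 (p b) = lin (- d2) d1 (p c) by rewrite /lin /d1 /d2; ring.
have [z zS bd] := max_on_curves (- d2) d1 Sn Sc.
have [le1|lt1] := leP (lin (- d2) d1 z) (lin (- d2) d1 (p b)); last first.
  apply: (key (- d2) d1 z) => //; first by rewrite oppr_eq0 orbC.
    by move=> e; move: lt1; rewrite e ltxx.
  by move=> e; move: lt1; rewrite e lbc ltxx.
have linN y : lin d2 (- d1) y = - lin (- d2) d1 y by rewrite /lin; ring.
have [z' zS' bd'] := max_on_curves d2 (- d1) Sn Sc.
have [le2|lt2] := leP (lin d2 (- d1) z') (lin d2 (- d1) (p b)); last first.
  apply: (key d2 (- d1) z') => //; first by rewrite oppr_eq0 orbC.
    by move=> e; move: lt2; rewrite e ltxx.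
  by move=> e; move: lt2; rewrite e !linN lbc ltxx.
(* the whole theta lies on the line through [p b] and [p c]: two strands share
   the midpoint *)
exfalso.
have flat y : covers S y -> lin (- d2) d1 y = lin (- d2) d1 (p b).
  move=> yS; apply/le_anti; rewrite (le_trans (bd y yS) le1) /=.
  by rewrite -lerN2 -!linN; exact: le_trans (bd' y yS) le2.
have nrm : 0 < d1 * d1 + d2 * d2.
  have h1 : 0 <= d1 * d1 by rewrite -expr2 sqr_ge0.
  have h2 : 0 <= d2 * d2 by rewrite -expr2 sqr_ge0.
  case/orP: dn => /negPf h.
    have : d1 * d1 != 0 by rewrite mulf_eq0 h.
    by rewrite neq_lt => /orP[] ?; lra.
  have : d2 * d2 != 0 by rewrite mulf_eq0 h.
  by rewrite neq_lt => /orP[] ?; lra.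
have cb : lin d1 d2 (p c) = lin d1 d2 (p b) + (d1 * d1 + d2 * d2).
  by rewrite /lin /d1 /d2; ring.
pose m := lin d1 d2 (p b) + (d1 * d1 + d2 * d2) / 2.
have mb : lin d1 d2 (p b) < m by rewrite /m; lra.
have mc : m < lin d1 d2 (p c) by rewrite /m cb; lra.
have L1 := linked_strand a1; rewrite last_rcons in L1.
have L2 := linked_strand a2; rewrite last_rcons in L2.
have [y1 yS1 m1] := value_on_curves L1 (strand_continuous a1) mb mc.
have [y2 yS2 m2] := value_on_curves L2 (strand_continuous a2) mb mc.
have f1 : lin (- d2) d1 y1 = lin (- d2) d1 (p b).
  by apply: flat; apply: covers_sub yS1 => g gs; rewrite mem_cat gs.
have f2 : lin (- d2) d1 y2 = lin (- d2) d1 (p b).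
  by apply: flat; apply: covers_sub yS2 => g gs; rewrite !mem_cat gs orbT.
have e1 : y1.1 = y2.1.
  apply: (mulfI (lt0r_neq0 nrm)).
  have -> : (d1 * d1 + d2 * d2) * y1.1 = d1 * lin d1 d2 y1 - d2 * lin (- d2) d1 y1.
    by rewrite /lin; ring.
  have -> : (d1 * d1 + d2 * d2) * y2.1 = d1 * lin d1 d2 y2 - d2 * lin (- d2) d1 y2.
    by rewrite /lin; ring.
  by rewrite m1 m2 f1 f2.
have e2 : y1.2 = y2.2.
  apply: (mulfI (lt0r_neq0 nrm)).
  have -> : (d1 * d1 + d2 * d2) * y1.2 = d2 * lin d1 d2 y1 + d1 * lin (- d2) d1 y1.
    by rewrite /lin; ring.
  have -> : (d1 * d1 + d2 * d2) * y2.2 = d2 * lin d1 d2 y2 + d1 * lin (- d2) d1 y2.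
    by rewrite /lin; ring.
  by rewrite m1 m2 f1 f2.
have e : y1 = y2 by rewrite [LHS]surjective_pairing [RHS]surjective_pairing e1 e2.
have [x [y [xq yq xy az]]] := covers_strand n1 a1 yS1; rewrite -e in yS2.
have [ey] := interior_meet u12 n2 a2 xq yq xy az yS2.
by case/orP=> /eqP h; move: m1; rewrite ey h => m1; move: mb mc; rewrite m1 ltxx.
Qed.

Section Certificate.
Variables (po : pt) (v w : G) (Lv Lw : seq (R -> pt)).
Hypothesis right_of : forall z, drawn z -> z.1 < po.1.
Let good L u := [/\ L != [::], all_continuous L, linked po L (p u) &
      forall a b, adj a b -> u != a -> u != b ->
        forall z, covers L z -> ~ arc (a |: [set b])%SET z].
Hypothesis goodv : good Lv v.
Hypothesis goodw : good Lw w.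

Let place (x : option G) : pt := if x is Some u then p u else po.
Let leg u := if u == v then Lv else Lw.
Let link (a b : option G) : seq (R -> pt) :=
  match a, b with
  | Some a, Some b => [:: gam a b]
  | None, Some u => leg u
  | Some u, None => reverse (leg u)
  | None, None => [::]
  end.

Lemma good_leg u : (u == v) || (u == w) -> good (leg u) u.
Proof.
rewrite /leg; have [->|n] := eqVneq u v; first by [].
by move=> /= /eqP ->.
Qed.

Lemma linkP a b : apex_adj v w a b ->
  [/\ linked (place a) (link a b) (place b), all_continuous (link a b) & link a b != [::]].
Proof.
case: a b => [a|] [b|] //= ab.
- have [cg _ g0 g1 _] := gamP ab; split=> //.
  by move=> g; rewrite inE => /eqP ->.
- have [n c l _] := good_leg ab; split; [exact: linked_reverse | exact: reverse_continuous |].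
  by rewrite -size_eq0 /reverse size_rev size_map size_eq0.
- by have [n c l _] := good_leg ab; split.
Qed.

Lemma link_apart a b x y z : apex_adj v w a b -> apex_adj v w x y ->
  a != x -> a != y -> b != x -> b != y -> covers (link a b) z -> covers (link x y) z -> False.
Proof.
have edge a0 b0 : adj a0 b0 -> covers [:: gam a0 b0] z -> arc (a0 |: [set b0])%SET z.
  by move=> ab /covers1 h; have [_ _ _ _ gE] := gamP ab; apply/gE.
have H u x0 y0 : (u == v) || (u == w) -> adj x0 y0 -> u != x0 -> u != y0 ->
    covers (leg u) z -> covers [:: gam x0 y0] z -> False.
  move=> /good_leg[_ _ _ h] xy n1 n2 c1 c2; exact: (h _ _ xy n1 n2 _ c1 (edge _ _ xy c2)).
case: a b x y => [a|] [b|] [x|] [y|] //= ab xy ax ay bx by_ c1 c2.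
- have [_] := arcs_meet ab xy ax ay (edge _ _ ab c1) (edge _ _ xy c2).
  by rewrite -[b == x]/(Some b == Some x) -[b == y]/(Some b == Some y) (negPf bx) (negPf by_).
- apply: (H x a b xy ab _ _ (covers_reverse c2) c1); [by rewrite eq_sym|by rewrite eq_sym].
- apply: (H y a b xy ab _ _ c2 c1); [by rewrite eq_sym|by rewrite eq_sym].
- exact: (H a x y ab xy ax ay (covers_reverse c1) c2).
- exact: (H b x y ab xy bx by_ c1 c2).
Qed.

Let rN N x a b := crr (place x) (place a) (chain N (link a b)).

Lemma wind_strand N x b l : (0 < N)%N -> path (@adj G) b l ->
  wind (rN N) (Some x) (Some b) (map Some l) = crr (p x) (p b) (chain N (strand_curves b l)).
Proof.
move=> N0; elim: l b => //= c l IH b /andP[bc /IH ->].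
have [_ _ g0 g1 _] := gamP bc.
by rewrite /rN /chain /= cats0 crr_cat -{3}g0 last_sample // g1.
Qed.

Lemma certificate_at : exists r s, planar_certificate v w r s.
Proof.
have [f hf] := pigeonhole (fun N => [ffun t : option G * option G * option G =>
  rN N t.1.1 t.1.2 t.2]).
pose r x a b := f (x, a, b).
(* A property of all fine meshes holds at some mesh that shows the recurrent pattern, hence it can
   be read off [r]. Starting from [M.+1] also makes that mesh positive. *)
have lim (Q : nat -> Prop) : (\forall N \near \oo%classic, Q N) ->
    exists N, [/\ (0 < N)%N, Q N & forall x a b, rN N x a b = r x a b].
  case=> M _ HM; have [N MN fN] := hf M.+1; exists N; split.
  - exact: leq_trans MN.
  - by apply: HM => /=; exact: ltnW.
  - by move=> x a b; rewrite /r -fN ffunE.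
exists r, (fun a x => prec (place x) (place a)); split.
- move=> a b x y ab xy ax ay bx by_.
  have [l1 c1 n1] := linkP ab; have [l2 c2 n2] := linkP xy.
  have [N [_ E rE]] := lim _ (paths_cross l1 l2 c1 c2 n1
    (fun z => @link_apart a b x y z ab xy ax ay bx by_)).
  by rewrite -!rE; exact: E.
- move=> a b ab; apply: prec_asym.
  case: a b ab => [a|] [b|] //= ab; apply/negP => /eqP e.
  + by move/(drawing_inj D): e ab => ->; rewrite eqxx.
  + by have := right_of (drawn_vertex a); rewrite -e ltxx.
  + by have := right_of (drawn_vertex b); rewrite e ltxx.
- move=> a b ab; have [|N [N0 _ rE]] := lim (fun=> True); first by apply: nearW.
  have [l c n] := @linkP (Some a) (Some b) ab.
  rewrite -rE /rN (@crr_behind _ 1 0) ?ltr10 // => y /(chain_covers N0 n l).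
  move=> /covers1 h; have [_ _ _ _ gE] := gamP ab.
  have : drawn y by exists a, b; split=> //; exact/gE.
  by move/right_of => /=; lra.
- move=> b c p1 p2 p3 th idx; have [_ _ [a1 a2 a3]] := th.
  have tr x q q' : path (@adj G) b (rcons q c) -> path (@adj G) b (rcons q' c) ->
      (\forall N \near \oo%classic, crr (p x) (p b) (chain N (strand_curves b (rcons q c))) =
        crr (p x) (p b) (chain N (strand_curves b (rcons q' c)))) -> idx x q q' = false.
    move=> pq pq' /lim[N [N0 E rE]].
    have W l : wind r (Some x) (Some b) (map Some l) = wind (rN N) (Some x) (Some b) (map Some l).
      by elim: l (Some b) => //= e l IH d; rewrite rE IH.
    by rewrite /idx /curve_index !W !wind_strand // E addbb.
  case: (theta_escape th) => [] [x xp /tr h]; [constructor 1|constructor 2|constructor 3];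
    by exists x => //; apply: h.
Qed.

End Certificate.
End Drawing.

Theorem planar_has_certificate (R : realType) (G : sgraph) :
  k_connected 3 G -> planar R G ->
  exists v w r s, v != w /\ @planar_certificate G v w r s.
Proof.
move=> [G3 conn] [p [arc D]].
have deg (u : G) : exists v, adj u v.
  have [v vu] : exists v, v != u.
    apply: contrapT => no; have : #|G| <= 1.
      apply/fintype_le1P => x y.
      have xu z : z = u by apply/eqP; apply: contrapT => /negP h; apply: no; exists z.
      by rewrite (xu x) (xu y).
    by rewrite leqNgt (leq_trans _ G3).
  have := conn finset.set0; rewrite cards0 => /(_ isT u v); rewrite !inE => /(_ isT isT).
  case/connectP=> [[|t l] /=]; first by move=> _ e; rewrite e eqxx in vu.
  by case/andP=> [/and3P[_ _ ut] _ _]; exists t.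
have [u0 _] : exists u0 : G, true.
  by have /card_gt0P[u _] : 0 < #|G| by [exact: leq_trans G3]; exists u.
have [gam gamP] := edge_curves D.
have [po [v [w [vw [Lv gv] [Lw gw] right_of]]]] := apex_exists D gamP deg u0.
have [r [s cert]] := certificate_at D gamP deg right_of gv gw.
by exists v, w, r, s.
Qed.

(** * Formulas *)

Notation var22 := (var 2 2).
Definition vx (i : 'I_2) : var22 := inl i.
Definition vy (i : 'I_2) : var22 := inr i.
Notation x1 := (vx ord0).
Notation x2 := (vx ord_max).
Notation y1 := (vy ord0).
Notation y2 := (vy ord_max).

Lemma eq_sat (V : eqType) (G : sgraph) (f : formula V) (a b : V -> option G) :
  (forall v, is_free v f -> a v = b v) -> sat a f = sat b f.
Proof.
elim: f a b => [u v|u v|f IH|f IHf g IHg|f IHf g IHg|f IHf g IHg|q u f IH] a b /= e.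
- by rewrite !e ?eqxx ?orbT.
- by rewrite !e ?eqxx ?orbT.
- by rewrite (IH a b).
- by rewrite (IHf a b) ?(IHg a b) // => v h; apply: e; rewrite h ?orbT.
- by rewrite (IHf a b) ?(IHg a b) // => v h; apply: e; rewrite h ?orbT.
- by rewrite (IHf a b) ?(IHg a b) // => v h; apply: e; rewrite h ?orbT.
- have E z : sat [eta a with u |-> Some z] f = sat [eta b with u |-> Some z] f.
    by apply: IH => v h /=; case: eqP => // /eqP nvu; apply: e; rewrite nvu.
  case: q => [||n].
  + by apply: eq_forallb => z; apply: E.
  + by apply: eq_existsb => z; apply: E.
  + by rewrite (eq_card (B := [pred z | sat [eta b with u |-> Some z] f])).
Qed.

Fixpoint rename (V : Type) (s : V -> V) (f : formula V) : formula V :=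
  match f with
  | FEq u v => FEq (s u) (s v)
  | FAdj u v => FAdj (s u) (s v)
  | FNot g => FNot (rename s g)
  | FAnd g h => FAnd (rename s g) (rename s h)
  | FOr g h => FOr (rename s g) (rename s h)
  | FImp g h => FImp (rename s g) (rename s h)
  | FQuant q v g => FQuant q (s v) (rename s g)
  end.

Lemma sat_rename (V : eqType) (G : sgraph) (s : V -> V) (f : formula V)
    (a : V -> option G) :
  injective s -> sat a (rename s f) = sat (a \o s) f.
Proof.
move=> s_inj.
elim: f a => [u v|u v|f IH|f IHf g IHg|f IHf g IHg|f IHf g IHg|q u f IH] a //=;
  rewrite ?IH ?IHf ?IHg //.
have E z : sat [eta a with s u |-> Some z] (rename s f)
         = sat [eta (a \o s) with u |-> Some z] f.
  by rewrite IH; apply: eq_sat => v _ /=; rewrite (inj_eq s_inj).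
case: q => [||n].
- by apply: eq_forallb => z; apply: E.
- by apply: eq_existsb => z; apply: E.
- by rewrite (eq_card (B := [pred z | sat [eta (a \o s) with u |-> Some z] f])).
Qed.

Fixpoint quantifies_x_only (f : formula var22) : bool :=
  match f with
  | FEq _ _ | FAdj _ _ => true
  | FNot g => quantifies_x_only g
  | FAnd g h | FOr g h | FImp g h => quantifies_x_only g && quantifies_x_only h
  | FQuant _ v g => (if v is inl _ then true else false) && quantifies_x_only g
  end.

Lemma quantifies_x_only_sub q j g f :
  quantifies_x_only f -> ~ subformula (FQuant q (vy j) g) f.
Proof.
elim: f => [u v|u v|f IH|f IHf h IHh|f IHf h IHh|f IHf h IHh|r u f IH] //=.
- by move=> _ [].
- by move=> _ [].
- by move=> /IH n [].
- by move=> /andP[/IHf n /IHh m] [|[]].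
- by move=> /andP[/IHf n /IHh m] [|[]].
- by move=> /andP[/IHf n /IHh m] [|[]].
- by move=> /andP[hu /IH n] [[_ e _]|//]; rewrite -e in hu.
Qed.

(** Exchanging the two variables, bound occurrences included, lets a formula about [x1] speak about
    a vertex named [x2] without a third variable. *)
Definition xswap (v : var22) : var22 := if v is inl i then inl (rev_ord i) else v.

Lemma xswapK : involutive xswap.
Proof. by case=> //= i; rewrite rev_ordK. Qed.

Lemma xswap1 : xswap x1 = x2. Proof. by congr inl; apply: val_inj. Qed.
Lemma quantifies_x_only_xswap f :
  quantifies_x_only (rename xswap f) = quantifies_x_only f.
Proof. by elim: f => //= [? -> ? ->|? -> ? ->|? -> ? ->|q [i|j] f ->]. Qed.

Lemma ord2_cases (i : 'I_2) : i = ord0 \/ i = ord_max.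
Proof. by case: i => [[|[|//]] hi]; [left|right]; apply: val_inj. Qed.

(** Each [y] is quantified once, in front, and the rest quantifies only variables [x]; with no
    variable left free, nothing is requantified. *)
Lemma in_C_pin (q1 q2 : quantifier) (f : formula var22) :
  quantifies_x_only f -> ~~ is_free x1 f -> ~~ is_free x2 f ->
  let F := FQuant q1 y1 (FQuant q2 y2 f) in in_C F /\ sentence F.
Proof.
move=> xf f1 f2 F.
have sF : sentence F.
  case=> i; apply/negP; case: (ord2_cases i) => -> /and3P[n1 n2 h].
  - exact: (negP f1 h).
  - exact: (negP f2 h).
  - by move: n1; rewrite eqxx.
  - by move: n2; rewrite eqxx.
split=> // j [[h]|]; first by rewrite (negbTE (sF _)) in h.
move=> [q [g [q' [h [/= sub1 sub2]]]]].
have no q0 g0 := @quantifies_x_only_sub q0 j g0 f xf.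
case: sub1 => [[_ ej eg]|[[_ ej eg]|/no//]]; move: sub2; rewrite eg.
- by case=> [[_ ej' _]|/no//]; rewrite ej in ej'.
- by move/no.
Qed.

Section SatView.
Variables (V : eqType) (G : sgraph) (a : V -> option G).

Lemma sat_FAnd f g : sat a (FAnd f g) = sat a f && sat a g.
Proof. by []. Qed.

Lemma sat_geq n v f : sat a (FQuant (ExGeq n) v f) =
  (n <= #|[pred z | sat [eta a with v |-> Some z] f]|).
Proof. by []. Qed.

Lemma sat_exP v f :
  reflect (exists z, sat [eta a with v |-> Some z] f) (sat a (FQuant Ex v f)).
Proof. exact: existsP. Qed.

End SatView.

Definition FTrue : formula var22 := FQuant All x1 (FEq x1 x1).
Definition conj_all (s : seq (formula var22)) := foldr (@FAnd _) FTrue s.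

Lemma sat_FTrue (G : sgraph) (a : var22 -> option G) : sat a FTrue.
Proof. by apply/forallP => z /=. Qed.

Lemma sat_conj_all (G : sgraph) (a : var22 -> option G) s :
  sat a (conj_all s) = all (sat a) s.
Proof. by elim: s => [|f s IH]; [exact: sat_FTrue | rewrite /= IH]. Qed.

Lemma quantifies_x_only_conj_all s :
  quantifies_x_only (conj_all s) = all quantifies_x_only s.
Proof. by elim: s => //= f s ->. Qed.

Lemma is_free_conj_all v s : is_free v (conj_all s) = has (is_free v) s.
Proof. by elim: s => [|f s /= ->] //=; case: (v == x1). Qed.

Definition pinned (G : sgraph) (v w : G) (u : var22) : option G :=
  if u is inr j then Some (if j == ord0 then v else w) else None.


(** * Types over two pinned vertices *)

Record pointed := Pointed { pgraph : sgraph; pin1 : pgraph; pin2 : pgraph; point : pgraph }.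

Definition psat (P : pointed) (f : formula var22) : bool :=
  sat [eta pinned (pin1 P) (pin2 P) with x1 |-> Some (point P)] f.

Definition admissible (f : formula var22) := quantifies_x_only f && ~~ is_free x2 f.

(** As a Boolean function on formulas, a type is compared by plain equality, also across graphs, and
    can serve as a colour. *)
Definition ctype (P : pointed) : formula var22 -> bool :=
  fun f => admissible f && psat P f.

Lemma ctype_psat P Q f : admissible f -> ctype P = ctype Q -> psat P f = psat Q f.
Proof. by move=> af /(congr1 (fun t => t f)); rewrite /ctype af. Qed.

(** Take the conjunction of one formula for each member of the family, true at [P] and false at the
    member if its type differs; a separating formula is negated where it fails at [P]. *)
Lemma separate (I : finType) (F : I -> pointed) (P : pointed) :
  (exists i, ctype (F i) = ctype P) ->
  exists2 f, admissible f & forall i, psat (F i) f <-> ctype (F i) = ctype P.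
Proof.
move=> [i0 e0].
have H i : exists g, [/\ admissible g, psat P g & ctype (F i) <> ctype P -> ~~ psat (F i) g].
  case: (EM (ctype (F i) = ctype P)) => [e|ne].
    by exists FTrue; split; [ | exact: sat_FTrue | move=> h; case: (h e)].
  have [g gne] : exists g, ctype (F i) g <> ctype P g.
    by apply/existsNP => h; apply: ne; apply/funext.
  have ag : admissible g by apply/negPn/negP => ng; apply: gne; rewrite /ctype (negbTE ng).
  rewrite /ctype ag /= in gne; case: (boolP (psat P g)) => Pg.
    by exists g; split=> // _; apply/negP => Fg; rewrite Fg Pg in gne.
  exists (FNot g); split=> // _; rewrite /psat /= negbK -/(psat _ _).
  by apply/negPn/negP => Fg; rewrite (negbTE Fg) (negbTE Pg) in gne.
have [g gP] := choice H.
exists (conj_all [seq g i | i <- enum I]).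
  rewrite /admissible quantifies_x_only_conj_all is_free_conj_all has_map all_map.
  apply/andP; split; first by apply/allP => i _ /=; case: (gP i) => /andP[].
  by apply/hasPn => i _ /=; case: (gP i) => /andP[].
move=> i; have E Q : psat Q (conj_all [seq g i | i <- enum I]) = all (fun i => psat Q (g i)) (enum I).
  by rewrite /psat sat_conj_all all_map.
rewrite E; split=> [/allP h|e].
  apply: contrapT => ne; case: (gP i) => _ _ /(_ ne).
  by rewrite h // mem_enum.
apply/allP => j _; case: (gP j) => ag Pg _; by rewrite (ctype_psat ag e).
Qed.

Lemma sat_swap (G : sgraph) (a : var22 -> option G) f z t : ~~ is_free x2 f ->
  sat [eta [eta a with x1 |-> Some z] with x2 |-> Some t] (rename xswap f)
  = sat [eta a with x1 |-> Some t] f.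
Proof.
move=> f2; rewrite sat_rename; last exact: inv_inj xswapK.
apply: eq_sat => -[i|j] h //; case: (ord2_cases i) h => -> h.
- by rewrite -[inl ord0]/x1 /comp xswap1.
- by rewrite (negbTE f2) in h.
Qed.

Section TwoGraphs.
Variables (G H : sgraph) (v w : G) (v' w' : H).
Notation PG u := (@Pointed G v w u).
Notation PH u := (@Pointed H v' w' u).
Notation tG u := (ctype (PG u)).
Notation tH u := (ctype (PH u)).

(** A formula isolating the type among the vertices of both graphs, moved to [x2] by [xswap], is
    counted over the neighbours of [x1]. Comparing all thresholds [n] gives equal numbers. *)
Lemma ctype_nbr u u' P : tG u = tH u' ->
  #|[pred t | adj u t & tG t == ctype P]| = #|[pred t | adj u' t & tH t == ctype P]|.
Proof.
move=> uu; case: (EM (exists i : G + H, ctype (match i with inl t => PG t | inr t => PH t end) = ctype P)).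
  move=> /separate[f af fP].
  have fG t : psat (PG t) f = (tG t == ctype P).
    by apply/idP/eqP; case: (fP (inl t)).
  have fH t : psat (PH t) f = (tH t == ctype P).
    by apply/idP/eqP; case: (fP (inr t)).
  case/andP: (af) => xf f2.
  pose F n := FQuant (ExGeq n) x2 (FAnd (FAdj x1 x2) (rename xswap f)).
  have aF n : admissible (F n) by rewrite /admissible /= quantifies_x_only_xswap xf.
  have FG n : psat (PG u) (F n) = (n <= #|[pred t | adj u t & tG t == ctype P]|).
    rewrite /psat /F /=; congr (_ <= _); apply: eq_card => t.
    by rewrite !inE sat_swap // -fG.
  have FH n : psat (PH u') (F n) = (n <= #|[pred t | adj u' t & tH t == ctype P]|).
    rewrite /psat /F /=; congr (_ <= _); apply: eq_card => t.
    by rewrite !inE sat_swap // -fH.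
  have FGH n := ctype_psat (aF n) uu; apply/eqP; rewrite eqn_leq.
  by rewrite -FH -FGH FG leqnn -FG FGH FH leqnn.
move=> nex; rewrite !eq_card0 // => t; rewrite !inE; apply/andP => -[_ /eqP e];
  apply: nex; [by exists (inr t) | by exists (inl t)].
Qed.

Lemma ctype_pin1 u u' : tG u = tH u' -> (u == v) = (u' == v').
Proof. by move/(@ctype_psat _ _ (FEq x1 y1)) => /(_ isT). Qed.

Lemma ctype_pin2 u u' : tG u = tH u' -> (u == w) = (u' == w').
Proof. by move/(@ctype_psat _ _ (FEq x1 y2)) => /(_ isT). Qed.

End TwoGraphs.

Lemma sum_by_colour (A B : finType) (C : eqType) (P : pred A) (Q : pred B)
    (cA : A -> C) (cB : B -> C) (g : A -> nat) (h : B -> nat) :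
  (forall c, #|[pred t | P t & cA t == c]| = #|[pred t | Q t & cB t == c]|) ->
  (forall t t', cA t = cA t' -> g t = g t') -> (forall t t', cA t = cB t' -> g t = h t') ->
  \sum_(t | P t) g t = \sum_(t | Q t) h t.
Proof.
move=> cnt gg gh; pose F c := if [pick t | cA t == c] is Some t then g t else 0.
have FA t : F (cA t) = g t.
  by rewrite /F; case: pickP => [x /eqP/gg//|/(_ t)]; rewrite eqxx.
have FB t : Q t -> F (cB t) = h t.
  move=> Qt; rewrite /F; case: pickP => [x /eqP/gh//|no].
  have : 0 < #|[pred x | Q x & cB x == cB t]| by apply/card_gt0P; exists t; rewrite !inE Qt /=.
  by rewrite -cnt => /card_gt0P[x]; rewrite !inE no andbF.
rewrite -(eq_bigr _ (fun t _ => FA t)) -(eq_bigr _ FB).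
rewrite -big_filter -[RHS]big_filter.
rewrite -(big_map cA xpredT F) -(big_map cB xpredT F); apply: perm_big.
apply/allP => c _ /=; rewrite !count_map !count_filter; apply/eqP.
have E (T : finType) (R : pred T) (k : T -> C) :
    count [predI (preim k (pred1 c)) & R] (index_enum T) = #|[pred t | R t & k t == c]|.
  by rewrite -sum1_count sum1_card; apply: eq_card => t; rewrite !inE /= andbC.
by rewrite !E.
Qed.

(** The target of the walks is the first pin, so the type of the start determines their number. The
    graphs are quantified inside the induction because the summation also compares vertices of one
    and the same graph. *)
Lemma walks_ctype k (G H : sgraph) (v w u : G) (v' w' u' : H) :
  ctype (@Pointed G v w u) = ctype (@Pointed H v' w' u') ->
  walks (@adj G) k u v = walks (@adj H) k u' v'.
Proof.
elim: k G H v w u v' w' u' => [|k IH] G H v w u v' w' u' e /=.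
  by rewrite (ctype_pin1 e).
rewrite (IH _ _ _ _ _ _ _ _ e); congr (_ + _).
apply: (@sum_by_colour _ _ _ _ _ (fun t => ctype (@Pointed G v w t))
  (fun t => ctype (@Pointed H v' w' t))) => [c|t t' /IH//|t t' /IH//].
case: (EM (exists P, c = ctype P)) => [[P ->]|nc]; first exact: ctype_nbr.
rewrite !eq_card0 // => t; rewrite !inE; apply/andP => -[_ /eqP ec];
  by case: nc; rewrite -ec; eexists.
Qed.

Lemma colour_injection (A B : finType) (C : eqType) (cA : A -> C) (cB : B -> C) (b0 : B) :
  (forall a, #|[pred t | cA t == cA a]| = #|[pred t | cB t == cA a]|) ->
  exists2 phi : A -> B, injective phi & forall a, cB (phi a) = cA a.
Proof.
move=> cnt; pose sA c := enum [pred t | cA t == c]; pose sB c := enum [pred t | cB t == c].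
pose phi a := nth b0 (sB (cA a)) (seq.index a (sA (cA a))).
have memA a : a \in sA (cA a) by rewrite mem_enum inE /=.
have lt a : seq.index a (sA (cA a)) < size (sB (cA a)).
  by rewrite /sB -cardE -cnt cardE index_mem.
have cphi a : cB (phi a) = cA a.
  by have := mem_nth b0 (lt a); rewrite mem_enum inE => /eqP.
exists phi => // a a' e; have ec : cA a = cA a' by rewrite -!cphi e.
move: e; rewrite /phi; have := lt a'; have := lt a; have := memA a'; have := memA a.
rewrite ec => m m' l l' /eqP; rewrite nth_uniq ?enum_uniq // => /eqP ei.
by rewrite -(nth_index a m) ei nth_index.
Qed.

(** * From equal sentences to an isomorphism *)

Section Assembly.
Variables (G H : sgraph).
Hypothesis equiv : forall f : formula var22, in_C f -> sentence f -> holds G f = holds H f.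

Lemma sat_pin (K : sgraph) (a b : K) f : ~~ is_free x1 f -> ~~ is_free x2 f ->
  sat [eta [eta (fun _ : var22 => @None K) with y1 |-> Some a] with y2 |-> Some b] f =
  sat (pinned a b) f.
Proof.
move=> f1 f2; apply: eq_sat => -[i|j] h; first last.
  by case: (ord2_cases j) => ->.
by case: (ord2_cases i) h => -> h; [case: (negP f1 h) | case: (negP f2 h)].
Qed.

(* [x1] is bound to the first pin, which turns a type into a sentence over the pins. *)
Definition at_pin f := FQuant Ex x1 (FAnd (FEq x1 y1) f).

Lemma sat_at_pin (K : sgraph) (a b : K) f :
  sat (pinned a b) (at_pin f) = psat (@Pointed K a b a) f.
Proof.
apply/existsP/idP => [[z /andP[/eqP e h]]|h].
  by have za : z = a := e; rewrite za in h.
by exists a; apply/andP; split=> //; exact: eqxx.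
Qed.

Lemma admissible_at_pin f : admissible f ->
  [/\ quantifies_x_only (at_pin f), ~~ is_free x1 (at_pin f) & ~~ is_free x2 (at_pin f)].
Proof. by case/andP=> xf f2; split; rewrite /= ?eqxx. Qed.

(** If no pair of [H] had the type of the pins, a formula isolating that type among the finitely
    many pairs would become, under two existential quantifiers, a sentence true in [G] and false in
    [H]. *)
Lemma exists_equivalent_pins (v w : G) : exists v' w' : H,
  ctype (@Pointed G v w v) = ctype (@Pointed H v' w' v').
Proof.
apply: contrapT => no.
(* The index [None] adds the original pins, so that the type to be isolated occurs in the family. *)
pose F (i : option (H * H)) :=
  if i is Some p then @Pointed H p.1 p.2 p.1 else @Pointed G v w v.
have [|f af fP] := @separate _ F (@Pointed G v w v); first by exists None.
have [xf f1 f2] := admissible_at_pin af.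
have [FC FS] := in_C_pin Ex Ex xf f1 f2; have := equiv FC FS.
have -> : holds G (FQuant Ex y1 (FQuant Ex y2 (at_pin f))).
  rewrite /holds; apply/sat_exP; exists v; apply/sat_exP; exists w.
  by rewrite sat_pin // sat_at_pin; apply/(fP None).
move/esym; rewrite /holds => /sat_exP[v' /sat_exP[w']]; rewrite sat_pin // sat_at_pin.
move=> h; apply: no; exists v', w'; symmetry; exact/(fP (Some (v', w'))).
Qed.

(** With both pins at [t], the type of [t] determines the number of its closed walks. Binding [y2]
    to [y1] by an equation lets a counting quantifier on [y1] count the vertices of a given type of
    this kind. *)
Lemma closed_walks_equal k :
  \sum_u walks (@adj G) k u u = \sum_u walks (@adj H) k u u.
Proof.
apply: (@sum_by_colour _ _ _ _ _ (fun t => ctype (@Pointed G t t t))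
  (fun t => ctype (@Pointed H t t t))); try by move=> t t' /walks_ctype.
move=> c; case: (EM (exists i : G + H, match i with inl t => ctype (@Pointed G t t t)
    | inr t => ctype (@Pointed H t t t) end = c)) => [[i0 e0]|nc]; last first.
  rewrite !eq_card0 // => t; rewrite !inE /=; apply/eqP => ec; apply: nc;
    by [exists (inr t) | exists (inl t)].
pose F (i : G + H) := match i with inl t => @Pointed G t t t | inr t => @Pointed H t t t end.
have ce : c = ctype (F i0) by rewrite -e0 /F; case: (i0).
have [|f af fP] := @separate _ F (F i0); first by exists i0.
have [xf f1 f2] := admissible_at_pin af.
pose g := FAnd (FEq y1 y2) (at_pin f).
have cnt (K : sgraph) n : holds K (FQuant (ExGeq n) y1 (FQuant Ex y2 g)) =
    (n <= #|[pred t | psat (@Pointed K t t t) f]|).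
  rewrite /holds sat_geq; congr (_ <= _); apply: eq_card => t.
  rewrite [LHS]inE [RHS]inE; apply/sat_exP/idP => [[z]|h].
    by rewrite sat_pin // sat_FAnd sat_at_pin => /andP[/eqP tz]; rewrite /= in tz; rewrite -tz.
  by exists t; rewrite sat_pin // sat_FAnd sat_at_pin h andbT; exact: eqxx.
have eq n : (n <= #|[pred t | psat (@Pointed G t t t) f]|) =
            (n <= #|[pred t | psat (@Pointed H t t t) f]|).
  by rewrite -!cnt; have [|||gC gS] := @in_C_pin (ExGeq n) Ex g; rewrite //= ; exact: equiv.
have -> : #|[pred t | true & ctype (@Pointed G t t t) == c]| =
          #|[pred t | psat (@Pointed G t t t) f]|.
  by apply: eq_card => t; rewrite !inE /= ce; apply/eqP/idP; case: (fP (inl t)).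
have -> : #|[pred t | true & ctype (@Pointed H t t t) == c]| =
          #|[pred t | psat (@Pointed H t t t) f]|.
  by apply: eq_card => t; rewrite !inE /= ce; apply/eqP/idP; case: (fP (inr t)).
by apply/eqP; rewrite eqn_leq -eq leqnn eq leqnn.
Qed.

Variables (v w : G) (r : option G -> option G -> option G -> bool).
Variable s : option G -> option G -> bool.
Hypothesis cert : planar_certificate v w r s.
Hypothesis conn3 : k_connected 3 G.
Hypothesis vw : v != w.

(** Types have equal multiplicities in both graphs, so a type-preserving bijection [phi] exists. It
    need not respect edges: [untwist_iso] corrects it by swapping some mirror pairs. *)
Theorem equivalent_isomorphic : isomorphic G H.
Proof.
have [v' [w' ev]] := exists_equivalent_pins v w.
pose tG u := ctype (@Pointed G v w u); pose tH u := ctype (@Pointed H v' w' u).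
pose same : rel G := fun u t => tG u == tG t.
have same_refl : reflexive same by move=> u; exact: eqxx.
have same_sym : symmetric same by move=> u t; exact: eq_sym.
have same_trans : transitive same by move=> y x z /eqP + /eqP; rewrite /same => -> ->.
have nbE (u c : G) : nb same u c = #|[pred t | adj u t & tG t == tG c]|.
  by apply: eq_card => t; rewrite !inE /same eq_sym.
have eqt : equitable same by move=> u u' c /eqP uu; rewrite !nbE; exact: ctype_nbr.
have same_v t : same v t -> t = v.
  by move/eqP/ctype_pin1; rewrite eqxx => /esym/eqP.
have same_w t : same w t -> t = w.
  by move/eqP/ctype_pin2; rewrite eqxx => /esym/eqP.
have [f [hf f_same]] := height_exists conn3 vw same_refl same_sym same_trans eqt same_v same_w.
have [tau [K [[tauK same_tau] K_tau tau_K a_K K_conn]]] :=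
  reflection cert conn3 hf same_refl same_sym same_trans eqt f_same same_v same_w.
have cls P : #|[pred t | tG t == ctype P]| = #|[pred t | tH t == ctype P]|.
  case: (EM (exists i : G + H,
    ctype (match i with inl t => @Pointed G v w t | inr t => @Pointed H v' w' t end) = ctype P)).
    move=> /separate[g ag gP].
    pose F n := FQuant (ExGeq n) x2 (rename xswap g); case/andP: (ag) => xg g2.
    have aF n : admissible (F n) by rewrite /admissible /= quantifies_x_only_xswap xg.
    have FE (L : sgraph) (a b c : L) n : psat (@Pointed L a b c) (F n) =
        (n <= #|[pred t | psat (@Pointed L a b t) g]|).
      rewrite /psat /F /=; congr (_ <= _); apply: eq_card => t; by rewrite !inE sat_swap.
    have eqn n := ctype_psat (aF n) ev.
    have -> : #|[pred t | tG t == ctype P]| = #|[pred t | psat (@Pointed G v w t) g]|.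
      by apply: eq_card => t; rewrite !inE; apply/eqP/idP; case: (gP (inl t)).
    have -> : #|[pred t | tH t == ctype P]| = #|[pred t | psat (@Pointed H v' w' t) g]|.
      by apply: eq_card => t; rewrite !inE; apply/eqP/idP; case: (gP (inr t)).
    have eqn' n : (n <= #|[pred t | psat (@Pointed G v w t) g]|) =
        (n <= #|[pred t | psat (@Pointed H v' w' t) g]|).
      by rewrite -(FE _ _ _ v) -(FE _ _ _ v'); exact: eqn.
    by apply/eqP; rewrite eqn_leq -eqn' leqnn eqn' leqnn.
  move=> nex; rewrite !eq_card0 // => t; rewrite !inE; apply/eqP => e;
    apply: nex; [by exists (inr t) | by exists (inl t)].
have [phi phi_inj phiE] := @colour_injection _ _ _ tG tH v' (fun a => cls _).
have [phi' phi'_inj _] := @colour_injection _ _ _ tH tG v (fun a => esym (cls _)).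
have cGH : #|G| = #|H|.
  by apply/eqP; rewrite eqn_leq (leq_card phi phi_inj) (leq_card phi' phi'_inj).
have phi_bij : bijective phi by apply: inj_card_bij => //; rewrite cGH.
have [psi0 phiK psi0K] := phi_bij.
(* Pulling the edges of [H] back along [phi] places both graphs on one vertex set with the same
   pairs, as the twisting argument requires. *)
pose b : rel G := fun u t => adj (phi u) (phi t).
have ab_eq x x' t : same x x' -> nbr same (@adj G) x t = nbr same b x' t.
  move=> xx; have -> : nbr same (@adj G) x t = #|[pred z | adj x z & tG z == tG t]| := nbE x t.
  have e : tG x = tH (phi x') by rewrite phiE; exact/eqP.
  rewrite (ctype_nbr _ e) /nbr -(fintype.card_image phi_inj); apply: eq_card => z.
  rewrite inE; apply/andP/fintype.imageP => [[az /eqP tz]|[y]].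
    exists (psi0 z); rewrite ?psi0K // inE /b psi0K az /= /same eq_sym -phiE psi0K.
    exact/eqP.
  rewrite inE => /andP[by_ /eqP ty] ->; split; first exact: by_.
  by apply/eqP; first [exact: etrans (phiE y) (esym ty) | exact: etrans (phiE y) ty].
have walks_b k x z : walks b k x z = walks (@adj H) k (phi x) (phi z).
  elim: k x z => [|k IH] x z /=; first by rewrite (inj_eq phi_inj).
  rewrite IH; congr (_ + _); rewrite [RHS](reindex phi); last exact: onW_bij.
  by apply: eq_bigr => t _.
have cw k : \sum_u walks (@adj G) k u u = \sum_u walks b k u u.
  rewrite closed_walks_equal (reindex phi); last exact: onW_bij.
  by apply: eq_bigr => t _; rewrite walks_b.
have b_sym : symmetric b by move=> x z; exact: adj_sym.
have b_irr : irreflexive b by move=> x; exact: adj_irrefl.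
have [psi [psi_inj psiE]] := untwist_iso same_refl tauK same_tau K_tau tau_K
  (@adj_sym G) b_sym (@adj_irrefl G) b_irr ab_eq a_K K_conn cw.
exists (phi \o psi); last by move=> u t; exact: psiE.
by apply: inj_card_bij; [exact: inj_comp | rewrite cGH].
Qed.

End Assembly.

Theorem theorem35 (R : realType) (G : sgraph) :
  k_connected 3 G -> planar R G ->
  forall H : sgraph, ~ isomorphic G H ->
  exists f : formula (var 2 2),
    [/\ in_C f, sentence f & holds G f != holds H f].
Proof.
move=> conn3 pl H nH.
have [v [w [r [s [vw cert]]]]] := planar_has_certificate conn3 pl.
apply: contrapT => no; apply: nH.
apply: (equivalent_isomorphic _ cert conn3 vw) => f fC fs.
by apply/eqP; apply: contrapT => /negP ne; apply: no; exists f.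
Qed.
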